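(* The consistency problem for AtMost-NValue constraints admits an $O(\phi^k k^2+|\mathcal{I}|)$ time algorithm, where $k$ is the number of holes in the domains of the input instance $\mathcal{I}$ and $\phi=\frac{1+\sqrt{5}}{2}<1.6181$.
   Context: For a totally ordered set $D$ and $D'\subseteq D$, a hole in $D'$ is a pair $(u,w)\in D'\times D'$ such that some $v\in D\setminus D'$ satisfies $u<v<w$ and no $v'\in D'$ satisfies $u<v'<w$. An AtMost-NValue instance is $\mathcal{I}=(X,D,\mathit{dom},N)$ with $X=\{x_1,\dots,x_n\}$ a set of variables, $D$ a totally ordered set of values, $\mathit{dom}(x)\subseteq D$ nonempty for each $x\in X$, and $N$ an integer; it is consistent iff there is $S\subseteq D$ with $|S|\le N$ and $\mathit{dom}(x)\cap S\neq\emptyset$ for all $x\in X$. The number of holes $k$ is the sum over $x\in X$ of the number of holes in $\mathit{dom}(x)$. Domains are given succinctly by the endpoints of their maximal intervals, so $|\mathcal{I}|=O(n+|D|+k)$. *)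

(* Defs.v *)
From Stdlib Require Import Reals ZArith.
From mathcomp Require Import all_boot.
Set Implicit Arguments. Unset Strict Implicit. Unset Printing Implicit Defensive.

(* AtMost-NValue instances.  The finite totally ordered value set D is
   represented (up to order isomorphism) by 'I_d, the variables by 'I_n. *)

Definition is_hole (d : nat) (A : {set 'I_d}) (u w : 'I_d) : bool :=
  [&& u \in A, w \in A,
      [exists v : 'I_d, (v \notin A) && ((u < v) && (v < w))]%N
    & [forall v : 'I_d, ((u < v) && (v < w))%N ==> (v \notin A)]].

Definition nholes (d : nat) (A : {set 'I_d}) : nat :=
  #|[set p : 'I_d * 'I_d | is_hole A p.1 p.2]|.

Definition total_holes (n d : nat) (dom : 'I_n -> {set 'I_d}) : nat :=
  \sum_(x < n) nholes (dom x).

Definition consistent (n d : nat) (dom : 'I_n -> {set 'I_d}) (N : Z) : Prop :=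
  exists S : {set 'I_d}, (Z.of_nat #|S| <= N)%Z /\ forall x : 'I_n, dom x :&: S != set0.

(* Succinct encoding: each domain as the list of endpoints of its maximal
   intervals (in increasing order). *)
Definition memn (d : nat) (A : {set 'I_d}) (i : nat) : bool :=
  [exists v in A, val v == i].

Definition is_maxint (d : nat) (A : {set 'I_d}) (l r : nat) : bool :=
  [&& (l <= r)%N, all (memn A) (iota l (r - l).+1),
      (l == 0%N) || ~~ memn A l.-1 & ~~ memn A r.+1].

Definition intervals (d : nat) (A : {set 'I_d}) : seq (nat * nat) :=
  [seq (l, r) | l <- iota 0 d, r <- [seq r <- iota 0 d | is_maxint A l r]].

Definition encode (n d : nat) (dom : 'I_n -> {set 'I_d}) (N : Z) : seq nat :=
  [:: n; d; (if (N <? 0)%Z then 1 else 0); Z.abs_nat N] ++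
  flatten [seq size (intervals (dom x)) ::
                 flatten [seq [:: p.1; p.2] | p <- intervals (dom x)]
          | x <- enum 'I_n].

(* Machine model: a unit-cost RAM with unbounded natural-number cells and
   indirect addressing.  M[i] denotes memory cell i. *)
Inductive instr : Type :=
  | IConst (r v : nat)
  | IAdd (r a b : nat)
  | ISub (r a b : nat)       (* M[r] := M[a] - M[b]  (truncated) *)
  | ILoad (r a : nat)
  | IStore (a b : nat)
  | IJz (r t : nat)
  | IJmp (t : nat)
  | IHalt.                   (* stop; also any pc outside the program *)

Definition upd (m : nat -> nat) (i v : nat) : nat -> nat :=
  fun j => if j == i then v else m j.

(* exec P fuel pc m = Some m' iff the program halts, starting at pc with
   memory m, after at most fuel executed instructions (each costing one
   unit of time, including the final halt), with final memory m'. *)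
Fixpoint exec (P : seq instr) (fuel pc : nat) (m : nat -> nat) : option (nat -> nat) :=
  match fuel with
  | 0 => None
  | f.+1 =>
    match nth IHalt P pc with
    | IHalt => Some m
    | IConst r v => exec P f pc.+1 (upd m r v)
    | IAdd r a b => exec P f pc.+1 (upd m r (m a + m b))
    | ISub r a b => exec P f pc.+1 (upd m r (m a - m b))
    | ILoad r a => exec P f pc.+1 (upd m r (m (m a)))
    | IStore a b => exec P f pc.+1 (upd m (m a) (m b))
    | IJz r t => exec P f (if m r == 0 then t else pc.+1) m
    | IJmp t => exec P f t m
    end
  end.

Definition init_mem (w : seq nat) : nat -> nat := fun i => nth 0 w i.

Local Open Scope R_scope.
Definition phi : R := (1 + sqrt 5) / 2.

(* Main.v *)
(** Greedy sweep by right endpoints.  When the leftmost unhit interval is the last interval of its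
    variable (in particular its only one), a point is placed at its right endpoint, which is
    optimal among the points hitting it.  Otherwise one branches: place that point, or give the
    interval up.  Only the [k] intervals that are not last in their domain can branch, so this is a
    [2^k] algorithm.

    To get [phi^k], compare the two children [A] (point placed, variable [x] hit) and [B] (interval
    of [x] given up), with [a] and [b] points used so far, at the next interval that may branch.
    If neither child hits it already, placing a point at its end puts both children at the same position, and they
    differ only in [x].  If [b < a] the copy of [B] is at least as good, since one extra point pays
    for [x]; if [a <= b] the copy of [A] is at least as good.  Hence one of the two siblings need not
    place, and the number of nodes satisfies the Fibonacci recurrence
    [T(k) = T(k-1) + T(k-2)].

    The greedy steps forced by variables without holes are precomputed: tables give, for every value,
    the next greedy point and the last greedy point before the next branching position.  After a
    preprocessing linear in the instance every search node then costs a constant number of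
    instructions. *)

Require Import Defs.
From Stdlib Require Import Reals ZArith Lra.
From HB Require Import structures.
From mathcomp Require Import all_boot zify.
Set Implicit Arguments. Unset Strict Implicit. Unset Printing Implicit Defensive.

(** * A small imperative language compiled to the RAM *)

(** The dominance test of a node needs the state of its sibling, yet the two are explored at
    different times. Each node therefore carries the position and the count of its sibling and
    advances both copies with the same tables; as their hit sets differ at one variable only, this
    shadow costs constant time. A pruned node may reject a feasible subproblem, so correctness can
    be claimed only for the disjunction of two siblings.

    The hit set cannot be copied at each node either. It is stored as one bit per event, telling
    whether the variable is hit once that event is processed: a node reads the bit of the preceding
    interval of the same variable and determines the bit of its own event, and depth-first order
    keeps the bits of the current branch valid.

    One tree node is one iteration of one loop with a loop-free body, so the search time is the node
    count times a constant. With [x] intervals that are not last there are at most [2 * x] events,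
    hence at most [(2 * x + 1) * fib (x + 2)] nodes, and [x] is at most the number of holes. *)

Definition reach P pc m k pc' m' := forall f, exec P (k + f) pc m = exec P f pc' m'.

(** Quantifying [reach] over the leftover fuel turns composition into rewriting, with exact addition
    of the costs. *)
Lemma reach_trans P pc1 m1 k1 pc2 m2 k2 pc3 m3 :
  reach P pc1 m1 k1 pc2 m2 -> reach P pc2 m2 k2 pc3 m3 ->
  reach P pc1 m1 (k1 + k2) pc3 m3.
Proof. by move=> h1 h2 f; rewrite -addnA h1 h2. Qed.

Definition code_at (P : seq instr) pc (c : seq instr) :=
  forall i, i < size c -> nth IHalt P (pc + i) = nth IHalt c i.

Lemma code_at_cat P pc c1 c2 :
  code_at P pc (c1 ++ c2) -> code_at P pc c1 /\ code_at P (pc + size c1) c2.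
Proof.
move=> h; split=> i hi; first by rewrite h ?size_cat ?nth_cat ?hi //; lia.
rewrite -addnA h ?size_cat ?nth_cat; last by lia.
by rewrite ifF; [congr nth; lia | lia].
Qed.

Lemma code_at_cons P pc i c :
  code_at P pc (i :: c) -> nth IHalt P pc = i /\ code_at P pc.+1 c.
Proof.
by rewrite -cat1s => /code_at_cat[/(_ 0 isT)]; rewrite addn0 addn1.
Qed.

Lemma code_at_prefix pre c post : code_at (pre ++ c ++ post) (size pre) c.
Proof.
move=> i hi; rewrite nth_cat ifF; last by lia.
by rewrite addKn nth_cat hi.
Qed.

Lemma code_at0 c post : code_at (c ++ post) 0 c.
Proof. by move=> i hi; rewrite nth_cat hi. Qed.

Section Steps.

Variables (P : seq instr) (pc : nat) (m : nat -> nat).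

Lemma reach_const r v : nth IHalt P pc = IConst r v -> reach P pc m 1 pc.+1 (upd m r v).
Proof. by move=> h f; rewrite add1n /= h. Qed.

Lemma reach_add r a b : nth IHalt P pc = IAdd r a b -> reach P pc m 1 pc.+1 (upd m r (m a + m b)).
Proof. by move=> h f; rewrite add1n /= h. Qed.

Lemma reach_sub r a b : nth IHalt P pc = ISub r a b -> reach P pc m 1 pc.+1 (upd m r (m a - m b)).
Proof. by move=> h f; rewrite add1n /= h. Qed.

Lemma reach_load r a : nth IHalt P pc = ILoad r a -> reach P pc m 1 pc.+1 (upd m r (m (m a))).
Proof. by move=> h f; rewrite add1n /= h. Qed.

Lemma reach_store a b : nth IHalt P pc = IStore a b -> reach P pc m 1 pc.+1 (upd m (m a) (m b)).
Proof. by move=> h f; rewrite add1n /= h. Qed.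

Lemma reach_jz r t : nth IHalt P pc = IJz r t ->
  reach P pc m 1 (if m r == 0 then t else pc.+1) m.
Proof. by move=> h f; rewrite add1n /= h. Qed.

Lemma reach_jmp t : nth IHalt P pc = IJmp t -> reach P pc m 1 t m.
Proof. by move=> h f; rewrite add1n /= h. Qed.

End Steps.

Lemma updE m i v j : upd m i v j = if j == i then v else m j. Proof. by []. Qed.

Lemma upd_same m i v : upd m i v i = v. Proof. by rewrite /upd eqxx. Qed.

Lemma upd_other m i v j : j != i -> upd m i v j = m j.
Proof. by rewrite /upd => /negbTE->. Qed.

Inductive expr :=
  | Cst (v : nat) | Var (x : nat) | Plus (e1 e2 : expr) | Minus (e1 e2 : expr)
  | Get (a : nat) (e : expr) | Ite (e e1 e2 : expr).

Inductive cmd := Asg (x : nat) (e : expr) | Put (a : nat) (e1 e2 : expr).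

Record state := State { vars : nat -> nat; arrs : nat -> nat -> nat }.

Fixpoint eval s e := match e with
  | Cst v => v
  | Var x => vars s x
  | Plus e1 e2 => eval s e1 + eval s e2
  | Minus e1 e2 => eval s e1 - eval s e2
  | Get a e => arrs s a (eval s e)
  | Ite e e1 e2 => if eval s e == 0 then eval s e2 else eval s e1
  end.

Definition set_array (A : nat -> nat -> nat) a f : nat -> nat -> nat :=
  fun b => if b == a then f else A b.

Definition run1 s c := match c with
  | Asg x e => State (upd (vars s) x (eval s e)) (arrs s)
  | Put a e1 e2 => State (vars s) (set_array (arrs s) a (upd (arrs s a) (eval s e1) (eval s e2)))
  end.

Definition run s cs := foldl run1 s cs.

(** Loops are not nested: the cost of a run is then bounded by iteration counts times the length of
    the compiled code. *)
Record loop := Loop { init : seq cmd; test : expr; body : seq cmd }.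

Fixpoint steps l n s s' := match n with
  | 0 => s' = s
  | n'.+1 => eval s (test l) != 0 /\ steps l n' (run s (body l)) s'
  end.

Lemma steps_cat l n1 n2 s1 s2 s3 :
  steps l n1 s1 s2 -> steps l n2 s2 s3 -> steps l (n1 + n2) s1 s3.
Proof. by elim: n1 s1 => [s1 -> //|n1 IH s1 /= [h /IH{}IH] /IH]. Qed.

Definition run_loop l n s s' := steps l n (run s (init l)) s' /\ eval s' (test l) = 0.

Fixpoint run_loops ls n s s' := match ls with
  | [::] => n = 0 /\ s' = s
  | l :: ls' => exists n1 n2 s1, [/\ n = n1 + n2, run_loop l n1 s s1 & run_loops ls' n2 s1 s']
  end.

(* Cell 0 holds the base address [B] of the array zone, variable [x] lives in cell [x.+1], cells
   [nvars.+1 .. nregs - 1] are scratch, and entry [i] of array [a] is cell [B + 32 * i + a]: the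
   interleaving makes all the arrays unbounded. *)
Definition nvars := 40.
Definition nregs := 56.
Definition slot B a i := B + (i * 32 + a).

Definition represents (B : nat) s m :=
  [/\ nregs <= B, m 0 = B, forall x, x < nvars -> m x.+1 = vars s x
    & forall a i, a < 32 -> m (slot B a i) = arrs s a i].

(** The machine cannot multiply, so five doublings scale the index by 32; cell 0 then supplies the
    base [B]. *)
Definition address t a : seq instr :=
  nseq 5 (IAdd t t t) ++ [:: IConst t.+1 a; IAdd t t t.+1; IAdd t t 0].

(** The value ends up in cell [t] and the cells above it serve as evaluation stack; [pc] is passed
    along because jump targets are absolute. *)
Fixpoint comp t pc e : seq instr := match e with
  | Cst v => [:: IConst t v]
  | Var x => [:: IConst t 0; IAdd t t x.+1]
  | Plus e1 e2 => let c1 := comp t pc e1 in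
      c1 ++ comp t.+1 (pc + size c1) e2 ++ [:: IAdd t t t.+1]
  | Minus e1 e2 => let c1 := comp t pc e1 in
      c1 ++ comp t.+1 (pc + size c1) e2 ++ [:: ISub t t t.+1]
  | Get a e => comp t pc e ++ address t a ++ [:: ILoad t t]
  | Ite e e1 e2 =>
      let c := comp t pc e in
      let pc1 := (pc + size c).+1 in
      let c1 := comp t pc1 e1 in
      let pc2 := (pc1 + size c1).+1 in
      let c2 := comp t pc2 e2 in
      c ++ IJz t pc2 :: c1 ++ IJmp (pc2 + size c2) :: c2
  end.

Fixpoint fits t e := match e with
  | Cst _ => t < nregs
  | Var x => (t < nregs) && (x < nvars)
  | Plus e1 e2 | Minus e1 e2 => [&& t < nregs, fits t e1 & fits t.+1 e2]
  | Get a e => [&& t.+1 < nregs, a < 32 & fits t e]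
  | Ite e e1 e2 => [&& fits t e, fits t e1 & fits t e2]
  end.

Definition agree_off t (m m' : nat -> nat) := forall j, (j < t) || (nregs <= j) -> m' j = m j.

Lemma agree_trans t m1 m2 m3 : agree_off t m1 m2 -> agree_off t m2 m3 -> agree_off t m1 m3.
Proof. by move=> h1 h2 j hj; rewrite h2 // h1. Qed.

Lemma agree_sub t t' m1 m2 : t <= t' -> agree_off t' m1 m2 -> agree_off t m1 m2.
Proof. by move=> h h1 j hj; apply: h1; lia. Qed.

Lemma agree_upd t j m v : t <= j < nregs -> agree_off t m (upd m j v).
Proof. by move=> h i hi; apply: upd_other; lia. Qed.

Lemma represents_agree B s t m m' : nvars < t -> represents B s m -> agree_off t m m' ->
  represents B s m'.
Proof.
move=> ht [h1 h2 h3 h4] h; split=> // [|x hx|a i ha]; rewrite h ?h2 ?h3 ?h4 //; try lia.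
by rewrite /slot; lia.
Qed.

Lemma address_ok P B s t pc m a : nvars < t -> t.+1 < nregs ->
  code_at P pc (address t a) -> represents B s m ->
  exists m', [/\ reach P pc m 8 (pc + 8) m', m' t = slot B a (m t) & agree_off t m m'].
Proof.
move=> ht tn hc hr; have m0 : m 0 = B by case: hr.
rewrite /address /= in hc.
have [i1 /code_at_cons[i2 /code_at_cons[i3 /code_at_cons[i4 /code_at_cons[i5
  /code_at_cons[i6 /code_at_cons[i7 /code_at_cons[i8 _]]]]]]]] := code_at_cons hc.
have t0 : (t == 0) = false by lia.
have tt : (t == t.+1) = false by lia.
eexists; split.
- have -> : pc + 8 = pc.+4.+4 by lia.
  apply: (reach_trans (k1 := 1)); first exact: reach_add i1.
  apply: (reach_trans (k1 := 1) (k2 := 6)); first exact: reach_add i2.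
  apply: (reach_trans (k1 := 1) (k2 := 5)); first exact: reach_add i3.
  apply: (reach_trans (k1 := 1) (k2 := 4)); first exact: reach_add i4.
  apply: (reach_trans (k1 := 1) (k2 := 3)); first exact: reach_add i5.
  apply: (reach_trans (k1 := 1) (k2 := 2)); first exact: reach_const i6.
  apply: (reach_trans (k1 := 1) (k2 := 1)); first exact: reach_add i7.
  exact: reach_add i8.
- by rewrite /upd !eqxx tt eq_sym t0 /= m0 /slot; lia.
- do 8!(apply: agree_trans; last by apply: agree_upd; lia).
  by [].
Qed.

(** Compiled expressions jump forward only, so every instruction runs at most once and the code
    length bounds the cost. *)
Lemma comp_ok P B s e t pc m : nvars < t -> fits t e -> code_at P pc (comp t pc e) ->
  represents B s m -> exists k m',
  [/\ k <= size (comp t pc e), reach P pc m k (pc + size (comp t pc e)) m',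
      m' t = eval s e & agree_off t m m'].
Proof.
elim: e t pc m => /=.
- move=> v t pc m ht tn /code_at_cons[i1 _] hr; exists 1, (upd m t v).
  by split; rewrite ?addn1 ?upd_same //; [exact: reach_const|apply: agree_upd; lia].
- move=> x t pc m ht /andP[tn xn] /code_at_cons[i1 /code_at_cons[i2 _]] hr.
  exists 2; eexists; split; first by [].
  + rewrite addn2; apply: (reach_trans (k1 := 1) (k2 := 1)); first exact: reach_const i1.
    exact: reach_add i2.
  + rewrite /upd !eqxx add0n ifF; last by lia.
    by case: hr => _ _ -> .
  + by do 2!(apply: agree_trans; last by apply: agree_upd; lia).
- move=> e1 IH1 e2 IH2 t pc m ht /and3P[tn f1 f2] /code_at_cat[c1 /code_at_cat[c2 /code_at_cons[i3 _]]] hr.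
  have [k1 [m1 [hk1 r1 v1 a1]]] := IH1 t pc m ht f1 c1 hr.
  have hr1 := represents_agree ht hr a1.
  have [k2 [m2 [hk2 r2 v2 a2]]] := IH2 t.+1 _ m1 (ltnW ht) f2 c2 hr1.
  exists (k1 + (k2 + 1)); eexists; split.
  + by rewrite !size_cat /=; lia.
  + apply: reach_trans r1 _; apply: reach_trans r2 _.
    by rewrite !size_cat /= addnA addnA addn1; exact: reach_add i3.
  + by rewrite upd_same v2 a2 ?v1 // ltnSn.
  + apply: agree_trans a1 _; apply: agree_trans (agree_sub (leqnSn t) a2) _.
    by apply: agree_upd; lia.
- move=> e1 IH1 e2 IH2 t pc m ht /and3P[tn f1 f2] /code_at_cat[c1 /code_at_cat[c2 /code_at_cons[i3 _]]] hr.
  have [k1 [m1 [hk1 r1 v1 a1]]] := IH1 t pc m ht f1 c1 hr.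
  have hr1 := represents_agree ht hr a1.
  have [k2 [m2 [hk2 r2 v2 a2]]] := IH2 t.+1 _ m1 (ltnW ht) f2 c2 hr1.
  exists (k1 + (k2 + 1)); eexists; split.
  + by rewrite !size_cat /=; lia.
  + apply: reach_trans r1 _; apply: reach_trans r2 _.
    by rewrite !size_cat /= addnA addnA addn1; exact: reach_sub i3.
  + by rewrite upd_same v2 a2 ?v1 // ltnSn.
  + apply: agree_trans a1 _; apply: agree_trans (agree_sub (leqnSn t) a2) _.
    by apply: agree_upd; lia.
- move=> a e IH t pc m ht /and3P[tn a32 f] /code_at_cat[c1 h] hr.
  have {h} /code_at_cat[c2 /code_at_cons[i3 _]] :
    code_at P (pc + size (comp t pc e)) (address t a ++ [:: ILoad t t]) by [].
  have [k1 [m1 [hk1 r1 v1 a1]]] := IH t pc m ht f c1 hr.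
  have hr1 := represents_agree ht hr a1.
  have [m2 [r2 v2 a2]] := address_ok ht tn c2 hr1.
  exists (k1 + (8 + 1)); eexists; split.
  + by rewrite !size_cat /=; lia.
  + apply: reach_trans r1 _; apply: reach_trans r2 _.
    have := reach_load m2 (i3 : nth IHalt P (pc + size (comp t pc e) + 8) = _).
    rewrite size_cat /=; have -> : pc + (size (comp t pc e) + 9) = (pc + size (comp t pc e) + 8).+1 by lia.
    exact.
  + have [_ _ _ h] := represents_agree ht hr1 a2.
    by rewrite upd_same v2 v1 h.
  + apply: agree_trans a1 _; apply: agree_trans a2 _.
    by apply: agree_upd; lia.
move=> e IH e1 IH1 e2 IH2 t pc m ht /and3P[f f1 f2].
move=> /code_at_cat[c /code_at_cons[i0 /code_at_cat[c1 /code_at_cons[i1 c2]]]] hr.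
have [k0 [m0 [hk0 r0 v0 a0]]] := IH t pc m ht f c hr.
have hr0 := represents_agree ht hr a0.
rewrite !size_cat /= !size_cat /=.
set pc1 := (pc + _).+1 in i0 c1 i1 c2 *; set pc2 := (pc1 + _).+1 in i0 c2 i1 *.
have rj := reach_jz m0 i0; rewrite v0 in rj.
case: eqP rj => he rj.
  have [k2 [m2 [hk2 r2 v2 a2]]] := IH2 t pc2 m0 ht f2 c2 hr0.
  exists (k0 + (1 + k2)), m2; split=> //; first by lia.
    apply: reach_trans r0 _; apply: reach_trans rj _.
    move: r2; congr (reach _ _ _ _ _ _); rewrite /pc2 /pc1; lia.
  exact: agree_trans a0 a2.
have [k1 [m1 [hk1 r1 v1 a1]]] := IH1 t pc1 m0 ht f1 c1 hr0.
exists (k0 + (1 + (k1 + 1))), m1; split=> //; first by lia.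
  apply: reach_trans r0 _; apply: reach_trans rj _; apply: reach_trans r1 _.
  have := reach_jmp m1 i1; congr (reach _ _ _ _ _ _); rewrite /pc2 /pc1; lia.
exact: agree_trans a0 a1.
Qed.

Definition scratch := nvars.+1.

Lemma scratchP : nvars < scratch. Proof. exact: ltnSn. Qed.

Definition comp_cmd pc c := match c with
  | Asg x e => comp scratch pc e ++ [:: IConst x.+1 0; IAdd x.+1 x.+1 scratch]
  | Put a e1 e2 => let c1 := comp scratch pc e1 in
      c1 ++ address scratch a ++ comp scratch.+1 (pc + size c1 + 8) e2 ++
      [:: IStore scratch scratch.+1]
  end.

Definition cmd_fits c := match c with
  | Asg x e => (x < nvars) && fits scratch e
  | Put a e1 e2 => [&& a < 32, fits scratch e1 & fits scratch.+1 e2]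
  end.

Lemma comp_cmd_ok P B s c pc m : cmd_fits c -> code_at P pc (comp_cmd pc c) ->
  represents B s m -> exists k m',
  [/\ k <= size (comp_cmd pc c), reach P pc m k (pc + size (comp_cmd pc c)) m'
    & represents B (run1 s c) m'].
Proof.
case: c => [x e|a e1 e2].
  move=> /=/andP[xn fe] /code_at_cat[c1 /code_at_cons[i1 /code_at_cons[i2 _]]] hr.
  have [k1 [m1 [hk1 r1 v1 a1]]] := comp_ok scratchP fe c1 hr.
  have [h1 h2 h3 h4] := represents_agree scratchP hr a1.
  exists (k1 + (1 + 1)); eexists; split.
  - by rewrite size_cat /=; lia.
  - apply: reach_trans r1 _; rewrite size_cat /= addnA addn2.
    by apply: reach_trans; [exact: reach_const i1|exact: reach_add i2].
  - split=> //= [y yn|b i b32].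
    + rewrite /upd eqSS eqxx; case: (eqVneq y x) => _; last by rewrite h3.
      rewrite add0n ifF ?v1 //; rewrite /scratch /nvars in xn *; lia.
    + by rewrite !upd_other ?h4 // /slot; rewrite /nregs /nvars in h1 xn; lia.
move=> /and3P[a32 f1 f2] /code_at_cat[c1 /code_at_cat[ca /code_at_cat[c2 /code_at_cons[i3 _]]]] hr.
have e8 : size (address scratch a) = 8 by [].
rewrite e8 in c2 i3.
have [k1 [m1 [hk1 r1 v1 a1]]] := comp_ok scratchP f1 c1 hr.
have hr1 := represents_agree scratchP hr a1.
have [|m2 [r2 v2 a2]] := address_ok scratchP _ ca hr1; first by [].
have hr2 := represents_agree scratchP hr1 a2.
have ns : nvars < scratch.+1 by [].
have [k3 [m3 [hk3 r3 v3 a3]]] := comp_ok ns f2 c2 hr2.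
have [h1 h2 h3 h4] := represents_agree ns hr2 a3.
have v3s : m3 scratch = slot B a (eval s e1) by rewrite a3 ?ltnSn // v2 v1.
exists (k1 + (8 + (k3 + 1))); eexists; rewrite /comp_cmd; split.
- by rewrite !size_cat /=; lia.
- apply: reach_trans r1 _; apply: reach_trans r2 _; apply: reach_trans r3 _.
  have -> : pc + size (comp scratch pc e1 ++ address scratch a ++
      comp scratch.+1 (pc + size (comp scratch pc e1) + 8) e2 ++ [:: IStore scratch scratch.+1])
    = (pc + size (comp scratch pc e1) + 8
       + size (comp scratch.+1 (pc + size (comp scratch pc e1) + 8) e2)).+1.
    by rewrite !size_cat /=; lia.
  exact: reach_store i3.
- rewrite v3s v3; split=> //= [|y yn|b i b32].
  + by rewrite upd_other // /slot; rewrite /nregs in h1; lia.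
  + by rewrite upd_other ?h3 // /slot; rewrite /nregs /nvars in h1 yn *; lia.
  + rewrite /set_array; case: eqVneq => [->|ba]; last by rewrite upd_other ?h4 // /slot; move: ba; lia.
    rewrite /upd h4 //; case: (eqVneq i) => [->|ij]; first by rewrite eqxx.
    by rewrite ifF // /slot; lia.
Qed.

Fixpoint comp_cmds pc cs := match cs with
  | [::] => [::]
  | c :: cs' => comp_cmd pc c ++ comp_cmds (pc + size (comp_cmd pc c)) cs'
  end.

Lemma comp_cmds_ok P B s cs pc m : all cmd_fits cs -> code_at P pc (comp_cmds pc cs) ->
  represents B s m -> exists k m',
  [/\ k <= size (comp_cmds pc cs), reach P pc m k (pc + size (comp_cmds pc cs)) m'
    & represents B (run s cs) m'].
Proof.
elim: cs s pc m => [|c cs IH] s pc m.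
  by move=> _ _ hr; exists 0, m; rewrite addn0.
move=> /andP[fc fcs] /code_at_cat[c1 c2] hr.
have [k1 [m1 [hk1 r1 hr1]]] := comp_cmd_ok fc c1 hr.
have [k2 [m2 [hk2 r2 hr2]]] := IH _ _ _ fcs c2 hr1.
exists (k1 + k2), m2; split=> //; first by rewrite /= size_cat leq_add.
by apply: reach_trans r1 _; rewrite /= size_cat addnA.
Qed.

Definition comp_loop pc l :=
  let ci := comp_cmds pc (init l) in
  let pc1 := pc + size ci in
  let ct := comp scratch pc1 (test l) in
  let pc2 := (pc1 + size ct).+1 in
  let cb := comp_cmds pc2 (body l) in
  ci ++ ct ++ IJz scratch (pc2 + size cb).+1 :: cb ++ [:: IJmp pc1].

Definition loop_fits l := [&& all cmd_fits (init l), fits scratch (test l) & all cmd_fits (body l)].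

Lemma comp_loop_ok P B s l n s' pc m : loop_fits l -> code_at P pc (comp_loop pc l) ->
  represents B s m -> run_loop l n s s' -> exists k m',
  [/\ k <= n.+1 * size (comp_loop pc l), reach P pc m k (pc + size (comp_loop pc l)) m'
    & represents B s' m'].
Proof.
move=> /and3P[f1 f2 f3] /code_at_cat[c1 /code_at_cat[c2 /code_at_cons[i1 /code_at_cat[c3]]]].
move=> /code_at_cons[i2 _] hr [st t0].
rewrite /comp_loop !size_cat /= size_cat /=.
have [k0 [m0 [hk0 r0 hr0]]] := comp_cmds_ok f1 c1 hr.
set pc1 := pc + size _ in c2 i1 c3 i2 r0 *.
set ct := comp _ _ _ in c2 i1 c3 i2 *.
set pc2 := (pc1 + _).+1 in i1 c3 i2 *.
set cb := comp_cmds pc2 _ in i1 c3 i2 *.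
set K := size ct + (size cb + 1).+1.
(* Each of the [n.+1] evaluations of the test is charged [K], which also pays for one body and both
   jumps; the initialisation is added afterwards. *)
have [k [m' [hk r' hr']]] : exists k m',
    [/\ k <= n.+1 * K, reach P pc1 m0 k (pc2 + size cb).+1 m' & represents B s' m'].
  clear r0; elim: n m0 (run s (init l)) hr0 st => [|n IH] m1 s1 hr1 /=.
    move=> st; rewrite -{}st in hr1 *.
    have [k2 [m2 [hk2 r2 v2 a2]]] := comp_ok scratchP f2 c2 hr1.
    rewrite -/ct in hk2 r2.
    have rj := reach_jz m2 i1; rewrite v2 t0 eqxx in rj.
    exists (k2 + 1), m2; split; first by rewrite mul1n /K; lia.
      exact: reach_trans r2 rj.
    exact: represents_agree scratchP hr1 a2.
  case=> /negbTE tn st.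
  have [k2 [m2 [hk2 r2 v2 a2]]] := comp_ok scratchP f2 c2 hr1.
    rewrite -/ct in hk2 r2.
  have rj := reach_jz m2 i1; rewrite v2 tn in rj.
  have hr2 := represents_agree scratchP hr1 a2.
  have [k3 [m3 [hk3 r3 hr3]]] := comp_cmds_ok f3 c3 hr2.
  rewrite -/cb in hk3 r3.
  have [k4 [m4 [hk4 r4 hr4]]] := IH _ _ hr3 st.
  exists (k2 + (1 + (k3 + (1 + k4)))), m4; split=> //; first by rewrite mulSn /K in hk4 *; lia.
  apply: reach_trans r2 _; apply: reach_trans rj _; apply: reach_trans r3 _.
  by apply: reach_trans r4; exact: reach_jmp i2.
exists (k0 + k), m'; split=> //.
  apply: leq_trans (leq_add hk0 hk) _; rewrite -/K mulnDr leq_add2r.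
  exact: leq_pmull.
have -> : pc + (size (comp_cmds pc (init l)) + (size ct + (size cb + 1).+1)) = (pc2 + size cb).+1.
  by rewrite /pc2 /pc1; lia.
exact: reach_trans r0 r'.
Qed.

Fixpoint comp_loops pc ls := match ls with
  | [::] => [::]
  | l :: ls' => comp_loop pc l ++ comp_loops (pc + size (comp_loop pc l)) ls'
  end.

Lemma comp_loops_ok P B s ls n s' pc m : all loop_fits ls -> code_at P pc (comp_loops pc ls) ->
  represents B s m -> run_loops ls n s s' -> exists k m',
  [/\ k <= (n + size ls) * size (comp_loops pc ls),
      reach P pc m k (pc + size (comp_loops pc ls)) m' & represents B s' m'].
Proof.
elim: ls n s pc m => [|l ls IH] n s pc m.
  by move=> _ _ hr [-> ->]; exists 0, m; split; rewrite /= ?addn0.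
move=> /andP[fl fls] /code_at_cat[c1 c2] hr [n1 [n2 [s1 [-> h1 h2]]]].
have [k1 [m1 [hk1 r1 hr1]]] := comp_loop_ok fl c1 hr h1.
have [k2 [m2 [hk2 r2 hr2]]] := IH _ _ _ _ fls c2 hr1 h2.
exists (k1 + k2), m2; split=> //; last first.
  by apply: reach_trans r1 _; rewrite /= size_cat addnA.
rewrite /= size_cat; nia.
Qed.

(** * Moving the input out of the register area *)

Definition record_of (iv : seq (nat * nat)) : seq nat :=
  size iv :: flatten [seq [:: p.1; p.2] | p <- iv].

Definition records ivs := flatten (map record_of ivs).

Lemma size_record iv : size (record_of iv) = (size iv).*2.+1.
Proof. by rewrite /record_of /=; elim: iv => //= p iv /= ->; rewrite doubleS. Qed.

Lemma records_rcons us v : records (rcons us v) = records us ++ record_of v.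
Proof. by rewrite /records map_rcons flatten_rcons. Qed.

(* Before the input has been moved only cells 0 and 2 are available: they hold the address of the
   current record and its length.  A record never starts with 0, so cell [E] just after
   the input is the first record head that is 0. *)
Definition find_end : seq instr :=
  [:: IJz 2 3; IConst 0 0; IHalt; IConst 0 4;
      ILoad 2 0; IJz 2 11; IAdd 0 0 2; IAdd 0 0 2; IConst 2 1; IAdd 0 0 2; IJmp 4;
      IConst 2 nregs; IAdd 0 0 2].

(** Unrolled, because the target address must be formed in cell 2 alone: any other register would
    destroy an input cell not yet copied. Once the low cells are saved, [copy_high] may use them as
    registers of a loop. *)
Definition copy_low ks : seq instr :=
  flatten [seq [:: IConst 2 (i * 32); IAdd 2 2 0; IStore 2 i] | i <- ks].

Definition copy_high pc : seq instr :=
  [:: IConst 1 nregs; IConst 3 1; IConst 5 nregs; ISub 4 0 5;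
      ISub 6 4 1; IJz 6 (pc + 18); ILoad 5 1; IConst 2 0; IAdd 2 2 1] ++
  nseq 5 (IAdd 2 2 2) ++ [:: IAdd 2 2 0; IStore 2 5; IAdd 1 1 3; IJmp (pc + 4)].

Definition prologue :=
  let c1 := find_end in let c2 := copy_low (iota 1 nregs.-1) in
  c1 ++ c2 ++ copy_high (size c1 + size c2).

(** Entries 0 and 2 of array 0 are left unspecified: these input cells (number of variables, sign
    flag) were overwritten as registers, and the later loops do not read them. *)
Definition moved w k (m : nat -> nat) :=
  let B := size w + nregs in
  [/\ m 0 = B, forall j, nregs <= j < B -> m j = nth 0 w j
    & forall a i, a < 32 -> (a != 0) || (i != 0) && (i != 2) ->
        m (slot B a i) = if (a == 0) && (i < k) then nth 0 w i else 0].

Ltac code_step h i := let h' := fresh in have [i h'] := code_at_cons h; clear h; rename h' into h.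

Lemma find_end_ok P hdr ivs m : code_at P 0 find_end -> size hdr = 4 -> all (fun iv : seq (nat * nat) => 0 < size iv) ivs ->
  (forall j, m j = nth 0 (hdr ++ records ivs) j) -> nth 0 hdr 2 = 0 ->
  exists k m', [/\ k <= 7 * size ivs + 6, reach P 0 m k 13 m',
    m' 0 = size (hdr ++ records ivs) + nregs &
    forall j, j != 0 -> j != 2 -> m' j = nth 0 (hdr ++ records ivs) j].
Proof.
move=> hc sh nz hm h2; set w := hdr ++ _ in hm *.
code_step hc i0; code_step hc i1; code_step hc i2; code_step hc i3; code_step hc i4.
code_step hc i5; code_step hc i6; code_step hc i7; code_step hc i8; code_step hc i9.
code_step hc i10; code_step hc i11; code_step hc i12.
(* Invariant of the walk: the records [us] have been skipped and cell 0 is the address of the next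
   record head, 4 being the length of the header. *)
have walk us vs m1 : ivs = us ++ vs -> m1 0 = 4 + size (records us) ->
    (forall j, j != 0 -> j != 2 -> m1 j = nth 0 w j) ->
    exists k m', [/\ k <= 7 * size vs + 2, reach P 4 m1 k 11 m', m' 0 = size w &
      forall j, j != 0 -> j != 2 -> m' j = nth 0 w j].
  elim: vs us m1 => [|v vs IH] us m1 euv m10 hm1.
    have ev : m1 (m1 0) = 0.
      rewrite hm1 m10 // nth_default // /w euv cats0 size_cat sh; lia.
    exists (1 + 1), (upd m1 2 0); split=> //=.
    - apply: reach_trans; first exact: reach_load i4.
      by have := reach_jz (upd m1 2 (m1 (m1 0))) i5; rewrite upd_same ev eqxx.
    - by rewrite /upd /= m10 /w euv cats0 size_cat sh.
    - by move=> j j0 j2; rewrite upd_other // hm1.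
  have hw : w = hdr ++ records us ++ record_of v ++ records vs.
    by rewrite /w euv /records map_cat flatten_cat /=.
  have ev : m1 (m1 0) = size v.
    rewrite hm1 m10 // hw nth_cat sh ltnNge leq_addr /= addKn nth_cat ltnn subnn.
    by [].
  have v0 : (size v == 0) = false.
    by move: nz; rewrite euv all_cat /= lt0n => /and3P[_ /negbTE].
  set m2 := upd m1 2 (m1 (m1 0)).
  have r1 : reach P 4 m1 1 5 m2 by exact: reach_load i4.
  have r2 : reach P 5 m2 1 6 m2.
    by have := reach_jz m2 i5; rewrite /m2 upd_same ev v0.
  have r3 := reach_add m2 i6; set m3 := upd m2 0 _ in r3.
  have r4 := reach_add m3 i7; set m4 := upd m3 0 _ in r4.
  have r5 := reach_const m4 i8; set m5 := upd m4 2 _ in r5.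
  have r6 := reach_add m5 i9; set m6 := upd m5 0 _ in r6.
  have r7 := reach_jmp m6 i10.
  have m60 : m6 0 = 4 + size (records (rcons us v)).
    rewrite /m6 /m5 /m4 /m3 /m2 /upd /= ev m10 records_rcons size_cat size_record.
    by rewrite -addnn; lia.
  have [|j j0 j2|k [m' [hk r hm' hj]]] := IH (rcons us v) m6 _ m60.
  - by rewrite cat_rcons.
  - by rewrite /m6 /m5 /m4 /m3 /m2 !upd_other // hm1.
  exists (1 + (1 + (1 + (1 + (1 + (1 + (1 + k))))))), m'; split=> //=; first by lia.
  apply: reach_trans r1 _; apply: reach_trans r2 _; apply: reach_trans r3 _.
  apply: reach_trans r4 _; apply: reach_trans r5 _; apply: reach_trans r6 _.
  exact: reach_trans r7 r.
have m2z : m 2 = 0 by rewrite hm /w nth_cat sh.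
have r0 : reach P 0 m 1 3 m by have := reach_jz m i0; rewrite m2z eqxx.
have r1 := reach_const m i3.
have [|//||k [m1 [hk r2 m10 hm1]]] := walk [::] ivs (upd m 0 4).
- by [].
- by move=> j j0 j2; rewrite upd_other // hm.
have r3 := reach_const m1 i11; set m2 := upd m1 2 _ in r3.
have r4 := reach_add m2 i12; set m3 := upd m2 0 _ in r4.
exists (1 + (1 + (k + (1 + 1)))), m3; split.
- by lia.
- apply: reach_trans r0 _; apply: reach_trans r1 _; apply: reach_trans r2 _.
  exact: reach_trans r3 r4.
- by rewrite /m3 /m2 /upd /= m10.
- by move=> j j0 j2; rewrite /m3 /m2 !upd_other // hm1.
Qed.

Lemma slot_inj B a i b j : a < 32 -> b < 32 -> (slot B a i == slot B b j) = (a == b) && (i == j).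
Proof. by move=> a32 b32; apply/eqP/andP=> [|[/eqP-> /eqP->//]]; rewrite /slot => h; split; apply/eqP; lia. Qed.

Lemma copy_low_ok P pc w n k m : code_at P pc (copy_low (iota k n)) -> 0 < k -> k + n <= nregs ->
  moved w k m -> (forall j, j != 0 -> j != 2 -> j < nregs -> m j = nth 0 w j) ->
  exists m', reach P pc m (3 * n) (pc + 3 * n) m' /\ moved w (k + n) m'.
Proof.
elim: n k pc m => [|n IH] k pc m hc k0 kn hm hlow.
  by exists m; rewrite !addn0.
code_step hc i0; code_step hc i1; code_step hc i2.
have r0 := reach_const m i0; set m1 := upd m 2 _ in r0.
have r1 := reach_add m1 i1; set m2 := upd m1 2 _ in r1.
have r2 := reach_store m2 i2; set m3 := upd m2 _ _ in r2.
have [h0 h1 h2] := hm.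
have e2 : m2 2 = slot (size w + nregs) 0 k by rewrite /m2 /m1 /upd /= h0 /slot; lia.
have big a i : nregs <= slot (size w + nregs) a i by rewrite /slot; lia.
have h3 j : j < nregs -> j != 2 -> m3 j = m j.
  move=> jn j2; rewrite /m3 e2 upd_other; last by have := big 0 k; lia.
  by rewrite /m2 /m1 !upd_other.
have mk : k != 2 -> m2 k = nth 0 w k.
  by move=> k2; rewrite /m2 /m1 !upd_other // hlow //; lia.
have [||||m' [r' hm']] := IH k.+1 pc.+3 m3 hc; [lia|lia| | |].
- split; first by rewrite h3.
    move=> j hj; rewrite /m3 e2 upd_other; last by rewrite /slot; lia.
    rewrite /m2 /m1 !upd_other ?h1 //; rewrite /nregs in hj; lia.
  move=> a i a32 ai; rewrite /m3 e2 updE slot_inj //.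
  have s2 : slot (size w + nregs) a i != 2 by have := big a i; rewrite /nregs; lia.
  case: (eqVneq a 0) ai s2 => [->|a0] /= ai s2.
    case: (eqVneq i k) ai => [->|ik] /= ai; first by rewrite ltnSn mk //; case/andP: ai.
    rewrite /m2 /m1 !upd_other ?h2 //.
    by rewrite [in RHS]ltnS [in RHS]leq_eqVlt (negbTE ik).
  by rewrite /m2 /m1 !upd_other ?h2 ?(negbTE a0).
- by move=> j j0 j2 jn; rewrite h3 // hlow.
exists m'; split; last by rewrite addnS -addSn.
rewrite (_ : 3 * n.+1 = 1 + (1 + (1 + 3 * n))); last by lia.
apply: reach_trans r0 _; apply: reach_trans r1 _; apply: reach_trans r2 _.
by rewrite (_ : pc + _ = pc.+3 + 3 * n) //; lia.
Qed.

Lemma copy_high_ok P pc w m : code_at P pc (copy_high pc) -> moved w nregs m ->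
  exists k m', [/\ k <= 14 * size w + 6, reach P pc m k (pc + 18) m' & moved w (size w) m'].
Proof.
move=> hc [h0 h1 h2]; rewrite /copy_high /= in hc.
code_step hc i0; code_step hc i1; code_step hc i2; code_step hc i3; code_step hc i4.
code_step hc i5; code_step hc i6; code_step hc i7; code_step hc i8; code_step hc i9.
code_step hc i10; code_step hc i11; code_step hc i12; code_step hc i13; code_step hc i14.
code_step hc i15; code_step hc i16; code_step hc i17.
set B := size w + nregs in h0 h1 h2 *.
have big a i : nregs <= slot B a i by rewrite /slot; lia.
have loop n i m1 : n = size w - i -> nregs <= i -> m1 1 = i -> m1 3 = 1 -> m1 4 = size w ->
    moved w i m1 ->
    exists k m', [/\ k <= 14 * n + 2, reach P pc.+4 m1 k (pc + 18) m' & moved w (size w) m'].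
  elim: n i m1 => [|n IH] i m1 hn ni e1 e3 e4 [g0 g1 g2].
    have r4 := reach_sub m1 i4; set m2 := upd m1 6 _ in r4.
    have z : m2 6 == 0 by rewrite /m2 upd_same e4 e1 -hn.
    have r5 := reach_jz m2 i5; rewrite z in r5.
    exists 2, m2; split=> //; first exact: reach_trans r4 r5.
    split; rewrite /m2 ?upd_other //.
      by move=> j hj; rewrite upd_other ?g1 //; rewrite /nregs in hj; lia.
    move=> a j a32 aj; rewrite upd_other ?g2 //; last by have := big a j; rewrite /B /nregs; lia.
    (* An input shorter than [nregs] makes the index overshoot [size w]; the surplus entries are the
       default 0. *)
    case: (a == 0) => //=; case: ltnP => hj; case: ltnP => hj' //; last by lia.
    by rewrite nth_default.
  have r4 := reach_sub m1 i4; set m2 := upd m1 6 _ in r4.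
  have z : (m2 6 == 0) = false by rewrite /m2 upd_same e4 e1; lia.
  have r5 := reach_jz m2 i5; rewrite z in r5.
  have r6 := reach_load m2 i6; set m3 := upd m2 _ _ in r6.
  have r7 := reach_const m3 i7; set m4 := upd m3 _ _ in r7.
  have r8 := reach_add m4 i8; set m5 := upd m4 _ _ in r8.
  have r9 := reach_add m5 i9; set m6 := upd m5 _ _ in r9.
  have r10 := reach_add m6 i10; set m7 := upd m6 _ _ in r10.
  have r11 := reach_add m7 i11; set m8 := upd m7 _ _ in r11.
  have r12 := reach_add m8 i12; set m9 := upd m8 _ _ in r12.
  have r13 := reach_add m9 i13; set m10 := upd m9 _ _ in r13.
  have r14 := reach_add m10 i14; set m11 := upd m10 _ _ in r14.
  have v2 : m11 2 = slot B 0 i.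
    rewrite /m11 /m10 /m9 /m8 /m7 /m6 /m5 /m4 /m3 /m2 /upd /= e1 g0 /slot; lia.
  have m21 : m2 1 = i by rewrite /m2 upd_other.
  have v5 : m11 5 = nth 0 w i.
    rewrite /m11 /m10 /m9 /m8 /m7 /m6 /m5 /m4 /m3 /upd /= m21.
    by rewrite /m2 upd_other ?g1 //; rewrite /nregs in ni *; lia.
  have oth j : j != 2 -> j != 5 -> j != 6 -> m11 j = m1 j.
    by move=> *; rewrite /m11 /m10 /m9 /m8 /m7 /m6 /m5 /m4 /m3 /m2 !upd_other.
  have r15 := reach_store m11 i15; set m12 := upd m11 _ _ in r15.
  have r16 := reach_add m12 i16; set m13 := upd m12 _ _ in r16.
  have r17 := reach_jmp m13 i17.
  have oth' j : 0 < j < nregs -> j != 1 -> j != 2 -> j != 5 -> j != 6 -> m13 j = m1 j.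
    move=> jn *; rewrite /m13 upd_other // /m12 v2 upd_other ?oth //.
    by have := big 0 i; lia.
  have l12 j : j < nregs -> m12 j = m11 j.
    by move=> jn; rewrite /m12 v2 upd_other //; have := big 0 i; lia.
  have [||||||k [m' [hk r hm]]] := IH i.+1 m13.
  - by lia.
  - by lia.
  - by rewrite /m13 upd_same !l12 // !oth // e1 e3 addn1.
  - by rewrite oth'.
  - by rewrite oth'.
  - split.
    + by rewrite /m13 upd_other // l12 // oth.
    + move=> j hj; rewrite /m13 upd_other; last by rewrite /nregs in hj; lia.
      rewrite /m12 v2 upd_other; last by rewrite /slot /B; lia.
      by rewrite oth ?g1 //; rewrite /nregs in hj; lia.
    + move=> a j a32 aj; rewrite /m13 upd_other; last by have := big a j; rewrite /B /nregs; lia.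
      rewrite /m12 v2 v5 updE slot_inj //.
      case: (eqVneq a 0) aj => [->|a0] /= aj.
        case: (eqVneq j i) => [->|ji] //=; first by rewrite ltnSn.
        rewrite oth ?g2 //; try by (have := big 0 j; rewrite /B /nregs; lia).
        by rewrite [in RHS]ltnS [in RHS]leq_eqVlt (negbTE ji).
      by rewrite oth ?g2 ?(negbTE a0) //; have := big a j; rewrite /B /nregs; lia.
  exists (1 + (1 + (1 + (1 + (1 + (1 + (1 + (1 + (1 + (1 + (1 + (1 + (1 + (1 + k)))))))))))))), m'.
  split=> //; first by lia.
  apply: reach_trans r4 _; apply: reach_trans r5 _; apply: reach_trans r6 _.
  apply: reach_trans r7 _; apply: reach_trans r8 _; apply: reach_trans r9 _.
  apply: reach_trans r10 _; apply: reach_trans r11 _; apply: reach_trans r12 _.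
  apply: reach_trans r13 _; apply: reach_trans r14 _; apply: reach_trans r15 _.
  apply: reach_trans r16 _; apply: reach_trans r17 _.
  by rewrite addn4.
have r0 := reach_const m i0; set m1 := upd m _ _ in r0.
have r1 := reach_const m1 i1; set m2 := upd m1 _ _ in r1.
have r2 := reach_const m2 i2; set m3 := upd m2 _ _ in r2.
have r3 := reach_sub m3 i3; set m4 := upd m3 _ _ in r3.
have oth j : j != 1 -> j != 3 -> j != 4 -> j != 5 -> m4 j = m j.
  by move=> *; rewrite /m4 /m3 /m2 /m1 !upd_other.
have [||||||k [m' [hk r hm]]] := loop (size w - nregs) nregs m4 => //.
- by rewrite /m4 /m3 /m2 /m1 /upd /= h0 /B; lia.
- split.
  + by rewrite oth.
  + by move=> j hj; rewrite oth ?h1 //; rewrite /nregs in hj; lia.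
  + by move=> a j a32 aj; rewrite oth ?h2 //; have := big a j; rewrite /B /nregs; lia.
exists (1 + (1 + (1 + (1 + k)))), m'; split=> //; first by lia.
apply: reach_trans r0 _; apply: reach_trans r1 _; apply: reach_trans r2 _.
exact: reach_trans r3 r.
Qed.

Lemma prologue_ok P hdr ivs m : code_at P 0 prologue -> size hdr = 4 ->
  all (fun iv : seq (nat * nat) => 0 < size iv) ivs -> (forall j, m j = nth 0 (hdr ++ records ivs) j) -> nth 0 hdr 2 = 0 ->
  let w := hdr ++ records ivs in
  exists k m' B s, [/\ k <= 21 * size w + 200, reach P 0 m k (size prologue) m', represents B s m'
    & (forall i, i != 0 -> i != 2 -> arrs s 0 i = nth 0 w i) /\
      (forall a i, 0 < a < 32 -> arrs s a i = 0)].
Proof.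
move=> hc sh nz hm h2 w.
have [c1 /code_at_cat[c2 c3]] := code_at_cat hc.
have [k1 [m1 [hk1 r1 m10 hm1]]] := find_end_ok c1 sh nz hm h2.
rewrite -/w in m10 hm1.
(* Every record occupies at least one cell, so the walk over the records can be charged to the input
   length. *)
have hw : size ivs + 4 <= size w.
  rewrite /w size_cat sh addnC leq_add2l; elim: (ivs) => // v vs IH.
  rewrite -[records _]/(record_of v ++ records vs) size_cat size_record.
  have -> : size (v :: vs) = (size vs).+1 by [].
  lia.
(* The base [B] lies beyond the input, where memory is 0: all arrays start out as zero. *)
have mv : moved w 1 m1.
  split=> // [j hj|a i a32 ai]; first by rewrite hm1 //; rewrite /nregs in hj; lia.
  rewrite hm1; try by rewrite /slot /nregs; lia.
  rewrite nth_default; last by rewrite /slot; lia.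
  case: eqVneq ai => //= _; case: i => //.
have [//|//||m2 [r2 mv2]] := copy_low_ok c2 _ _ mv.
  by move=> j j0 j2 _; apply: hm1.
have [k3 [m3 [hk3 r3 [g0 g1 g2]]]] := copy_high_ok c3 mv2.
pose B := size w + nregs.
exists (k1 + (3 * nregs.-1 + k3)), m3, B, (State (fun x => m3 x.+1) (fun a i => m3 (slot B a i))).
split.
- by rewrite /nregs; lia.
- by apply: reach_trans r1 _; apply: reach_trans r2 _.
- by split=> //; rewrite /B; lia.
split=> [i i0 i2|a i /andP[a0 a32]] /=.
  rewrite g2 // ?i0 ?i2 //=; case: ltnP => // hi; by rewrite nth_default.
by rewrite g2 // (gtn_eqF a0).
Qed.

(** * The search tree *)

(* An interval of a domain with holes.  Values are shifted by one, so that the position 0 means that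
   no point has been placed.  [eopt] holds if the interval is not the last one of its variable
   [evar]; [eprev] is the [eid] of the preceding one, or 0. *)
Record event := Event {
  eid : nat; elo : nat; ehi : nat; evar : nat; eprev : nat; eopt : bool }.

Definition event_code e := (eid e, elo e, ehi e, evar e, eprev e, eopt e).
Definition event_decode u := let: (i, l, h, x, p, o) := u in Event i l h x p o.
Lemma event_codeK : cancel event_code event_decode. Proof. by case. Qed.
HB.instance Definition _ := Equality.copy event (can_type event_codeK).

(** The tree is kept as data so that two aspects can be studied apart: [accepts] is the answer,
    [nodes] the number of loop iterations. *)
Inductive tree := Leaf of bool | Unary of tree | Binary of tree & tree.

Fixpoint accepts t := match t with
  | Leaf b => b
  | Unary t => accepts t
  | Binary t1 t2 => accepts t1 || accepts t2
  end.

Fixpoint nodes t := match t with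
  | Leaf _ => 1
  | Unary t => (nodes t).+1
  | Binary t1 t2 => (nodes t1 + nodes t2).+1
  end.

Definition setb (H : nat -> bool) x b : nat -> bool := fun y => if y == x then b else H y.

Section Search.

Variables (D N : nat) (sg : seq (nat * nat)).
Variables (nx ll cc bd : nat -> nat).

(** Takes at once the greedy points forced by single intervals up to [r]: [ll] and [cc] give the end
    and the length of the greedy chain that starts at [nx p], cut at the next event end, which is
    [r] when this is called. *)
Definition advance p c r :=
  if nx p <= r then (ll (nx p), c.+1 + cc (nx p)) else (p, c).

(* [p] and [c] are the last point placed and the number of points, [H] tells the variables already
   hit.  The sibling has [ps] and [cs] instead, and differs from [H] at [x] only, where [H] is [b].
   A sibling at [D.+1], which hits everything and hence never dominates, stands for no sibling. *)
Fixpoint search es (H : nat -> bool) p c x (b : bool) ps cs : tree :=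
  match es with
  | [::] => Leaf ((advance p c D).2 <= N)
  | e :: es' =>
    let pc := advance p c (ehi e) in
    let qc := advance ps cs (ehi e) in
    let h := H (evar e) || (elo e <= pc.1) in
    let hs := (H (evar e) (+) (evar e == x)) || (elo e <= qc.1) in
    if ~~ eopt e then
      Unary (search es' (setb H (evar e) true)
        (if h then pc.1 else ehi e) (if h then pc.2 else pc.2.+1) x b
        (if hs then qc.1 else ehi e) (if hs then qc.2 else qc.2.+1))
    else if h || ~~ hs && (qc.2 + b <= pc.2) then
      Unary (search es' (setb H (evar e) h) pc.1 pc.2 0 true D.+1 0)
    else
      Binary
        (search es' (setb H (evar e) true) (ehi e) pc.2.+1 (evar e) true pc.1 pc.2)
        (search es' (setb H (evar e) false) pc.1 pc.2 (evar e) false (ehi e) pc.2.+1)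
  end.

Definition stabs s (g : nat * nat) := g.1 <= s <= g.2.
Definition estabs e s := elo e <= s <= ehi e.

(** [S] is the set of points still to come. Remembering only the last point [p] suffices: remaining
    events end at or after [p], so an earlier point inside one of them could be replaced by [p].
    Single intervals starting at or before [p] count as settled. *)
Definition feasible H p c (es : seq event) := exists S : seq nat,
  [/\ size S + c <= N,
      forall g : nat * nat, g \in sg -> p < g.1 -> exists2 s : nat, s \in S & stabs s g
    & forall e : event, e \in es -> ~~ H (evar e) ->
        exists (e' : event) (s : nat), [/\ e' \in es, evar e' = evar e, s \in p :: S & estabs e' s]].

Hypothesis sgP : forall g : nat * nat, g \in sg -> g.1 <= g.2 <= D.
(** Together with the next hypothesis: [nx p] is the least right end of a single interval starting
    after [p], and exceeds [D] if there is none. *)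
Hypothesis nx_le : forall p (g : nat * nat), p <= D -> g \in sg -> p < g.1 -> nx p <= g.2.
Hypothesis nx_ex : forall p, p <= D -> nx p <= D ->
  exists2 g : nat * nat, g \in sg & p < g.1 /\ g.2 = nx p.
Hypothesis nx_inf : nx D.+1 = D.+1.
Hypothesis tabP : forall q, 0 < q <= D ->
  if nx q <= bd q then ll q = ll (nx q) /\ cc q = (cc (nx q)).+1
  else ll q = q /\ cc q = 0.

Lemma nx_gt p : p <= D -> p < nx p.
Proof.
move=> pD; case: (leqP (nx p) D) => [nD|]; last by lia.
by have [g gs [pg <-]] := nx_ex pD nD; have := sgP gs; lia.
Qed.

(** Exchange argument: some point of [S] stabs the single interval that ends at [nx p], and it can
    slide right to [nx p]. It stays in every remaining event it stabbed, as these end no earlier,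
    and single intervals starting later did not contain it. *)
Lemma feasible_next H p c es :
  p <= D -> nx p <= D -> (forall e : event, e \in es -> nx p <= ehi e) ->
  feasible H p c es <-> feasible H (nx p) c.+1 es.
Proof.
move=> pD nD hes; have pn := nx_gt pD; split=> -[S [Sc Ss Se]].
  have [g gs [pg g2]] := nx_ex pD nD.
  have [s sS /andP[s1 s2]] := Ss g gs pg.
  have sz : (size (rem s S)).+1 = size S.
    by rewrite size_rem // prednK //; case: (S) sS.
  have memrem t : t \in S -> t != s -> t \in rem s S.
    move=> tS ts; have := perm_to_rem sS => /perm_mem /(_ t).
    by rewrite tS inE (negbTE ts) /= => <-.
  exists (rem s S); split; first by move: Sc; rewrite -sz addSnnS.
    move=> g' g's pg'; have [] := Ss g' g's; first by lia.
    move=> t tS /andP[t1 t2]; exists t; last exact/andP.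
    by apply: memrem => //; rewrite gtn_eqF // (leq_ltn_trans s2) // g2 (leq_trans pg').
  move=> e ein He; have [e' [t [e'in ve tS /andP[t1 t2]]]] := Se e ein He.
  have hi := hes _ e'in.
  move: tS; rewrite inE => /orP[/eqP tp|tS].
    rewrite tp in t1 t2; by exists e', (nx p); split=> //; rewrite ?inE ?eqxx // /estabs; lia.
  have [ts|ts] := eqVneq t s.
    rewrite ts in t1 t2; by exists e', (nx p); split=> //; rewrite ?inE ?eqxx // /estabs; lia.
  by exists e', t; split=> //; rewrite ?inE ?memrem ?orbT // /estabs t1 t2.
exists (nx p :: S); split=> /=; first lia.
  move=> g gs pg; case: (ltnP (nx p) g.1) => [lt|ge].
    by have [t tS tg] := Ss g gs lt; exists t => //; rewrite inE tS orbT.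
  by exists (nx p); rewrite ?inE ?eqxx // /stabs ge (nx_le pD gs pg).
move=> e ein He; have [e' [t [e'in ve tS te]]] := Se e ein He.
by exists e', t; split=> //; rewrite inE tS orbT.
Qed.

(** Between the event ends [rp] and [r] the table [bd] is constantly [r], so [ll] and [cc] unfold
    along [nx] exactly while it stays at most [r]; each unfolding is one use of [feasible_next]. *)
Lemma feasible_chain rp r q H c es :
  (forall q, rp < q <= r -> bd q = r) -> r <= D ->
  (forall e : event, e \in es -> r <= ehi e) -> rp < q <= r ->
  [/\ feasible H q c es <-> feasible H (ll q) (c + cc q) es,
      q <= ll q <= r & r < nx (ll q)].
Proof.
move=> bdr rD hes; have [k] := ubnP (D - q).
elim: k q c => // k IH q c kq rq.
have qD : q <= D by lia.
have q0D : 0 < q <= D by lia.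
have := tabP q0D; rewrite (bdr q) //.
have qn := nx_gt qD.
case: (leqP (nx q) r) => nr [-> ->]; last first.
  by rewrite addn0; split=> //; lia.
have [||F B1 B2] := IH (nx q) c.+1; try lia.
rewrite addnS -addSn; split=> //; last by lia.
rewrite -F; apply: feasible_next => //; first lia.
by move=> e /hes; lia.
Qed.

(** [rp < nx p] is the invariant that every greedy point forced up to [rp] has been placed;
    [r < nx p'] restores it for the next event. *)
Lemma feasible_advance rp r H p c es p' c' :
  (forall q, rp < q <= r -> bd q = r) -> r <= D ->
  (forall e : event, e \in es -> r <= ehi e) -> p <= r -> rp < nx p ->
  advance p c r = (p', c') ->
  [/\ feasible H p c es <-> feasible H p' c' es, p <= p' <= r & r < nx p'].
Proof.
move=> bdr rD hes pr rpn; rewrite /advance.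
case: (leqP (nx p) r) => nr [<- <-]; last first.
  by split=> //; lia.
have pD : p <= D by lia.
have pn := nx_gt pD.
have [|F B1 B2] := @feasible_chain rp r (nx p) H c.+1 es bdr rD hes; first lia.
split=> //; last lia.
rewrite -F; apply: feasible_next => //; first lia.
by move=> e /hes; lia.
Qed.

Lemma advance_inf c r : r <= D -> advance D.+1 c r = (D.+1, c).
Proof. by move=> rD; rewrite /advance nx_inf leqNgt ltnS rD. Qed.

Lemma feasible_imp (H1 H2 : nat -> bool) p c1 c2 es :
  (forall e : event, e \in es -> H1 (evar e) -> H2 (evar e)) -> c2 <= c1 ->
  feasible H1 p c1 es -> feasible H2 p c2 es.
Proof.
move=> H12 c21 [S [Sc Ss Se]]; exists S; split=> //; first lia.
by move=> e ein He; apply: Se => //; apply: contra He; apply: H12.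
Qed.

(** The point saved by [c2 < c1] is spent at the end of some remaining interval of [x]; if there is
    none, no event depends on the status of [x]. *)
Lemma feasible_pay x (H1 H2 : nat -> bool) p c1 c2 es :
  (forall e : event, e \in es -> elo e <= ehi e) ->
  (forall e : event, e \in es -> evar e != x -> H1 (evar e) -> H2 (evar e)) -> c2 < c1 ->
  feasible H1 p c1 es -> feasible H2 p c2 es.
Proof.
move=> les H12 c21 [S [Sc Ss Se]].
have [/hasP[e0 e0in /eqP e0x]|/hasPn nox] := boolP (has (fun e => evar e == x) es); last first.
  exists S; split=> //; first lia.
  by move=> e ein He; apply: Se => //; apply: contra He; apply: H12 => //; apply: nox.
exists (ehi e0 :: S); split=> /=; first lia.
  by move=> g gs pg; have [s sS] := Ss g gs pg; exists s; rewrite ?inE ?sS ?orbT.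
move=> e ein He; have [ex|ex] := eqVneq (evar e) x.
  exists e0, (ehi e0); split=> //; rewrite ?ex ?inE ?eqxx ?orbT //.
  by rewrite /estabs leqnn les.
have [|e' [s [e'in ve sS te]]] := Se e ein.
  by apply: contra He; apply: H12.
by exists e', s; split=> //; move: sS; rewrite !inE => /orP[]->; rewrite ?orbT.
Qed.

Section Step.

Variables (e : event) (es : seq event) (H : nat -> bool) (p c : nat).
Hypothesis lo_hi : elo e <= ehi e.
Hypothesis p_hi : p <= ehi e.
Hypothesis hi_nx : ehi e < nx p.
Hypothesis hi_D : ehi e <= D.
Hypothesis hi_es : forall e' : event, e' \in es -> ehi e <= ehi e'.

Lemma feasible_hit : H (evar e) || (elo e <= p) ->
  feasible H p c (e :: es) <-> feasible (setb H (evar e) true) p c es.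
Proof.
move=> h; split=> -[S [Sc Ss Se]]; exists S; split=> // e0; last first.
  rewrite inE => /predU1P He0 H0.
  have [v0|v0] := eqVneq (evar e0) (evar e).
    move: h; rewrite -v0 (negbTE H0) /= => lp.
    by exists e, p; split; rewrite ?inE ?eqxx // /estabs lp.
  case: He0 => [e0e|e0in]; first by rewrite e0e eqxx in v0.
  have [|e' [s [e'in ve sS te]]] := Se e0 e0in; first by rewrite /setb (negbTE v0).
  by exists e', s; split=> //; rewrite inE e'in orbT.
move=> e0in; rewrite /setb; case: eqVneq => // v0 H0.
have [|e' [s [e'in ve sS te]]] := Se e0 _ H0; first by rewrite inE e0in orbT.
exists e', s; split=> //; move: e'in; rewrite inE => /predU1P[e'e|//].
by rewrite -ve e'e eqxx in v0.
Qed.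

(** No single interval is skipped by jumping to [ehi e]: one that starts in between ends at [nx p]
    or later, hence beyond [ehi e], and is stabbed there. *)
Lemma feasible_place :
  feasible (setb H (evar e) true) (ehi e) c.+1 es -> feasible H p c (e :: es).
Proof.
move=> [S [Sc Ss Se]]; exists (ehi e :: S); split=> /=; first lia.
  move=> g gs pg; case: (ltnP (ehi e) g.1) => [lt|ge].
    by have [t tS tg] := Ss g gs lt; exists t => //; rewrite inE tS orbT.
  have pD : p <= D by lia.
  have := nx_le pD gs pg => g2; exists (ehi e); first by rewrite inE eqxx.
  by rewrite /stabs; lia.
move=> e0 e0in H0; have [v0|v0] := eqVneq (evar e0) (evar e).
  exists e, (ehi e); split; rewrite ?inE ?eqxx ?orbT //.
  by rewrite /estabs leqnn lo_hi.
move: e0in; rewrite inE => /predU1P[e0e|e0in]; first by rewrite e0e eqxx in v0.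
have [|e' [s [e'in ve sS te]]] := Se e0 e0in; first by rewrite /setb (negbTE v0).
by exists e', s; split=> //; rewrite inE ?e'in ?orbT // sS orbT.
Qed.

(** The obligation of [e] is inherited by a later event of the same variable; without one the
    variable would silently drop out of the requirements. *)
Lemma feasible_post :
  has (fun e' => evar e' == evar e) es ->
  feasible (setb H (evar e) false) p c es -> feasible H p c (e :: es).
Proof.
move=> /hasP[e1 e1in /eqP v1] [S [Sc Ss Se]]; exists S; split=> // e0 e0in H0.
have [v0|v0] := eqVneq (evar e0) (evar e).
  have [|e' [s [e'in ve sS te]]] := Se e1 e1in; first by rewrite /setb v1 eqxx.
  by exists e', s; split=> //; rewrite ?inE ?e'in ?orbT // ve v1 v0.
move: e0in; rewrite inE => /predU1P[e0e|e0in]; first by rewrite e0e eqxx in v0.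
have [|e' [s [e'in ve sS te]]] := Se e0 e0in; first by rewrite /setb (negbTE v0).
by exists e', s; split=> //; rewrite inE e'in orbT.
Qed.

(** If a point of [S] stabs [e], it can slide right to [ehi e], since all remaining events end no
    earlier. Otherwise another interval must serve the variable of [e], so it has one later in the
    list. *)
Lemma feasible_unhit : ~~ (H (evar e) || (elo e <= p)) ->
  feasible H p c (e :: es) ->
  feasible (setb H (evar e) true) (ehi e) c.+1 es \/
  has (fun e' => evar e' == evar e) es /\ feasible (setb H (evar e) false) p c es.
Proof.
rewrite negb_or => /andP[nH np] [S [Sc Ss Se]].
have [/hasP[s sS /andP[s1 s2]]|/hasPn nos] := boolP (has (estabs e) S); last first.
  right.
  have Se' e0 : e0 \in e :: es -> ~~ H (evar e0) ->
      exists (e' : event) (s : nat),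
      [/\ e' \in es, evar e' = evar e0, s \in p :: S & estabs e' s].
    move=> e0in H0; have [e' [s [e'in ve sS te]]] := Se e0 e0in H0.
    exists e', s; split=> //; move: e'in; rewrite inE => /predU1P[e'e|//].
    move: te; rewrite e'e; move: sS; rewrite inE => /predU1P[->|/nos/negbTE->//].
    by rewrite /estabs (negbTE np).
  split.
    have [|e' [s [e'in ve _ _]]] := Se' e _ nH; first by rewrite inE eqxx.
    by apply/hasP; exists e' => //; rewrite ve.
  exists S; split=> // e0 e0in; rewrite /setb => H0; apply: Se'; first by rewrite inE e0in orbT.
  by move: H0; case: eqVneq => // ->.
left.
have sz : (size (rem s S)).+1 = size S.
  by rewrite size_rem // prednK //; case: (S) sS.
have memrem t : t \in S -> t != s -> t \in rem s S.
  move=> tS ts; have := perm_to_rem sS => /perm_mem /(_ t).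
  by rewrite tS inE (negbTE ts) /= => <-.
exists (rem s S); split; first by move: Sc; rewrite -sz addSnnS.
  move=> g gs pg; have [] := Ss g gs; first by lia.
  move=> t tS /andP[t1 t2]; exists t; last exact/andP.
  by apply: memrem => //; rewrite gtn_eqF // (leq_ltn_trans s2) // (leq_trans pg).
move=> e0 e0in; rewrite /setb; case: eqVneq => // v0 H0.
have [|e' [t [e'in ve tS /andP[t1 t2]]]] := Se e0 _ H0; first by rewrite inE e0in orbT.
have {}e'in : e' \in es.
  by move: e'in; rewrite inE => /predU1P[e'e|//]; rewrite -ve e'e eqxx in v0.
have hi := hi_es e'in.
move: tS; rewrite inE => /orP[/eqP tp|tS].
  rewrite tp in t1 t2; exists e', (ehi e); split=> //; rewrite ?inE ?eqxx // /estabs; lia.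
have [ts|ts] := eqVneq t s.
  rewrite ts in t1 t2; exists e', (ehi e); split=> //; rewrite ?inE ?eqxx // /estabs; lia.
by exists e', t; split=> //; rewrite ?inE ?memrem ?orbT // /estabs t1 t2.
Qed.

End Step.

(** Restricting to positions after [rp] lets the property pass to the tail of a list sorted by end;
    the default [D] makes the final jump run to the last value. *)
Definition headed rp (es : seq event) :=
  forall q, rp < q -> bd q = head D [seq ehi e | e <- es & q <= ehi e].

Fixpoint wf_events es := match es with
  | [::] => True
  | e :: es' => [/\ elo e <= ehi e <= D,
      forall e' : event, e' \in es' -> ehi e <= ehi e',
      eopt e = has (fun e' => evar e' == evar e) es' & wf_events es']
  end.

Lemma wf_events_lo es e : wf_events es -> e \in es -> elo e <= ehi e.
Proof.
elim: es => // e0 es IH [/andP[lh _] _ _ /IH{}IH]; rewrite inE => /predU1P[->//|].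
exact: IH.
Qed.

Lemma setb_same H x b : setb H x b x = b. Proof. by rewrite /setb eqxx. Qed.

(** Both claims go through one induction: a node without sibling is correct by itself, whereas a
    node with a sibling may be pruned, so only the disjunction over the pair is claimed. The first
    sibling is the one in which [x] is hit. *)
Lemma search_correct es rp : wf_events es -> headed rp es -> rp <= D ->
  (forall e : event, e \in es -> rp <= ehi e) ->
  (forall H p c x b cs, p <= rp -> rp < nx p ->
     accepts (search es H p c x b D.+1 cs) <-> feasible H p c es) /\
  (forall (H1 H2 : nat -> bool) p1 c1 p2 c2 x,
     p1 <= rp -> rp < nx p1 -> p2 <= rp -> rp < nx p2 ->
     (forall e : event, e \in es -> H2 (evar e) = H1 (evar e) (+) (evar e == x)) ->
     (forall e : event, e \in es -> evar e = x -> H1 x) ->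
     accepts (search es H1 p1 c1 x true p2 c2) || accepts (search es H2 p2 c2 x false p1 c1)
     <-> feasible H1 p1 c1 es \/ feasible H2 p2 c2 es).
Proof.
elim: es rp => [|e es IH] rp.
  move=> _ hd rpD _.
  (* After the last jump [nx] exceeds [D], so no single interval is left and the count alone
     decides. *)
  have leaf H p c : p <= rp -> rp < nx p ->
      ((advance p c D).2 <= N) <-> feasible H p c [::].
    move=> prp rpn; case E: (advance p c D) => [p' c'].
    have [||||F /andP[_ B1] B2] := @feasible_advance rp D H p c [::] p' c' _ _ _ _ rpn E => //.
    - by move=> q /andP[/hd->].
    - by lia.
    rewrite F /=; split=> [cN|[S [Sc _ _]]]; last lia.
    exists [::]; split=> //= g gs pg.
    have /andP[g1 g2] := sgP gs; have := nx_le B1 gs pg; lia.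
  split=> [H p c x b cs prp rpn|H1 H2 p1 c1 p2 c2 x ? ? ? ? _ _]; first exact: leaf.
  by rewrite /= -!leaf //; split=> /orP.
move=> [/andP[lh hD] hes opt wf] hd rpD rphi.
have rphe : rp <= ehi e by apply: rphi; rewrite inE eqxx.
have hd' : headed (ehi e) es.
  move=> q qh; rewrite hd /=; last by lia.
  by rewrite leqNgt qh.
have [IH1 IH2] := IH _ wf hd' hD hes; move: IH => _.
have adv p c : p <= rp -> rp < nx p -> exists p' c',
    [/\ advance p c (ehi e) = (p', c'), p' <= ehi e, ehi e < nx p' &
      forall H, feasible H p c (e :: es) <-> feasible H p' c' (e :: es)].
  move=> prp rpn; case E: (advance p c (ehi e)) => [p' c'].
  have A H : [/\ feasible H p c (e :: es) <-> feasible H p' c' (e :: es), p <= p' <= ehi e & ehi e < nx p'].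
    apply: (feasible_advance (rp := rp)) E => //; last by lia.
    - by move=> q /andP[q1 q2]; rewrite hd //= q2.
    - by move=> e'; rewrite inE => /predU1P[->//|/hes].
  have [_ /andP[_ B1] B2] := A (fun=> true).
  by exists p', c'; split=> // H; have [] := A H.
have hnx := nx_gt hD.
have forced H p c : ~~ eopt e -> p <= ehi e -> ehi e < nx p ->
    let h := H (evar e) || (elo e <= p) in
    feasible H p c (e :: es) <-> feasible (setb H (evar e) true)
       (if h then p else ehi e) (if h then c else c.+1) es.
  move=> nopt ph hn /=; case: ifPn => h; first exact: feasible_hit.
  split; last exact: feasible_place.
  by case/feasible_unhit => // -[]; rewrite -opt (negbTE nopt).
have place_or_post H p c : eopt e -> p <= ehi e -> ehi e < nx p ->
    ~~ (H (evar e) || (elo e <= p)) ->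
    feasible H p c (e :: es) <->
    feasible (setb H (evar e) true) (ehi e) c.+1 es \/ feasible (setb H (evar e) false) p c es.
  move=> o ph hn h; split=> [/feasible_unhit[]//|]; first by left.
    by case; right.
  case; first exact: feasible_place.
  by apply: feasible_post; rewrite -opt.
have branch H p c : eopt e -> p <= ehi e -> ehi e < nx p ->
    ~~ (H (evar e) || (elo e <= p)) ->
    accepts (search es (setb H (evar e) true) (ehi e) c.+1 (evar e) true p c)
    || accepts (search es (setb H (evar e) false) p c (evar e) false (ehi e) c.+1)
    <-> feasible H p c (e :: es).
  move=> o ph hn h; rewrite (place_or_post H p c) //; apply: IH2 => //.
    by move=> e' _; rewrite /setb; case: eqVneq => //; rewrite addbF.
  by move=> e' _ _; apply: setb_same.
have hit H p c : p <= ehi e -> ehi e < nx p -> H (evar e) || (elo e <= p) ->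
    accepts (search es (setb H (evar e) true) p c 0 true D.+1 0)
    <-> feasible H p c (e :: es).
  by move=> ph hn h; rewrite feasible_hit //; apply: IH1.
have post H p c : p <= ehi e -> ehi e < nx p ->
    accepts (search es (setb H (evar e) false) p c 0 true D.+1 0)
    <-> feasible (setb H (evar e) false) p c es.
  by move=> ph hn; apply: IH1.
split.
  move=> H p c x b cs prp rpn.
  have [p' [c' [Ea ph hn ->]]] := adv p c prp rpn.
  rewrite /= Ea advance_inf //=.
  (* The fictitious sibling at [D.+1] makes [hs] true, which switches the pruning test off. *)
  have -> : elo e <= D.+1 by lia.
  rewrite orbT /=; case: (boolP (eopt e)) => o /=.
    case: ifPn => [/orP[h|//]|]; first by rewrite h; apply: hit.
    by rewrite orbF; apply: branch.
  rewrite (forced H p' c' o) //; case: ifP => h; apply: IH1 => //.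
move=> H1 H2 p1 c1 p2 c2 x p1r p1n p2r p2n H12 H1x.
have [q1 [d1 [E1 q1h q1n F1]]] := adv p1 c1 p1r p1n.
have [q2 [d2 [E2 q2h q2n F2]]] := adv p2 c2 p2r p2n.
have H12e : H1 (evar e) (+) (evar e == x) = H2 (evar e).
  by rewrite H12 // inE eqxx.
have H21e : H2 (evar e) (+) (evar e == x) = H1 (evar e) by rewrite -H12e addbK.
rewrite F1 F2 /= E1 E2 /= H12e H21e addn0 addn1.
case: (boolP (eopt e)) => o /=; last first.
  rewrite (forced H1 q1 d1 o) // (forced H2 q2 d2 o) //.
  apply: IH2.
  1-4: by case: ifP.
    (* Both copies now mark the variable of [e] as hit, which would break the relation if it is [x];
       but [e] is its last event, so no event of [es] observes this. *)
    move=> e' e'in; rewrite /setb; case: eqVneq => [v|_].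
      by move: o; rewrite opt => /hasPn/(_ _ e'in); rewrite v eqxx.
    by rewrite H12 // inE e'in orbT.
  move=> e' e'in e'x; rewrite /setb; case: eqVneq => // _.
  by apply: H1x e'x; rewrite inE e'in orbT.
have uninfl (a b : bool) (P Q : Prop) : (a <-> P) -> (b <-> Q) -> a || b <-> P \/ Q.
  by move=> <- <-; split=> /orP.
(* If one sibling already hits [e], the other sees it through [hs] and its test is off: the two are
   decided independently. *)
case: (boolP (H1 (evar e) || (elo e <= q1))) => h1 /=.
  apply: uninfl; first exact: hit.
  rewrite orbF; case: ifPn => h2; first by rewrite h2; apply: hit.
  exact: branch.
case: (boolP (H2 (evar e) || (elo e <= q2))) => h2 /=.
  by apply: uninfl; [exact: branch|exact: hit].
(* Adding [b] makes the comparison strict for the sibling that has [x] hit and weak for the other,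
   so exactly one of them keeps only its postponing child. The dropped placing child would stand at
   [ehi e] like its counterpart, to which [feasible_pay] or [feasible_imp] transfers its
   solutions. *)
case: (ltnP d2 d1) => d12 /=.
  apply: iff_trans; first by apply: uninfl; [exact: post|exact: branch].
  split; first by case=> [F|]; [left; rewrite (place_or_post H1 q1 d1) //; right|right].
  case=> [|F]; last by right.
  rewrite (place_or_post H1 q1 d1) // => -[F|F]; last by left.
  right; rewrite (place_or_post H2 q2 d2) //; left.
  apply: (feasible_pay (x := x)) F => // [e' e'in|e' e'in e'x]; first exact: wf_events_lo wf e'in.
  rewrite /setb; case: eqVneq => // _.
  by rewrite H12 ?inE ?e'in ?orbT // (negbTE e'x) addbF.
apply: iff_trans; first by apply: uninfl; [exact: branch|exact: post].
split; first by case=> [|F]; [left|right; rewrite (place_or_post H2 q2 d2) //; right].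
case=> [F|]; first by left.
rewrite (place_or_post H2 q2 d2) // => -[F|F]; last by right.
left; rewrite (place_or_post H1 q1 d1) //; left.
apply: feasible_imp F => // e' e'in; rewrite /setb; case: eqVneq => // _.
have e'in' : e' \in e :: es by rewrite inE e'in orbT.
rewrite H12 //; case: eqVneq => [e'x|_]; last by rewrite addbF.
by rewrite e'x (H1x _ e'in' e'x).
Qed.

Fixpoint fib n := match n with 0 => 0 | m.+1 => match m with 0 => 1 | k.+1 => fib m + fib k end end.

Arguments fib : simpl never.

Lemma fibSS n : fib n.+2 = fib n.+1 + fib n. Proof. by []. Qed.

Lemma fib_gt0 n : 0 < fib n.+1.
Proof. by elim: n => // n IH; rewrite fibSS addn_gt0 IH. Qed.

(* A node without sibling spawns a pair of siblings, and a pair of siblings spawns at most one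
   pair and one single node, since one of the two cannot branch: hence the Fibonacci numbers. *)
Lemma search_nodes es : wf_events es ->
  (forall H p c x b cs,
     nodes (search es H p c x b D.+1 cs) <= (size es).+1 * fib (count eopt es).+2) /\
  (forall (H1 H2 : nat -> bool) p1 c1 p2 c2 x,
     (forall e : event, e \in es -> H2 (evar e) = H1 (evar e) (+) (evar e == x)) ->
     nodes (search es H1 p1 c1 x true p2 c2) + nodes (search es H2 p2 c2 x false p1 c1)
     <= (size es).+1 * fib (count eopt es).+3).
Proof.
elim: es => // e es IH [/andP[lh hD] hes opt wf].
have [IH1 IH2] := IH wf; move: IH => _.
have g0 := fib_gt0 (count eopt es); have g1 := fib_gt0 (count eopt es).+1.
have g2 : 1 < fib (count eopt es).+3.
  by rewrite fibSS; lia.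
have branch (H : nat -> bool) p c :
    nodes (search es (setb H (evar e) true) (ehi e) c.+1 (evar e) true p c)
    + nodes (search es (setb H (evar e) false) p c (evar e) false (ehi e) c.+1)
    <= (size es).+1 * fib (count eopt es).+3.
  apply: IH2 => e' _; rewrite /setb; case: eqVneq => //; by rewrite addbF.
split.
  move=> H p c x b cs; rewrite /= advance_inf //=.
  have -> : elo e <= D.+1 by lia.
  rewrite orbT /= orbF; case: (boolP (eopt e)) => o /=.
    case: ifP => h /=.
      apply: leq_trans (_ : (_ * fib (count eopt es).+2).+1 <= _); first by rewrite ltnS; apply: IH1.
      by rewrite ?add1n ?add0n [(size es).+2 * _]mulSn (fibSS (count eopt es).+1); nia.
    by rewrite ?add1n ?add0n mulSn; have := branch H (advance p c (ehi e)).1 (advance p c (ehi e)).2; lia.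
  apply: leq_trans (_ : (_ * fib (count eopt es).+2).+1 <= _); first by rewrite ltnS; apply: IH1.
  by rewrite ?add0n [(size es).+2 * _]mulSn; lia.
move=> H1 H2 p1 c1 p2 c2 x H12.
have H12e : H1 (evar e) (+) (evar e == x) = H2 (evar e).
  by rewrite H12 // inE eqxx.
have H21e : H2 (evar e) (+) (evar e == x) = H1 (evar e) by rewrite -H12e addbK.
rewrite /= H12e H21e addn0 addn1.
case: (advance p1 c1 _) => [q1 d1]; case: (advance p2 c2 _) => [q2 d2] /=.
case: (boolP (eopt e)) => o /=; last first.
  rewrite ?add0n mulSn addSn addnS.
  set u := nodes _; set v := nodes _.
  suff : u + v <= (size es).+1 * fib (count eopt es).+3 by lia.
  apply: IH2 => e' e'in; rewrite /setb; case: eqVneq => [v'|_].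
    by move: o; rewrite opt => /hasPn/(_ _ e'in); rewrite v' eqxx.
  by rewrite H12 // inE e'in orbT.
have single H p c : nodes (search es H p c 0 true D.+1 0) <= (size es).+1 * fib (count eopt es).+2.
  exact: IH1.
have b1 := branch H1 q1 d1; have b2 := branch H2 q2 d2.
have s1 := single (setb H1 (evar e) (H1 (evar e) || (elo e <= q1))) q1 d1.
have s2 := single (setb H2 (evar e) (H2 (evar e) || (elo e <= q2))) q2 d2.
(* One pair plus one single subtree is the Fibonacci step; the two nodes themselves are absorbed by
   the increment of the depth factor, as the Fibonacci number is at least 2. *)
have total u v : u <= (size es).+1 * fib (count eopt es).+3 ->
    v <= (size es).+1 * fib (count eopt es).+2 ->
    u.+1 + v.+1 <= (size es).+2 * fib (1 + count eopt es).+3.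
  rewrite ?add1n ?add0n (fibSS (count eopt es).+2) mulSn; nia.
have mono : (size es).+1 * fib (count eopt es).+2 <= (size es).+1 * fib (count eopt es).+3.
  by rewrite leq_mul2l (fibSS (count eopt es).+1) leq_addr orbT.
move: s1 s2; case: (boolP (H1 _ || _)) => h1 s1 /=; case: (boolP (H2 _ || _)) => h2 s2 /=.
- by apply: total => //; apply: leq_trans mono.
- by rewrite addnC; apply: total.
- by apply: total.
case: (ltnP d2 d1) => d12 /=; last exact: total.
by rewrite addnC; apply: total.
Qed.

End Search.

(** * Events of an instance *)

Fixpoint var_events (iv : seq (nat * nat)) id x prev : seq event := match iv with
  | [::] => [::]
  | p :: iv' => Event id p.1.+1 p.2.+1 x prev (0 < size iv') :: var_events iv' id.+1 x id
  end.

(** A variable is named by the identifier of its first event, which keeps the names distinct.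
    Domains that are a single interval produce no event; they are collected in [singles]. *)
Fixpoint all_events ivs id : seq event := match ivs with
  | [::] => [::]
  | iv :: ivs' => if size iv == 1 then all_events ivs' id
      else var_events iv id id 0 ++ all_events ivs' (id + size iv)
  end.

Fixpoint singles (ivs : seq (seq (nat * nat))) : seq (nat * nat) := match ivs with
  | [::] => [::]
  | iv :: ivs' => (if size iv == 1 then [seq (p.1.+1, p.2.+1) | p <- iv] else [::]) ++ singles ivs'
  end.

Definition wf_domain d (iv : seq (nat * nat)) :=
  [&& 0 < size iv, all (fun p => p.1 <= p.2 < d) iv & pairwise (fun p q => p.2 < q.2) iv].

Section VarEvents.

Variable x : nat.

Lemma size_var_events iv id prev : size (var_events iv id x prev) = size iv.
Proof. by elim: iv id prev => //= p iv IH id prev; rewrite IH. Qed.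

Lemma var_events_eid iv id prev : map eid (var_events iv id x prev) = iota id (size iv).
Proof. by elim: iv id prev => //= p iv IH id prev; rewrite IH. Qed.

Lemma var_events_mem iv id prev e : e \in var_events iv id x prev ->
  [/\ evar e = x, id <= eid e < id + size iv & exists2 p : nat * nat, p \in iv & elo e = p.1.+1 /\ ehi e = p.2.+1].
Proof.
elim: iv id prev => //= p iv IH id prev; rewrite inE => /predU1P[->|/IH[-> h [q qin hq]]] /=.
  by split=> //; [lia|exists p => //; rewrite inE eqxx].
by split=> //; [lia|exists q => //; rewrite inE qin orbT].
Qed.

Lemma var_events_has iv id prev (p : nat * nat) : p \in iv ->
  exists2 e, e \in var_events iv id x prev & elo e = p.1.+1 /\ ehi e = p.2.+1.
Proof.
elim: iv id prev => //= q iv IH id prev; rewrite inE => /predU1P[->|/(IH id.+1 id)[e ein he]].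
  by eexists; first exact: mem_head.
by exists e => //; rewrite inE ein orbT.
Qed.

Lemma var_events_lt iv id prev e e' : pairwise (fun p q : nat * nat => p.2 < q.2) iv ->
  e \in var_events iv id x prev -> e' \in var_events iv id x prev ->
  eid e < eid e' -> eopt e /\ ehi e < ehi e'.
Proof.
elim: iv id prev => //= p iv IH id prev /andP[hp piv]; rewrite !inE.
case/predU1P=> [->|ein]; case/predU1P=> [->|e'in] /=; rewrite ?ltnn //.
- have [_ h [q qin [_ ->]]] := var_events_mem e'in.
  by rewrite ltnS (allP hp) //; split=> //; case: (iv) qin.
- by have [_ h _] := var_events_mem ein; lia.
- exact: IH ein e'in.
Qed.

Lemma var_events_opt iv id prev e : e \in var_events iv id x prev -> eopt e ->
  exists2 e', e' \in var_events iv id x prev & eid e < eid e'.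
Proof.
elim: iv id prev => //= p iv IH id prev; rewrite inE => /predU1P[->|ein] /= o.
  case: iv o {IH} => //= q iv _; eexists; last first.
    by apply: (_ : _ < eid (Event id.+1 q.1.+1 q.2.+1 x id (0 < size iv))) => /=.
  by rewrite !inE eqxx orbT.
by have [e' e'in lt] := IH _ _ ein o; exists e' => //; rewrite inE e'in orbT.
Qed.

Lemma var_events_prev iv id prev e : e \in var_events iv id x prev ->
  (eprev e = prev /\ eid e = id) \/
  exists2 e', e' \in var_events iv id x prev & eid e' = eprev e /\ eid e = (eprev e).+1.
Proof.
elim: iv id prev => //= p iv IH id prev; rewrite inE => /predU1P[->|ein]; first by left.
right; case: (IH _ _ ein) => [[-> ->]|[e' e'in h]].
  by eexists; first exact: mem_head.
by exists e' => //; rewrite inE e'in orbT.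
Qed.

Lemma var_events_count iv id prev : count eopt (var_events iv id x prev) = (size iv).-1.
Proof. elim: iv id prev => //= p iv IH id prev; rewrite IH; lia. Qed.

End VarEvents.

(** Stated through membership only, so that it can be used for any reordering of the events. *)
Definition chained (E : seq event) :=
  [/\ forall e e', e \in E -> e' \in E -> evar e = evar e' -> eid e < eid e' ->
        eopt e /\ ehi e < ehi e',
      forall e, e \in E -> eopt e -> exists2 e', e' \in E & evar e' = evar e /\ eid e < eid e'
    & forall e, e \in E -> (eprev e = 0 /\ forall e', e' \in E -> evar e' = evar e -> eid e <= eid e')
        \/ exists2 e', e' \in E & [/\ evar e' = evar e, eid e' = eprev e & eid e = (eprev e).+1]].

Section AllEvents.

Variable d : nat.

Lemma all_events_eid ivs id :
  map eid (all_events ivs id) = iota id (size (all_events ivs id)).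
Proof.
elim: ivs id => //= iv ivs IH id; case: eqP => // _.
by rewrite map_cat IH size_cat iotaD var_events_eid size_var_events.
Qed.

Lemma all_events_mem ivs id e : all (wf_domain d) ivs -> e \in all_events ivs id ->
  [/\ id <= evar e, id <= eid e < id + size (all_events ivs id) & 0 < elo e <= ehi e /\ ehi e <= d].
Proof.
elim: ivs id => //= iv ivs IH id /andP[/and3P[_ wiv _] wivs].
case: eqP => _; first exact: IH.
rewrite mem_cat size_cat size_var_events => /orP[/var_events_mem|/IH -/(_ wivs)].
  by case=> -> h [p /(allP wiv) hp [-> ->]]; split; lia.
by case=> h1 h2 h3; split=> //; lia.
Qed.

Lemma all_events_chained ivs id : all (wf_domain d) ivs -> 0 < id -> chained (all_events ivs id).
Proof.
elim: ivs id => [|iv ivs IH] id; first by split.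
move=> /= /andP[/and3P[sz wiv piv] wivs] id0.
case: eqP => _; first exact: IH.
have sep e : e \in var_events iv id id 0 -> evar e = id by case/var_events_mem.
have sep' e : e \in all_events ivs (id + size iv) -> evar e != id.
  by case/(all_events_mem wivs) => h _ _; rewrite neq_ltn; apply/orP; right; lia.
have [|H1 H2 H3] := IH (id + size iv) wivs; first lia.
split.
- move=> e e'; rewrite !mem_cat => /orP[ein|ein] /orP[e'in|e'in] ee'.
  + exact: var_events_lt piv ein e'in.
  + by have := sep' _ e'in; rewrite -ee' sep ?eqxx.
  + by have := sep' _ ein; rewrite ee' sep ?eqxx.
  + exact: H1.
- move=> e; rewrite mem_cat => /orP[ein|ein] o.
    have [e' e'in lt] := var_events_opt ein o.
    by exists e'; rewrite ?mem_cat ?e'in // (sep _ ein) (sep _ e'in).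
  by have [e' e'in h] := H2 e ein o; exists e'; rewrite ?mem_cat ?e'in ?orbT.
- move=> e; rewrite mem_cat => /orP[ein|ein].
    case: (var_events_prev ein) => [[p0 ei]|[e' e'in [h1 h2]]].
      left; split=> // e'; rewrite mem_cat => /orP[|] e'in.
        by have [_ h _] := var_events_mem e'in; lia.
      by have [h _] := all_events_mem wivs e'in; rewrite (sep _ ein); lia.
    by right; exists e'; rewrite ?mem_cat ?e'in // (sep _ ein) (sep _ e'in).
  case: (H3 e ein) => [[p0 h]|[e' e'in h]].
    left; split=> // e'; rewrite mem_cat => /orP[|] e'in; last exact: h.
    by move=> ee; have := sep' _ ein; rewrite -ee sep ?eqxx.
  by right; exists e' => //; rewrite mem_cat e'in orbT.
Qed.

Lemma singles_mem ivs g : all (wf_domain d) ivs -> g \in singles ivs -> 0 < g.1 <= g.2 /\ g.2 <= d.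
Proof.
elim: ivs => //= iv ivs IH /andP[/and3P[_ wiv _] wivs]; rewrite mem_cat => /orP[|/(IH wivs)//].
by case: ifP => // _ /mapP[p /(allP wiv) hp ->] /=; lia.
Qed.

End AllEvents.

(** The parameter of the whole analysis: it is exactly the number of events that may branch, and
    [size_intervals] bounds it by the number of holes. *)
Definition excess (ivs : seq (seq (nat * nat))) := \sum_(iv <- ivs) (size iv).-1.

Lemma all_events_count ivs id : count eopt (all_events ivs id) = excess ivs.
Proof.
rewrite /excess; elim: ivs id => [|iv ivs IH] id /=; first by rewrite big_nil.
rewrite big_cons; case: eqP => [->|_]; first by rewrite IH.
by rewrite count_cat var_events_count IH.
Qed.

(** A domain that produces events has [s >= 2] intervals, and then [s <= 2 * (s - 1)]. *)
Lemma all_events_size d ivs id : all (wf_domain d) ivs -> size (all_events ivs id) <= 2 * excess ivs.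
Proof.
rewrite /excess; elim: ivs id => [|iv ivs IH] id //= /andP[/and3P[sz _ _] wivs].
rewrite big_cons; have := IH; case: eqP => [->|n1]; first by move=> h; rewrite h.
by move=> /(_ (id + size iv) wivs); rewrite size_cat size_var_events; lia.
Qed.

(** * Bucket sort of the events by right end *)

Section Sorting.

Variable (E : seq event).

(** Reversed because the program inserts each event at the front of the linked list of its end. *)
Definition bucket v := rev [seq e <- E | ehi e == v].

Definition by_end D := flatten [seq bucket v | v <- iota 1 D].

Lemma by_endS D : by_end D.+1 = by_end D ++ bucket D.+1.
Proof. by rewrite /by_end -[D.+1]addn1 iotaD map_cat flatten_cat /= cats0 add1n addn1. Qed.

Lemma perm_by_end_le D : all (fun e => 0 < ehi e) E ->
  perm_eq (by_end D) [seq e <- E | ehi e <= D].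
Proof.
move=> E0; elim: D => [|D IH].
  rewrite (_ : [seq _ <- _ | _] = [::]) //; apply/eqP; rewrite -[_ == _]negbK -has_filter.
  by apply/hasPn => e /(allP E0); rewrite -ltnNge.
rewrite by_endS; apply/permP => a; rewrite count_cat (permP IH) /bucket count_rev.
elim: (E) => //= e es IHe.
have -> : (ehi e <= D.+1) = (ehi e <= D) || (ehi e == D.+1) by rewrite leq_eqVlt ltnS orbC.
case: leqP => h; case: eqP => h' /=; lia.
Qed.

Lemma perm_by_end D : all (fun e => 0 < ehi e <= D) E -> perm_eq (by_end D) E.
Proof.
move=> ED; have := @perm_by_end_le D; rewrite (_ : [seq _ <- _ | _] = E).
  by apply; apply: sub_all ED => e /andP[].
by apply/all_filterP; apply: sub_all ED => e /andP[].
Qed.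

Lemma by_end_le D e : e \in by_end D -> ehi e <= D.
Proof.
case/flattenP => s /mapP[v]; rewrite mem_iota => hv -> .
by rewrite mem_rev mem_filter => /andP[/eqP->]; lia.
Qed.

Lemma by_end_pairwise D : pairwise (fun e e' => ehi e <= ehi e') (by_end D).
Proof.
elim: D => // D IH; rewrite by_endS pairwise_cat IH /=; apply/andP; split.
  apply/allrelP => e e' /by_end_le h; rewrite mem_rev mem_filter => /andP[/eqP-> _]; lia.
have /allP : {in bucket D.+1, forall e, ehi e == D.+1}.
  by move=> e; rewrite mem_rev mem_filter => /andP[].
by elim: (bucket D.+1) => //= e es IHe /andP[/eqP-> h]; rewrite IHe // andbT; apply: sub_all h => e' /eqP->.
Qed.

Lemma by_end_gt v D : v <= D -> [seq e <- by_end D | v < ehi e] =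
  flatten [seq bucket u | u <- iota v.+1 (D - v)].
Proof.
move=> vD; rewrite /by_end -{1}(subnKC vD) iotaD map_cat flatten_cat filter_cat.
rewrite -[RHS]cat0s; congr (_ ++ _).
  apply/eqP; rewrite -[_ == _]negbK -has_filter; apply/hasPn => e /by_end_le; lia.
rewrite add1n; apply/all_filterP/allP => e /flattenP[s /mapP[u]]; rewrite mem_iota => hu ->.
by rewrite mem_rev mem_filter => /andP[/eqP->]; lia.
Qed.

End Sorting.

(** What lets one bit per event stand for the hit set: when [e] is reached its predecessor is no
    longer pending, and afterwards the events whose predecessor is [e] are exactly those of its
    variable whose predecessor is not pending. *)
Fixpoint prev_ok (es : seq event) := match es with
  | [::] => True
  | e :: es' => [/\ 0 < eid e,
      forall e', e' \in es' -> evar e' = evar e -> eprev e' \in map eid (e :: es'),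
      eprev e \notin map eid (e :: es'),
      forall e', e' \in es' -> eprev e' = eid e -> evar e' = evar e
    & eid e \notin map eid es' /\ prev_ok es']
  end.

Lemma uniq_map_inj (T U : eqType) (f : T -> U) (s : seq T) :
  uniq (map f s) -> {in s &, injective f}.
Proof.
elim: s => //= x s IH /andP[nx us] y z; rewrite !inE.
case/predU1P=> [->|yin]; case/predU1P=> [->|zin] // fxz.
- by rewrite fxz map_f in nx.
- by rewrite -fxz map_f in nx.
- exact: IH.
Qed.

(** Within a variable identifiers and ends increase together, so sorting by end keeps its intervals
    in domain order, however ties between variables are broken. *)
Lemma chained_sorted E D es : chained E ->
  (forall e, e \in E -> [/\ 0 < eid e, elo e <= ehi e & ehi e <= D]) ->
  uniq (map eid E) -> perm_eq es E -> pairwise (fun e e' => ehi e <= ehi e') es ->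
  wf_events D es /\ prev_ok es.
Proof.
move=> [H1 H2 H3] bnd uE pE; have mE := perm_mem pE.
have {}uE : uniq (map eid es) by rewrite (perm_uniq (perm_map eid pE)).
have inj := uniq_map_inj uE.
(* The induction runs over suffixes while membership still refers to the whole list [es], because
   predecessors and successors must be located in it. *)
move=> srt; have [pre epre] : exists pre, es = pre ++ es by exists [::].
have {}mE e : (e \in es) = (e \in E) by rewrite mE.
move: {2 3 4}es epre => suf; elim: suf pre => // e suf IH pre epre.
have [|wf pv] := IH (rcons pre e); first by rewrite cat_rcons.
have ein : e \in es by rewrite epre mem_cat mem_head orbT.
have sin e' : e' \in suf -> e' \in es by move=> h; rewrite epre mem_cat inE h !orbT.
move: srt uE; rewrite epre pairwise_cat map_cat cat_uniq.
move=> /and3P[/allrelP hpre _ /= /andP[/allP hsuf _]] /and3P[_ _ /andP[esuf _]].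
have after e' : e' \in es -> ehi e < ehi e' -> e' \in suf.
  rewrite {1}epre mem_cat inE => /or3P[e'in|/eqP->|//]; last by rewrite ltnn.
  by have := hpre e' e e'in (mem_head _ _); lia.
have lt e' : e' \in suf -> evar e' = evar e -> eid e < eid e'.
  move=> e'in ve; rewrite ltnNge; apply/negP; rewrite leq_eqVlt => /predU1P[eqi|lti].
    by move: esuf; rewrite -eqi map_f.
  have [||_] := H1 _ _ _ _ ve lti; rewrite -?mE //; first exact: sin.
  by have := hsuf _ e'in; lia.
have [id0 lh hD] := bnd e (etrans (esym (mE e)) ein).
split.
  split=> //; first by rewrite lh.
  apply/idP/hasP => [o|[e' e'in /eqP ve]].
    have [|e' e'E [ve lti]] := H2 e _ o; first by rewrite -mE.
    have [|_ lte] := H1 e e' _ e'E (esym ve) lti; first by rewrite -mE.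
    by exists e'; [apply: after; rewrite ?mE|rewrite ve].
  by have [] := H1 e e' _ _ (esym ve) (lt _ e'in ve); rewrite -?mE //; apply: sin.
split=> //=.
- move=> e' e'in ve; have lti := lt _ e'in ve.
  have e'E : e' \in E by rewrite -mE sin.
  case: (H3 _ e'E) => [[_ h]|[e1 e1E [v1 i1 p1]]].
    by have := h e; rewrite -mE => /(_ ein (esym ve)); lia.
  rewrite -i1 inE; have [lt1|lt1|eq1] := ltngtP (eid e) (eid e1); last by [].
    rewrite map_f ?orbT //; apply: after; first by rewrite mE.
    by have [] := H1 e e1 _ e1E _ lt1; rewrite -?mE // v1.
  lia.
- case: (H3 e) => [|[-> _]|[e1 e1E [v1 <- p1]]]; first by rewrite -mE.
    apply/negP; rewrite inE => /predU1P[h|/mapP[e' e'in h]]; first by rewrite -h in id0.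
    by have [] := bnd e'; rewrite -?mE ?sin // -h.
  have [||_ lte] := H1 e1 e e1E _ v1; rewrite -?mE //; first by lia.
  have e1in : e1 \in es by rewrite mE.
  apply/negP; rewrite inE => /predU1P[h|/mapP[e' e'in h]].
    by rewrite (inj _ _ e1in ein h) ltnn in lte.
  have := inj _ _ e1in (sin _ e'in) h => e1e'.
  by have := hsuf _ e'in; rewrite -e1e'; lia.
- move=> e' e'in pe; have e'E : e' \in E by rewrite -mE sin.
  case: (H3 _ e'E) => [[p0 _]|[e1 e1E [v1 i1 _]]]; first by rewrite -pe p0 in id0.
  have e1in : e1 \in es by rewrite mE.
  by rewrite -v1 (inj e1 e) // i1.
Qed.

(** * Feasibility of the events and hitting of all domains *)

Definition hits (pts : seq nat) (iv : seq (nat * nat)) :=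
  has (fun p => has (fun s => p.1 <= s <= p.2) pts) iv.

Lemma hits_shift pts iv : hits pts iv =
  has (fun p => has (fun s => p.1.+1 <= s <= p.2.+1) (map succn pts)) iv.
Proof. by apply: eq_has => p; rewrite has_map; apply: eq_has => s. Qed.

Lemma hits_unshift pts iv :
  has (fun p => has (fun s => p.1.+1 <= s <= p.2.+1) pts) iv -> hits (map predn pts) iv.
Proof.
case/hasP => p pin /hasP[s sin h]; apply/hasP; exists p => //.
by rewrite has_map; apply/hasP; exists s => //=; lia.
Qed.

Lemma all_events_hits d ivs id pts : all (wf_domain d) ivs ->
  ((forall g : nat * nat, g \in singles ivs -> exists2 s : nat, s \in pts & stabs s g) /\
   (forall e, e \in all_events ivs id -> exists (e' : event) (s : nat),
      [/\ e' \in all_events ivs id, evar e' = evar e, s \in pts & estabs e' s])) <->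
  all (fun iv => has (fun p => has (fun s => p.1.+1 <= s <= p.2.+1) pts) iv) ivs.
Proof.
elim: ivs id => [|iv ivs IH] id; first by split.
move=> /= /andP[wiv wivs]; case: (altP (size iv =P 1)) => [s1|n1].
  rewrite -(rwP andP) -(IH id) //.
  case: iv s1 wiv => [|p [|]] //= _ _; rewrite orbF; split.
    case=> Hs He; split; last by split=> // g gin; apply: Hs; rewrite inE gin orbT.
    have [|s sin sg] := Hs (p.1.+1, p.2.+1); first by rewrite mem_head.
    by apply/hasP; exists s.
  case=> /hasP[s sin sp] [Hs He]; split=> // g; rewrite inE => /predU1P[->|]; last exact: Hs.
  by exists s.
rewrite -(rwP andP) -(IH (id + size iv)) //=.
have sep e : e \in var_events iv id id 0 -> evar e = id by case/var_events_mem.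
have [sz _ _] := and3P wiv.
have sep' e : e \in all_events ivs (id + size iv) -> evar e != id.
  by case/(all_events_mem wivs) => h _ _; rewrite neq_ltn; apply/orP; right; lia.
split.
  case=> Hs He; split; last split=> //.
    case E : iv sz => [//|p iv'] _.
    have [|e1 e1in _] := @var_events_has id iv id 0 p; first by rewrite E mem_head.
    have [|e' [s [e'in ve sin es]]] := He e1; first by rewrite mem_cat e1in.
    have e'iv : e' \in var_events iv id id 0.
      move: e'in; rewrite mem_cat => /orP[//|/sep']; by rewrite ve sep ?eqxx.
    have [_ _ [q qin [lo hi]]] := var_events_mem e'iv.
    by rewrite -E; apply/hasP; exists q => //; apply/hasP; exists s => //; rewrite -lo -hi.
  move=> e ein; have [|e' [s [e'in ve sin es]]] := He e; first by rewrite mem_cat ein orbT.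
  exists e', s; split=> //; move: e'in; rewrite mem_cat => /orP[/sep h|//].
  by have := sep' _ ein; rewrite -ve h eqxx.
case=> /hasP[p pin /hasP[s sin sp]] [Hs He]; split=> // e; rewrite mem_cat => /orP[ein|ein].
  have [e' e'in [lo hi]] := @var_events_has id iv id 0 p pin.
  exists e', s; split; rewrite ?mem_cat ?e'in // ?(sep _ ein) ?(sep _ e'in) //.
  by rewrite /estabs lo hi.
by have [e' [s' [e'in ve s'in es]]] := He e ein; exists e', s'; split; rewrite ?mem_cat ?e'in ?orbT.
Qed.

Lemma feasible_start d N ivs es : all (wf_domain d) ivs -> perm_eq es (all_events ivs 1) ->
  feasible N (singles ivs) (fun=> false) 0 0 es <->
  exists pts, size pts <= N /\ all (hits pts) ivs.
Proof.
move=> wf pE; have mE := perm_mem pE; split=> [[S [Sc Ss Se]]|[pts [sz hp]]].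
  exists (map predn S); rewrite size_map -[size S]addn0; split=> //.
  suff : all (fun iv => has (fun p => has (fun s => p.1.+1 <= s <= p.2.+1) S) iv) ivs.
    by apply: sub_all => iv; apply: hits_unshift.
  apply: (proj1 (@all_events_hits d ivs 1 S wf)).
  split=> [g gin|e]; first by have [/andP[g0 _] _] := singles_mem wf gin; apply: Ss.
  rewrite -mE => /Se/(_ isT)[e' [s [e'in ve sin es']]]; exists e', s; split=> //; first by rewrite -mE.
  (* By the shift, events start at 1 or later, so the initial position 0 stabs nothing. *)
  move: sin; rewrite inE => /predU1P[s0|//]; move: es'; rewrite s0 /estabs.
  have [_ _ [/andP[lo0 _] _]] := all_events_mem wf (etrans (esym (mE e')) e'in).
  by rewrite leqNgt lo0.
have [|Hs He] := proj2 (@all_events_hits d ivs 1 (map succn pts) wf).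
  by apply: sub_all hp => iv; rewrite hits_shift.
exists (map succn pts); rewrite size_map addn0; split=> // [g /Hs//|e].
rewrite mE => /He[e' [s [e'in ve sin es']]] _; exists e', s; split; rewrite ?mE ?inE ?sin ?orbT //.
Qed.

(** * Maximal intervals of a domain and its holes *)

Section Domains.

Variable d : nat.
Implicit Types A : {set 'I_d}.

Lemma memnP A i : reflect (exists2 v : 'I_d, v \in A & val v = i) (memn A i).
Proof.
apply: (iffP existsP) => [[v /andP[vA /eqP vi]]|[v vA vi]]; exists v => //.
by rewrite vA vi eqxx.
Qed.

Lemma memn_lt A i : memn A i -> i < d. Proof. by case/memnP => v _ <-; apply: ltn_ord. Qed.

Lemma memn_ord A (v : 'I_d) : memn A v = (v \in A).
Proof.
by apply/memnP/idP => [[u uA /val_inj <-]|vA] //; exists v.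
Qed.

Lemma maxintP A l r : reflect [/\ l <= r, forall i, l <= i <= r -> memn A i,
    l = 0 \/ ~~ memn A l.-1 & ~~ memn A r.+1] (is_maxint A l r).
Proof.
apply: (iffP and4P) => -[h1 h2 h3 h4]; split=> //.
- by move=> i hi; apply: (allP h2); rewrite mem_iota; lia.
- by case/orP: h3 => [/eqP|]; [left|right].
- by apply/allP => i; rewrite mem_iota => hi; apply: h2; lia.
- by case: h3 => [->|->]; rewrite ?orbT.
Qed.

Lemma mem_intervals A (p : nat * nat) : p \in intervals A = is_maxint A p.1 p.2.
Proof.
apply/idP/idP => [/allpairsPdep[l [r [_ rin ->]]]|h].
  by move: rin; rewrite mem_filter => /andP[].
have [lr hA _ _] := maxintP _ _ _ h.
have rd : p.2 < d by apply: (@memn_lt A); apply: hA; lia.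
apply/allpairsPdep; exists p.1, p.2; split.
- by rewrite mem_iota; lia.
- by rewrite mem_filter h mem_iota.
- by case: (p).
Qed.

Lemma intervals_hit A (v : 'I_d) : v \in A = has (fun p => p.1 <= v <= p.2) (intervals A).
Proof.
apply/idP/hasP => [vA|[p]]; last first.
  by rewrite mem_intervals => /maxintP[_ h _ _] /h; rewrite memn_ord.
have [l [lv lA lmax]] : exists l, [/\ l <= v, forall i, l <= i <= v -> memn A i &
    l = 0 \/ ~~ memn A l.-1].
  have : memn A v by rewrite memn_ord.
  elim: (nat_of_ord v) => [|n IH] hn.
    by exists 0; split=> // [i|]; [case: i => //|left].
  case hn' : (memn A n); last first.
    by exists n.+1; split=> // [i hi|]; [rewrite (_ : i = n.+1) //; lia|right; rewrite /= hn'].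
  have [l [lv lA lmax]] := IH hn'; exists l; split=> // [|i hi]; first lia.
  by have [->//|/eqP ni] := eqVneq i n.+1; apply: lA; lia.
have [r [vr rA rmax]] : exists r, [/\ v <= r, forall i, v <= i <= r -> memn A i & ~~ memn A r.+1].
  have : memn A v by rewrite memn_ord.
  have [k] := ubnP (d - v); elim: k (nat_of_ord v) => // k IH n kn hn.
  have nd := memn_lt hn.
  case hn' : (memn A n.+1); last first.
    by exists n; split=> // [i hi|]; [rewrite (_ : i = n) //; lia|rewrite hn'].
  have [|r [vr rA rmax]] := IH n.+1 _ hn'; first lia.
  exists r; split=> // [|i hi]; first lia.
  by have [->//|/eqP ni] := eqVneq i n; apply: rA; lia.
exists (l, r) => /=; last by rewrite lv vr.
rewrite mem_intervals /=; apply/maxintP; split=> //; first lia.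
by move=> i hi; case: (leqP i v) => h; [apply: lA|apply: rA]; lia.
Qed.

Lemma maxint_sep A l r l' r' : is_maxint A l r -> is_maxint A l' r' -> l < l' -> r < l'.
Proof.
move=> /maxintP[lr hA _ _] /maxintP[lr' hA' [l0|nl] _] ll; first lia.
rewrite ltnNge; apply/negP => h; case/negP: nl; apply: hA; lia.
Qed.

Lemma intervals_pairwise A : pairwise (fun p q => p.2 < q.2) (intervals A).
Proof.
have iotaP n m : pairwise ltn (iota m n).
  by rewrite -sorted_pairwise ?iota_ltn_sorted //; exact: ltn_trans.
suff gen ls : pairwise ltn ls -> pairwise (fun p q : nat * nat => p.2 < q.2)
    [seq (l, r) | l <- ls, r <- [seq r <- iota 0 d | is_maxint A l r]] by apply: gen.
elim: ls => //= l ls IH /andP[hl /IH{}IH].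
rewrite pairwise_cat IH andbT; apply/andP; split.
  apply/allrelP => p q /mapP[r]; rewrite mem_filter => /andP[m _] ->.
  case/allpairsPdep => l' [r' [l'in]]; rewrite mem_filter => /andP[m' _] -> /=.
  have := maxint_sep m m' (allP hl _ l'in).
  by case/maxintP: m' => h _ _ _; lia.
by rewrite pairwise_map; apply: subseq_pairwise (filter_subseq _ _) (iotaP d 0).
Qed.

Lemma intervals_wf A : A != set0 -> wf_domain d (intervals A).
Proof.
move=> /set0Pn[v vA]; apply/and3P; split; last exact: intervals_pairwise.
  by move: vA; rewrite intervals_hit; case: (intervals A).
apply/allP => p; rewrite mem_intervals => /maxintP[lr hA _ _]; rewrite lr.
by apply: (@memn_lt A); apply: hA; lia.
Qed.

(* Every maximal interval but the first one starts right after a hole, which determines it. *)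
Lemma size_intervals A : (size (intervals A)).-1 <= nholes A.
Proof.
case E : (intervals A) => [|p0 iv] //=.
have uiv : uniq (map fst iv).
  have : pairwise (fun p q : nat * nat => p.1 < q.1) (intervals A).
    apply: (sub_in_pairwise (P := mem (intervals A))) (intervals_pairwise A); last exact/allP.
    move=> p q pin qin h; rewrite ltnNge; apply/negP.
    have mp : is_maxint A p.1 p.2 by rewrite -mem_intervals.
    have mq : is_maxint A q.1 q.2 by rewrite -mem_intervals.
    have [lrp _ _ _] := maxintP _ _ _ mp; have [lrq _ _ _] := maxintP _ _ _ mq.
    rewrite leq_eqVlt => /predU1P[eq|lt]; last first.
      by have s := maxint_sep mq mp lt; have := leq_ltn_trans (leq_trans (ltnW s) lrp) h; rewrite ltnn.
    have [_ hA _ _] := maxintP _ _ _ mq; have [_ _ _ /negP] := maxintP _ _ _ mp.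
    by apply; apply: hA; rewrite eq h andbT leqW.
  rewrite E /= => /andP[_ h]; apply: (sorted_uniq (leT := ltn)) => //; first exact: ltn_trans.
    exact: ltnn.
  by rewrite sorted_pairwise ?pairwise_map //; exact: ltn_trans.
(* Left ends of the intervals after the first are matched with the upper elements of holes; being
   distinct, they cannot outnumber the holes. *)
rewrite -(size_map fst) /nholes cardE -(size_map (fun u : 'I_d * 'I_d => val u.2)).
apply: uniq_leq_size => // _ /mapP[q qin ->].
have p0lt : p0.2 < q.2 by have := intervals_pairwise A; rewrite E /= => /andP[/allP/(_ _ qin)].
have m0 : is_maxint A p0.1 p0.2 by rewrite -mem_intervals E mem_head.
have mq : is_maxint A q.1 q.2 by rewrite -mem_intervals E inE qin orbT.
have [lr0 h0 _ n0] := maxintP _ _ _ m0; have [lrq hq nq _] := maxintP _ _ _ mq.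
have lt : p0.2 < q.1.
  apply: maxint_sep m0 mq _; rewrite ltnNge; apply/negP => le.
  by case/negP: n0; apply: hq; lia.
have /memnP[u0 u0A u0v] : memn A p0.1 by apply: h0; lia.
have /memnP[w wA wv] : memn A q.1 by apply: hq; lia.
have nv : ~~ memn A q.1.-1 by case: nq => // q0; rewrite q0 in lt.
(* The lower element of the hole is the largest member of [A] below [w]; [u0], from the first
   interval, shows that there is one. The missing value is the one just before [q.1]. *)
have P0 : (u0 \in A) && (u0 < w) by rewrite u0A /= -[X in X < _]/(val u0) u0v -[X in _ < X]/(val w) wv; lia.
case: (@arg_maxnP _ u0 (fun u : 'I_d => (u \in A) && (u < w)) val P0) => u /andP[uA uw] umax.
have vd : q.1.-1 < d by have := ltn_ord w; rewrite -[X in X < _]/(val w) wv; lia.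
have vA : Ordinal vd \notin A by rewrite -memn_ord.
apply/mapP; exists (u, w); rewrite ?wv //= mem_enum inE /=.
apply/and4P; split=> //.
  apply/existsP; exists (Ordinal vd); rewrite vA /=.
  have un : u != q.1.-1 :> nat by apply: contraNneq nv => <-; rewrite memn_ord.
  have wv' : w = q.1 :> nat by [].
  rewrite wv' in uw *; have q0 : 0 < q.1 by apply: leq_ltn_trans lt.
  have le : u <= q.1.-1 by rewrite -ltnS prednK.
  by rewrite ltn_neqAle un le ltn_predL.
apply/forallP => v; apply/implyP => /andP[uv vw]; apply/negP => vin.
have /umax : (v \in A) && (v < w) by rewrite vin.
by rewrite /geq /= leqNgt uv.
Qed.

End Domains.

(** Arbitrary lists of naturals may replace subsets of the values: a point inside an interval of a
    domain is below [d], and repetitions only lengthen the list. *)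
Lemma consistent_hits n d (dom : 'I_n -> {set 'I_d}) (N : Z) : (0 <= N)%Z ->
  consistent dom N <-> exists pts, size pts <= Z.abs_nat N /\
    all (hits pts) [seq intervals (dom x) | x <- enum 'I_n].
Proof.
move=> N0; have eN : Z.of_nat (Z.abs_nat N) = N by rewrite Zabs2Nat.id_abs Z.abs_eq.
split=> [[S [SN hS]]|[pts [sz hp]]].
  exists [seq val v | v <- enum S]; rewrite size_map -cardE; split; first by apply/leP/Nat2Z.inj_le; rewrite eN.
  apply/allP => _ /mapP[x _ ->]; have /set0Pn[v] := hS x.
  rewrite inE intervals_hit => /andP[/hasP[p pin hp] vS].
  apply/hasP; exists p => //; apply/hasP; exists (val v) => //.
  by apply: map_f; rewrite mem_enum.
exists [set v : 'I_d | val v \in pts]; split.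
  rewrite -eN; apply/Nat2Z.inj_le/leP; apply: leq_trans sz.
  rewrite cardE -(size_map val); apply: uniq_leq_size; first by rewrite map_inj_uniq ?enum_uniq //; exact: val_inj.
  by move=> _ /mapP[v vin ->]; move: vin; rewrite mem_enum inE.
move=> x; have /hasP[p pin /hasP[s sin /andP[s1 s2]]] : hits pts (intervals (dom x)).
  by apply: (allP hp); apply: map_f; rewrite mem_enum.
have := pin; rewrite mem_intervals => /maxintP[_ hA _ _].
have /memnP[v vA vs] : memn (dom x) s by apply: hA; rewrite s1.
by apply/set0Pn; exists v; rewrite !inE vA vs.
Qed.

Lemma encode_records n d (dom : 'I_n -> {set 'I_d}) N :
  encode dom N = [:: n; d; (if (N <? 0)%Z then 1 else 0); Z.abs_nat N] ++
    records [seq intervals (dom x) | x <- enum 'I_n].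
Proof. by rewrite /encode /records -map_comp. Qed.

Lemma excess_holes n d (dom : 'I_n -> {set 'I_d}) :
  excess [seq intervals (dom x) | x <- enum 'I_n] <= total_holes dom.
Proof.
rewrite /excess /total_holes big_map big_enum /=; apply: leq_sum => x _; exact: size_intervals.
Qed.

(** * The program *)

Notation vD := 0 (only parsing).
Notation vN := 1 (only parsing).
Notation vQ := 2 (only parsing).
Notation vC := 3 (only parsing).
Notation vPR := 4 (only parsing).
Notation vM := 5 (only parsing).
Notation vL := 6 (only parsing).
Notation vR := 7 (only parsing).
Notation vSG := 8 (only parsing).
Notation vID := 9 (only parsing).
Notation vV := 10 (only parsing).
Notation vBD := 11 (only parsing).
Notation vNX := 12 (only parsing).
Notation vCU := 13 (only parsing).
Notation vSP := 14 (only parsing).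
Notation vANS := 15 (only parsing).
Notation vCE := 16 (only parsing).
Notation vCP := 17 (only parsing).
Notation vCC := 18 (only parsing).
Notation vSV := 19 (only parsing).
Notation vPS := 20 (only parsing).
Notation vCS := 21 (only parsing).
Notation vPB := 22 (only parsing).
Notation vH := 23 (only parsing).
Notation vHS := 24 (only parsing).
Notation vBR := 25 (only parsing).
Notation vOP := 26 (only parsing).
Notation vNS := 27 (only parsing).

Notation aINP := 0 (only parsing).
Notation aMINR := 1 (only parsing).
Notation aHEAD := 2 (only parsing).
Notation aTAIL := 3 (only parsing).
Notation aSNEXT := 4 (only parsing).
Notation aELO := 5 (only parsing).
Notation aEHI := 6 (only parsing).
Notation aEPREV := 7 (only parsing).
Notation aEOPT := 8 (only parsing).
Notation aNXT := 9 (only parsing).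
Notation aLL := 10 (only parsing).
Notation aCNT := 11 (only parsing).
Notation aBIT := 12 (only parsing).
Notation aTE := 13 (only parsing).
Notation aTEB := 14 (only parsing).
Notation aTB := 15 (only parsing).
Notation aTP := 16 (only parsing).
Notation aTC := 17 (only parsing).
Notation aTSV := 18 (only parsing).
Notation aTPS := 19 (only parsing).
Notation aTCS := 20 (only parsing).

Definition Succ e := Plus e (Cst 1).
Definition Not e := Ite e (Cst 0) (Cst 1).
Definition And e1 e2 := Ite e1 e2 (Cst 0).
Definition Or e1 e2 := Ite e1 (Cst 1) e2.
Definition Le e1 e2 := Not (Minus e1 e2).

(* [aMINR] maps [l] to the least end of a single interval starting at [l], or 0; [aHEAD] and [aTAIL]
   delimit the list, linked by [aSNEXT], of the events ending at a given value.  For a single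
   interval the writes to the event arrays go to the unused index 0. *)
Definition parse_loop := Loop
  [:: Asg vD (Get aINP (Cst 1)); Asg vN (Get aINP (Cst 3)); Asg vC (Get aINP (Cst 4)); Asg vQ (Cst 5);
      Asg vPR (Cst 0); Asg vM (Cst 0)]
  (Var vC)
  [:: Asg vL (Succ (Get aINP (Var vQ)));
      Asg vR (Succ (Get aINP (Succ (Var vQ))));
      Asg vQ (Plus (Var vQ) (Cst 2));
      Asg vC (Minus (Var vC) (Cst 1));
      Asg vSG (And (Not (Var vC)) (Not (Var vPR)));
      Asg vID (Ite (Var vSG) (Cst 0) (Succ (Var vM)));
      Put aMINR (Var vL) (Ite (And (Var vSG) (Or (Not (Get aMINR (Var vL))) (Le (Var vR) (Get aMINR (Var vL)))))
                         (Var vR) (Get aMINR (Var vL)));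
      Put aELO (Var vID) (Var vL);
      Put aEHI (Var vID) (Var vR);
      Put aEPREV (Var vID) (Var vPR);
      Put aEOPT (Var vID) (Var vC);
      Put aSNEXT (Var vID) (Get aHEAD (Var vR));
      Put aTAIL (Var vR) (Ite (Or (Var vSG) (Get aHEAD (Var vR))) (Get aTAIL (Var vR)) (Var vID));
      Put aHEAD (Var vR) (Ite (Var vSG) (Get aHEAD (Var vR)) (Var vID));
      Asg vM (Ite (Var vSG) (Var vM) (Var vID));
      Asg vPR (Ite (Var vC) (Var vID) (Cst 0));
      Asg vNS (Var vC);
      Asg vC (Ite (Var vC) (Var vC) (Get aINP (Var vQ)));
      Asg vQ (Ite (Var vNS) (Var vQ) (Succ (Var vQ)))].

(** Downward sweep: [vNX] is the least end of a single interval starting beyond the current value,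
    [vBD] the nearest event end, [vCU] the head of the sorted event list built so far. Linking the
    tail of a bucket to [vCU] concatenates in constant time. The entry at [d + 1] makes the
    fictitious sibling position a fixed point. *)
Definition table_loop := Loop
  [:: Asg vBD (Var vD); Asg vNX (Succ (Var vD)); Asg vCU (Cst 0); Asg vV (Var vD);
      Put aNXT (Succ (Var vD)) (Succ (Var vD))]
  (Var vV)
  [:: Put aNXT (Var vV) (Var vNX);
      Asg vBD (Ite (Get aHEAD (Var vV)) (Var vV) (Var vBD));
      Put aLL (Var vV) (Ite (Le (Var vNX) (Var vBD)) (Get aLL (Var vNX)) (Var vV));
      Put aCNT (Var vV) (Ite (Le (Var vNX) (Var vBD)) (Succ (Get aCNT (Var vNX))) (Cst 0));
      Put aSNEXT (Get aTAIL (Var vV)) (Ite (Get aHEAD (Var vV)) (Var vCU) (Get aSNEXT (Get aTAIL (Var vV))));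
      Asg vCU (Ite (Get aHEAD (Var vV)) (Get aHEAD (Var vV)) (Var vCU));
      Asg vNX (Ite (And (Get aMINR (Var vV)) (Le (Get aMINR (Var vV)) (Var vNX))) (Get aMINR (Var vV)) (Var vNX));
      Asg vV (Minus (Var vV) (Cst 1))].

(* A stack entry consists of the next event, the event just processed and its bit, the position and
   the count, and the last branching event with the position and the count of the sibling. *)
Definition push k e1 e2 e3 e4 e5 e6 e7 e8 :=
  [:: Put aTE (Plus (Var vSP) (Cst k)) e1; Put aTEB (Plus (Var vSP) (Cst k)) e2;
      Put aTB (Plus (Var vSP) (Cst k)) e3; Put aTP (Plus (Var vSP) (Cst k)) e4;
      Put aTC (Plus (Var vSP) (Cst k)) e5; Put aTSV (Plus (Var vSP) (Cst k)) e6;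
      Put aTPS (Plus (Var vSP) (Cst k)) e7; Put aTCS (Plus (Var vSP) (Cst k)) e8].

(** The bit of the event just processed is written when an entry is popped, not when it is pushed:
    the second child thereby replaces the value left by the first. *)
Definition visit :=
  [:: Put aBIT (Get aTEB (Var vSP)) (Get aTB (Var vSP));
      Asg vCE (Get aTE (Var vSP));
      Asg vCP (Get aTP (Var vSP)); Asg vCC (Get aTC (Var vSP)); Asg vSV (Get aTSV (Var vSP));
      Asg vPS (Get aTPS (Var vSP)); Asg vCS (Get aTCS (Var vSP));
      Asg vSP (Minus (Var vSP) (Cst 1));
      Asg vR (Get aEHI (Var vCE));
      Asg vL (Get aELO (Var vCE));
      Asg vNX (Get aNXT (Var vCP));
      Asg vCC (Ite (Le (Var vNX) (Var vR)) (Plus (Succ (Var vCC)) (Get aCNT (Var vNX))) (Var vCC));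
      Asg vCP (Ite (Le (Var vNX) (Var vR)) (Get aLL (Var vNX)) (Var vCP));
      Asg vNX (Get aNXT (Var vPS));
      Asg vCS (Ite (Le (Var vNX) (Var vR)) (Plus (Succ (Var vCS)) (Get aCNT (Var vNX))) (Var vCS));
      Asg vPS (Ite (Le (Var vNX) (Var vR)) (Get aLL (Var vNX)) (Var vPS));
      Asg vPR (Get aEPREV (Var vCE));
      Asg vPB (Get aBIT (Var vPR));
      Asg vH (Or (Var vPB) (Le (Var vL) (Var vCP)));
      Asg vHS (Or (Ite (And (Le (Var vPR) (Var vSV)) (Le (Var vSV) (Var vPR))) (Not (Var vPB)) (Var vPB))
                 (Le (Var vL) (Var vPS)));
      Asg vOP (Get aEOPT (Var vCE));
      Asg vBR (And (Not (Var vH))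
               (Or (Var vHS) (Not (Le (Plus (Var vCS) (Get aBIT (Var vSV))) (Var vCC)))));
      Asg vBR (And (Var vOP) (Var vBR));
      Asg vANS (Ite (Var vCE) (Var vANS) (Or (Var vANS) (Le (Var vCC) (Var vN))));
      Asg vNS (Get aSNEXT (Var vCE))].

(** Both children are always written and the new stack height decides how many are kept. The placing
    child is on top; at a leaf nothing is kept. *)
Definition branch :=
  push 1 (Var vNS) (Var vCE) (Ite (Var vOP) (Var vH) (Cst 1))
     (Ite (Or (Var vOP) (Var vH)) (Var vCP) (Var vR))
     (Ite (Or (Var vOP) (Var vH)) (Var vCC) (Succ (Var vCC)))
     (Ite (Var vBR) (Var vCE) (Ite (Var vOP) (Cst 0) (Var vSV)))
     (Ite (Var vBR) (Var vR) (Ite (Var vOP) (Succ (Var vD)) (Ite (Var vHS) (Var vPS) (Var vR))))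
     (Ite (Var vBR) (Succ (Var vCC)) (Ite (Var vOP) (Cst 0) (Ite (Var vHS) (Var vCS) (Succ (Var vCS))))) ++
   push 2 (Var vNS) (Var vCE) (Cst 1) (Var vR) (Succ (Var vCC)) (Var vCE) (Var vCP) (Var vCC) ++
   [:: Asg vSP (Ite (Var vCE) (Plus (Var vSP) (Ite (Var vBR) (Cst 2) (Cst 1))) (Var vSP))].

(** Event 0 terminates the list. Its end is set to [d], so that a leaf performs the last jump with
    the code of an ordinary event. The table loop stops before value 0, hence [aNXT] at 0 is filled
    in here. *)
Definition search_loop := Loop
  ([:: Put aNXT (Cst 0) (Var vNX); Put aEHI (Cst 0) (Var vD); Asg vANS (Cst 0); Asg vSP (Cst 0)] ++
   push 1 (Var vCU) (Cst 0) (Cst 0) (Cst 0) (Cst 0) (Cst 0) (Succ (Var vD)) (Cst 0) ++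
   [:: Asg vSP (Cst 1)])
  (Var vSP)
  (visit ++ branch).

Definition loops := [:: parse_loop; table_loop; search_loop].

Lemma loops_fit : all loop_fits loops. Proof. by vm_compute. Qed.

Lemma run_asg Vs As x e cs :
  run (State Vs As) (Asg x e :: cs) = run (State (upd Vs x (eval (State Vs As) e)) As) cs.
Proof. by []. Qed.

Lemma run_put Vs As a e1 e2 cs :
  run (State Vs As) (Put a e1 e2 :: cs) =
  run (State Vs (set_array As a (upd (As a) (eval (State Vs As) e1) (eval (State Vs As) e2)))) cs.
Proof. by []. Qed.

Arguments upd _ _ _ _ /.
Arguments set_array _ _ _ _ /.

Lemma name_value (A : Type) (x : A) (P : A -> Prop) : (forall v, v = x -> P v) -> P x.
Proof. exact. Qed.

(* Naming the values through a lemma keeps them shared in the proof terms. *)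
Ltac name_as x v E := pattern x; apply name_value; intros v E; cbv beta; simpl in E.

Ltac exec1 :=
  (rewrite run_asg; let v := fresh "v" in let E := fresh "Ev" in
   match goal with |- context [eval ?s ?e] => name_as (eval s e) v E end) ||
  (rewrite run_put; let i := fresh "i" in let v := fresh "v" in let A := fresh "A" in
   let Ei := fresh "Ei" in let Ev := fresh "Ev" in let EA := fresh "EA" in
   match goal with |- context [upd ?f (eval ?s ?e) (eval ?s ?e')] =>
     name_as (eval s e) i Ei; name_as (eval s e') v Ev; name_as (upd f i v) A EA end).

(** * The parsing loop *)

Lemma parse_step Vs As :
  let l := As aINP (Vs vQ) + 1 in let r := As aINP (Vs vQ + 1) + 1 in
  let c := Vs vC - 1 in let sg := (c == 0) && (Vs vPR == 0) in
  let idn := if sg then 0 else Vs vM + 1 in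
  let s' := run (State Vs As) (body parse_loop) in
  [/\ [/\ vars s' vD = Vs vD, vars s' vN = Vs vN & vars s' vM = if sg then Vs vM else idn],
    [/\ vars s' vPR = if c == 0 then 0 else idn,
      vars s' vC = if c == 0 then As aINP (Vs vQ + 2) else c
      & vars s' vQ = Vs vQ + 2 + (c == 0)],
    [/\ arrs s' aINP = As aINP,
      arrs s' aMINR = upd (As aMINR) l (if sg && ((As aMINR l == 0) || (r <= As aMINR l)) then r else As aMINR l),
      arrs s' aELO = upd (As aELO) idn l, arrs s' aEHI = upd (As aEHI) idn r
      & arrs s' aEPREV = upd (As aEPREV) idn (Vs vPR)]
    & [/\ arrs s' aEOPT = upd (As aEOPT) idn c,
      arrs s' aSNEXT = upd (As aSNEXT) idn (As aHEAD r),
      arrs s' aTAIL = upd (As aTAIL) r (if sg || (As aHEAD r != 0) then As aTAIL r else idn)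
      & arrs s' aHEAD = upd (As aHEAD) r (if sg then As aHEAD r else idn)]].
Proof.
move=> l r c sg idn s'; have : s' = run (State Vs As) (body parse_loop) by [].
clearbody s'; rewrite /parse_loop [body _]/=; do 19!exec1; rewrite /run /= => ->.
rewrite /sg /c /idn /l /r /=; subst; rewrite /sg /c.
rewrite !subn_eq0.
case: (Vs vC <= 1); case: (Vs vPR == 0) => /=; rewrite ?addn0 ?addn1 //;
by case: (As aMINR (As aINP (Vs vQ)).+1 == 0); case: (As aHEAD (As aINP (Vs vQ).+1).+1 == 0);
   case: ((As aINP (Vs vQ).+1).+1 <= As aMINR (As aINP (Vs vQ)).+1).
Qed.

Fixpoint chain_to (nxt : nat -> nat) h l z := match l with
  | [::] => h = z
  | x :: l' => h = x /\ chain_to nxt (nxt x) l' z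
  end.

Lemma chain_to_ext nxt nxt' h l z : {in l, nxt =1 nxt'} -> chain_to nxt h l z -> chain_to nxt' h l z.
Proof.
elim: l h => //= x l IH h hx [-> h2]; split=> //.
by rewrite -hx ?mem_head //; apply: IH => // y yin; apply: hx; rewrite inE yin orbT.
Qed.

Definition parsed (As : nat -> nat -> nat) (E : seq event) (sg : seq (nat * nat)) :=
  [/\ map eid E = iota 1 (size E),
      forall e, e \in E -> [/\ As aELO (eid e) = elo e, As aEHI (eid e) = ehi e,
        As aEPREV (eid e) = eprev e & (As aEOPT (eid e) != 0) = eopt e],
      forall v, chain_to (As aSNEXT) (As aHEAD v) (map eid (bucket E v)) 0 /\
        As aTAIL v = last 0 (map eid (bucket E v))
    & forall v, (forall g : nat * nat, g \in sg -> g.1 = v -> 0 < As aMINR v <= g.2) /\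
        (As aMINR v != 0 -> (v, As aMINR v) \in sg)].

Lemma eid_gt0 As E sg e : parsed As E sg -> e \in E -> 0 < eid e <= size E.
Proof. by case=> h _ _ _ /(map_f eid); rewrite h mem_iota; lia. Qed.

Lemma bucket_rcons E e v :
  bucket (rcons E e) v = if ehi e == v then e :: bucket E v else bucket E v.
Proof. by rewrite /bucket filter_rcons; case: ifP => _ //; rewrite rev_rcons. Qed.

Lemma mem_bucket E v e : e \in bucket E v -> e \in E.
Proof. by rewrite mem_rev mem_filter => /andP[]. Qed.

Lemma parsed_single As As' E sg l r : parsed As E sg -> 0 < r ->
  (forall i, 0 < i -> [/\ As' aELO i = As aELO i, As' aEHI i = As aEHI i,
     As' aEPREV i = As aEPREV i, As' aEOPT i = As aEOPT i & As' aSNEXT i = As aSNEXT i]) ->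
  As' aTAIL =1 As aTAIL -> As' aHEAD =1 As aHEAD ->
  As' aMINR =1 upd (As aMINR) l (if (As aMINR l == 0) || (r <= As aMINR l) then r else As aMINR l) ->
  parsed As' E (rcons sg (l, r)).
Proof.
move=> pA r0 hi hT hH hM; have [h1 h2 h3 h4] := pA.
have idp e : e \in E -> 0 < eid e by move=> /(eid_gt0 pA)/andP[].
split=> //.
- move=> e ein; have [-> -> -> -> _] := hi _ (idp e ein); exact: h2.
- move=> v; have [c1 c2] := h3 v; rewrite hT hH; split=> //.
  apply: chain_to_ext c1 => i /mapP[e /mem_bucket/idp ep ->].
  by have [_ _ _ _ ->] := hi _ ep.
- move=> v; have [m1 m2] := h4 v; rewrite hM /=; case: eqVneq => [->|vl].
    split=> [g|_]; rewrite mem_rcons inE.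
      case/predU1P => [-> _|gin gl] /=; last rewrite -gl.
        by case: ifP; lia.
      have := proj1 (h4 g.1) g gin erefl; case: ifP => //; rewrite gl; lia.
    case: ifPn => [_|]; first by rewrite eqxx.
    by rewrite negb_or => /andP[/(proj2 (h4 l))-> _]; rewrite orbT.
  split=> [g|/m2 vin]; rewrite mem_rcons inE; last by rewrite vin orbT.
  by case/predU1P => [-> /= lv|]; [rewrite lv eqxx in vl|apply: m1].
Qed.

Lemma parsed_event As As' E sg e : parsed As E sg -> eid e = (size E).+1 ->
  As' aELO =1 upd (As aELO) (eid e) (elo e) -> As' aEHI =1 upd (As aEHI) (eid e) (ehi e) ->
  As' aEPREV =1 upd (As aEPREV) (eid e) (eprev e) ->
  (exists2 o, As' aEOPT =1 upd (As aEOPT) (eid e) o & (o != 0) = eopt e) ->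
  As' aSNEXT =1 upd (As aSNEXT) (eid e) (As aHEAD (ehi e)) ->
  As' aTAIL =1 upd (As aTAIL) (ehi e) (if As aHEAD (ehi e) != 0 then As aTAIL (ehi e) else eid e) ->
  As' aHEAD =1 upd (As aHEAD) (ehi e) (eid e) ->
  As' aMINR =1 As aMINR ->
  parsed As' (rcons E e) sg.
Proof.
move=> pA ee hL hI hP [o hO oe] hS hT hH hM; have [h1 h2 h3 h4] := pA.
have idp e' : e' \in E -> (eid e' == eid e) = false.
  by move=> /(eid_gt0 pA); rewrite ee => h; apply/eqP; lia.
have cx v : chain_to (As' aSNEXT) (As aHEAD v) (map eid (bucket E v)) 0.
  have [c1 c2] := h3 v; apply: chain_to_ext c1 => i /mapP[e' /mem_bucket/idp ep ->].
  by rewrite hS /= ep.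
split.
- by rewrite map_rcons h1 size_rcons ee -cats1 -(addn1 (size E)) iotaD add1n addn1.
- move=> e'; rewrite mem_rcons inE hL hI hP hO /= => /predU1P[->|e'in]; first by rewrite eqxx.
  by rewrite idp //; apply: h2.
- move=> v; have [c1 c2] := h3 v; rewrite bucket_rcons hT hH /= [v == _]eq_sym.
  case: eqVneq => [ev|_] //; split=> /=.
    by split=> //; rewrite hS /= eqxx -ev.
  have hb : forall e', e' \in bucket E v -> 0 < eid e' by move=> e' /mem_bucket/(eid_gt0 pA)/andP[].
  rewrite ev; move: c1 c2 hb; case: (bucket E v) => [|e1 b] /=; first by move=> -> _; rewrite eqxx.
  by case=> -> _ -> /(_ e1 (mem_head _ _)); case: (eid e1).
- by move=> v; rewrite hM.
Qed.

Definition fields (iv : seq (nat * nat)) : seq nat := flatten [seq [:: p.1; p.2] | p <- iv].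

Definition tape (inp : nat -> nat) q (w : seq nat) := forall i, inp (q + i) = nth 0 w i.

(** The premise on [prev] excludes what the program takes for a single interval: the last interval
    of a record met while [vPR] is 0. *)
Lemma parse_var iv ivs s E sg x prev : 0 < size iv -> (prev != 0) || (size iv != 1) ->
  vars s vC = size iv -> vars s vPR = prev -> vars s vM = size E ->
  tape (arrs s aINP) (vars s vQ) (fields iv ++ records ivs) ->
  parsed (arrs s) E sg ->
  exists s', [/\ steps parse_loop (size iv) s s',
    parsed (arrs s') (E ++ var_events iv (size E).+1 x prev) sg,
    [/\ vars s' vD = vars s vD, vars s' vN = vars s vN & vars s' vM = size E + size iv],
    vars s' vC = head 0 (records ivs) /\ vars s' vPR = 0
    & tape (arrs s' aINP) (vars s' vQ) (behead (records ivs))].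
Proof.
elim: iv s E prev => // p iv IH [Vs As] E prev _ np hC hP hM ht pA.
have := parse_step Vs As; cbv zeta; remember (run _ _) as s1 eqn:e1.
have sgF : (Vs vC - 1 == 0) && (Vs vPR == 0) = false.
  by move: np; rewrite /= in hC hP *; rewrite hC hP subSS subn0 eqSS; do 2!case: (_ == 0).
rewrite sgF /=; set r := As aINP (Vs vQ + 1) + 1; set l := As aINP (Vs vQ) + 1.
move=> [[hD hN hM1] [hP1 hC1 hQ1] [hI h1 h2 h3 h4] [h5 h6 h7 h8]].
rewrite /= in hC hP hM ht.
have lE : l = p.1.+1 by rewrite /l; have := ht 0; rewrite addn0 /= => ->; rewrite addn1.
have rE : r = p.2.+1 by rewrite /r (ht 1) /= addn1.
have c1E : Vs vC - 1 = size iv by rewrite hC subSS subn0.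
rewrite c1E in hP1 hC1 hQ1 h5.
set e := Event (size E).+1 p.1.+1 p.2.+1 x prev (0 < size iv).
have idE : Vs vM + 1 = eid e by rewrite hM addn1.
have p1 : parsed (arrs s1) (rcons E e) sg.
  apply: parsed_event pA _ _ _ _ _ _ _ _ _ => //.
  - by rewrite h2 idE lE.
  - by rewrite h3 idE rE.
  - by rewrite h4 idE hP.
  - by exists (size iv); [rewrite h5 idE|rewrite /e /= lt0n].
  - by rewrite h6 idE rE.
  - by rewrite h7 idE rE.
  - by rewrite h8 idE rE.
  - by move=> i; rewrite h1 /=; case: eqP => [->|].
have tn : Vs vC != 0 by rewrite hC.
case: (posnP (size iv)) => [iv0|ivp].
  have ivE : iv = [::] by case: (iv) iv0.
  exists s1; rewrite ivE in ht *; split.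
  - by rewrite e1; split.
  - by move: p1; rewrite /e ivE -cats1.
  - by split=> //; rewrite hM1 hM /= addn1.
  - by rewrite hP1 hC1 iv0 /= (ht 2) /= nth0.
  - move=> i; rewrite hI hQ1 iv0 /= -!addnA (ht (2 + (1 + i))) /=.
    by rewrite nth_behead.
have [|||||||s2 [st p2 [hD2 hN2 hM2] [hC2 hP2] ht2]] := IH s1 (rcons E e) (size E).+1.
- by [].
- by [].
- by rewrite hC1; case: (size iv) ivp.
- by rewrite hP1 idE; case: (size iv) ivp.
- by rewrite hM1 idE size_rcons.
- move=> i; rewrite hI hQ1 (gtn_eqF ivp) addn0 -addnA (ht (2 + i)) /=.
  by [].
- by [].
exists s2; split=> //.
- by split; rewrite -?e1 //; rewrite e1 in st.
- by rewrite size_rcons cat_rcons in p2.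
- by rewrite hD2 hN2 hM2 hD hN size_rcons /= addnS.
Qed.

Lemma parse_all d ivs s E sg : all (wf_domain d) ivs ->
  vars s vC = head 0 (records ivs) -> vars s vPR = 0 -> vars s vM = size E ->
  tape (arrs s aINP) (vars s vQ) (behead (records ivs)) -> parsed (arrs s) E sg ->
  exists s', [/\ steps parse_loop (\sum_(iv <- ivs) size iv) s s',
    parsed (arrs s') (E ++ all_events ivs (size E).+1) (sg ++ singles ivs),
    vars s' vD = vars s vD, vars s' vN = vars s vN & vars s' vC = 0].
Proof.
elim: ivs s E sg => [|iv ivs IH] s E sg.
  by move=> _ hC _ _ _ pA; exists s; rewrite big_nil !cats0.
move=> /= /andP[/and3P[sz wiv _] wivs] hC hP hM ht pA; rewrite big_cons.
case: (altP (size iv =P 1)) => [s1|n1]; last first.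
  have np : (0 != 0) || (size iv != 1) by rewrite n1.
  have [s1 [st p1 [hD1 hN1 hM1] [hC1 hP1] ht1]] := parse_var (size E).+1 sz np hC hP hM ht pA.
  have [|s2 [st2 p2 hD2 hN2 hC2]] := IH s1 _ _ wivs hC1 hP1 _ ht1 p1.
    by rewrite size_cat size_var_events.
  exists s2; split; rewrite ?hD2 ?hN2 //; first exact: steps_cat st st2.
  by move: p2; rewrite size_cat size_var_events catA addSn.
case: iv s1 sz wiv hC ht => [|p [|]] // _ _ wiv hC ht.
case: s hC hP hM ht pA => Vs As /= hC hP hM ht pA.
have := parse_step Vs As; cbv zeta; remember (run _ _) as s1 eqn:e1.
move=> F; rewrite hC hP subnn eqxx /= in F; move: F.
set r := As aINP (Vs vQ + 1) + 1; set l := As aINP (Vs vQ) + 1.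
move=> [[hD hN hM1] [hP1 hC1 hQ1] [hI h1 h2 h3 h4] [h5 h6 h7 h8]].
have lE : l = p.1.+1 by rewrite /l; have := ht 0; rewrite addn0 /= => ->; rewrite addn1.
have rE : r = p.2.+1 by rewrite /r (ht 1) /= addn1.
have p1 : parsed (arrs s1) E (rcons sg (p.1.+1, p.2.+1)).
  rewrite -lE -rE; apply: parsed_single pA _ _ _ _ _.
  - by rewrite rE.
  - by move=> i i0; rewrite h2 h3 h4 h5 h6 /= (gtn_eqF i0).
  - by move=> i; rewrite h7 /=; case: eqP => [->|].
  - by move=> i; rewrite h8 /=; case: eqP => [->|].
  - by rewrite h1.
have [|||s2 [st2 p2 hD2 hN2 hC2]] := IH s1 E _ wivs _ hP1 _ _ p1.
- by rewrite hC1 -nth0; exact: (ht 2).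
- by rewrite hM1.
- by move=> i; rewrite hI hQ1 -!addnA (ht (2 + (1 + i))) /= nth_behead.
have st1 : steps parse_loop 1 (State Vs As) s1 by split; rewrite ?e1 //= hC.
exists s2; split; [exact: steps_cat st1 st2| |by rewrite hD2|by rewrite hN2|by []].
by move: p2; rewrite cat_rcons.
Qed.

(** * The table loop *)

Lemma table_step Vs As :
  let v := Vs vV in let nx := Vs vNX in
  let bd := if As aHEAD v == 0 then Vs vBD else v in
  let s' := run (State Vs As) (body table_loop) in
  [/\ [/\ vars s' vD = Vs vD, vars s' vN = Vs vN, vars s' vBD = bd & vars s' vV = v.-1],
    [/\ vars s' vCU = if As aHEAD v == 0 then Vs vCU else As aHEAD v
      & vars s' vNX = if (0 < As aMINR v <= nx) then As aMINR v else nx],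
    [/\ arrs s' aNXT = upd (As aNXT) v nx,
      arrs s' aLL = upd (As aLL) v (if nx <= bd then As aLL nx else v),
      arrs s' aCNT = upd (As aCNT) v (if nx <= bd then (As aCNT nx).+1 else 0)
      & arrs s' aSNEXT = upd (As aSNEXT) (As aTAIL v)
          (if As aHEAD v == 0 then As aSNEXT (As aTAIL v) else Vs vCU)],
    [/\ arrs s' aHEAD = As aHEAD, arrs s' aTAIL = As aTAIL & arrs s' aMINR = As aMINR]
    & [/\ arrs s' aELO = As aELO, arrs s' aEHI = As aEHI, arrs s' aEPREV = As aEPREV
      & arrs s' aEOPT = As aEOPT]].
Proof.
move=> v nx bd s'; have : s' = run (State Vs As) (body table_loop) by [].
clearbody s'; rewrite /table_loop [body _]/=; do 8!exec1; rewrite /run /= => ->.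
rewrite /bd /nx /v /=; subst.
rewrite !subn_eq0 !addn1 !subn1 lt0n.
case: (As aHEAD (Vs vV) == 0) => /=; [case: (Vs vNX <= Vs vBD)|case: (Vs vNX <= Vs vV)] => /=;
by case: (As aMINR (Vs vV) == 0) => //=; case: (As aMINR (Vs vV) <= Vs vNX).
Qed.

Definition next_end (sg : seq (nat * nat)) d u x :=
  [/\ forall g : nat * nat, g \in sg -> u < g.1 -> x <= g.2,
      x <= d -> exists2 g : nat * nat, g \in sg & u < g.1 /\ g.2 = x
    & x <= d.+1].

Definition first_end E d u := head d [seq ehi e | e <- by_end E d & u <= ehi e].

Definition table_ok (As : nat -> nat -> nat) E sg d u :=
  next_end sg d u (As aNXT u) /\
  if As aNXT u <= first_end E d u
  then As aLL u = As aLL (As aNXT u) /\ As aCNT u = (As aCNT (As aNXT u)).+1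
  else As aLL u = u /\ As aCNT u = 0.

Definition events_at (As : nat -> nat -> nat) (E : seq event) :=
  forall e, e \in E -> [/\ As aELO (eid e) = elo e, As aEHI (eid e) = ehi e,
    As aEPREV (eid e) = eprev e & (As aEOPT (eid e) != 0) = eopt e].

(** Above [v] the tables and the links are final, while the buckets up to [v] are still as parsed;
    both halves must be tracked because they share the array [aSNEXT]. *)
Definition tabled (s : state) E sg d v :=
  [/\ events_at (arrs s) E,
    [/\ vars s vD = d, vars s vV = v, vars s vBD = first_end E d v.+1 & next_end sg d v (vars s vNX)],
    chain_to (arrs s aSNEXT) (vars s vCU) (map eid [seq e <- by_end E d | v < ehi e]) 0,
    (forall u, u <= v ->
      [/\ chain_to (arrs s aSNEXT) (arrs s aHEAD u) (map eid (bucket E u)) 0,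
        arrs s aTAIL u = last 0 (map eid (bucket E u)),
        forall g : nat * nat, g \in sg -> g.1 = u -> 0 < arrs s aMINR u <= g.2
      & arrs s aMINR u != 0 -> (u, arrs s aMINR u) \in sg])
    & arrs s aNXT d.+1 = d.+1 /\ forall u, v < u <= d -> table_ok (arrs s) E sg d u].

(** Uniqueness keeps the write at the last cell of [l1] away from all other links. *)
Lemma chain_to_append nxt h l1 l2 z : chain_to nxt h l1 0 -> l1 != [::] -> uniq (l1 ++ l2) ->
  chain_to nxt z l2 0 -> chain_to (upd nxt (last 0 l1) z) h (l1 ++ l2) 0.
Proof.
move=> c1 n1 u c2; have {}c2 : chain_to (upd nxt (last 0 l1) z) z l2 0.
  apply: chain_to_ext c2 => i iin /=; case: eqP => // il.
  move: u; rewrite cat_uniq => /and3P[_ /hasPn/(_ _ iin)/= /negP[]].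
  by rewrite il; case: (l1) n1 => //= x l _; rewrite mem_last.
case: l1 n1 c1 u c2 => // x l _ /= [-> c1] u c2; split=> //.
elim: l x c1 u c2 => [|y l IH] x /= c1 u c2; first by rewrite eqxx.
case: c1 => c1 c1'; have xl : (x == last y l) = false.
  by move: u => /andP[]; rewrite -cat_cons mem_cat negb_or => /andP[nx' _] _; apply: contraNF nx' => /eqP->; rewrite mem_last.
rewrite xl c1; split=> //; apply: IH => //; by case/andP: u.
Qed.

Lemma by_end_step E d v : v < d -> [seq e <- by_end E d | v < ehi e] =
  bucket E v.+1 ++ [seq e <- by_end E d | v.+1 < ehi e].
Proof.
by move=> vd; rewrite !by_end_gt // 1?ltnW // -[d - v]prednK ?subn_gt0 //= subnS.
Qed.

Section Table.

Variables (E : seq event) (sg : seq (nat * nat)) (d : nat).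
Hypothesis E_id : map eid E = iota 1 (size E).
Hypothesis E_hi : all (fun e => 0 < ehi e <= d) E.
Hypothesis sg_hi : forall g : nat * nat, g \in sg -> 0 < g.1 <= g.2 /\ g.2 <= d.

Lemma bucket_uniq v : v < d ->
  uniq (map eid (bucket E v.+1) ++ map eid [seq e <- by_end E d | v.+1 < ehi e]).
Proof.
move=> vd; rewrite -map_cat -by_end_step //; apply: (subseq_uniq (map_subseq _ (filter_subseq _ _))).
by rewrite (perm_uniq (perm_map eid (perm_by_end E_hi))) E_id iota_uniq.
Qed.

Lemma bucket_head nxt h v : chain_to nxt h (map eid (bucket E v)) 0 ->
  (h == 0) = (bucket E v == [::]).
Proof.
have : forall e, e \in bucket E v -> 0 < eid e.
  by move=> e /mem_bucket/(map_f eid); rewrite E_id mem_iota => /andP[].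
case: (bucket E v) => [_ ->|e b /(_ e (mem_head _ _)) + [-> _]] //=; exact: gtn_eqF.
Qed.

Lemma tabled_step s v : v < d -> tabled s E sg d v.+1 ->
  tabled (run s (body table_loop)) E sg d v.
Proof.
case: s => Vs As vd [hE [hD hV hB hN] hC hu [hNd hT]].
have := table_step Vs As; cbv zeta; remember (run _ _) as s1 eqn:e1; clear e1.
rewrite /= in hE hD hV hB hN hC hu hNd hT; rewrite hV.
move=> [[hD1 hN1 hB1 hV1] [hC1 hX1] [a1 a2 a3 a4] [b1 b2 b3] [c1 c2 c3 c4]].
have [ch tl m1 m2] := hu v.+1 (leqnn _).
have hd := bucket_head ch.
have bdE : (if As aHEAD v.+1 == 0 then Vs vBD else v.+1) = first_end E d v.+1.
  have -> : first_end E d v.+1 = head d [seq ehi e | e <- bucket E v.+1 ++ [seq e <- by_end E d | v.+1 < ehi e]].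
    by rewrite -by_end_step.
  rewrite hd hB; case: eqP => [->//|/eqP].
  have : forall e, e \in bucket E v.+1 -> ehi e = v.+1.
    by move=> e; rewrite mem_rev mem_filter => /andP[/eqP].
  by case: (bucket E v.+1) => // e b /(_ e (mem_head _ _)) /= ->.
have he e : e \in bucket E v.+1 -> ehi e = v.+1 by rewrite mem_rev mem_filter => /andP[/eqP].
(* The cell relinked in this step is the tail of bucket [v.+1], or 0 if that is empty; neither
   occurs in a lower bucket, whose links are thus untouched. *)
have disj u : u <= v -> last 0 (map eid (bucket E v.+1)) \notin map eid (bucket E u).
  move=> uv; apply/negP => /mapP[e ein].
  case: (lastP (bucket E v.+1)) (@mem_bucket E v.+1) he => [|b e'] hb he; last first.
    rewrite map_rcons last_rcons => ee; have e'b : e' \in rcons b e' by rewrite mem_rcons mem_head.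
    have ee' : e' = e.
      apply: (@uniq_map_inj _ _ eid E) ee; first by rewrite E_id iota_uniq.
        exact: hb e'b.
      exact: mem_bucket ein.
    have := he _ e'b; rewrite ee'; move: ein; rewrite mem_rev mem_filter => /andP[/eqP -> _]; lia.
  move=> /= e0; have := mem_bucket ein; move/(map_f eid).
  by rewrite E_id -e0 mem_iota.
split.
- by move=> e ein; rewrite c1 c2 c3 c4; apply: hE.
- split; [by rewrite hD1|by rewrite hV1|by rewrite hB1 bdE|].
  rewrite hX1; have [n1 n2 n3] := hN; split.
  + move=> g gin vg; case: (ltngtP v.+1 g.1) => [lt|lt|eq]; [|lia|].
      by have := n1 g gin lt; case: ifP => //; lia.
    have := m1 g gin (esym eq); case: ifP => //; lia.
  + case: ifP => [/andP[m0 _] _|_ xd].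
      by exists (v.+1, As aMINR v.+1) => //; apply: m2; rewrite -lt0n.
    have [g gin [vg gx]] := n2 xd; exists g => //; split=> //; exact: ltnW.
  + by case: ifP => //; lia.
- rewrite hC1 a4 by_end_step // map_cat tl hd; case: eqP => [b0|/eqP b0].
    rewrite b0 /=; apply: chain_to_ext hC => i _ /=; by case: eqP => // ->.
  apply: chain_to_append ch _ (bucket_uniq vd) hC.
  by case: (bucket E v.+1) b0.
- move=> u uv; have [ch' tl' m1' m2'] := hu u (leqW uv).
  rewrite a4 b1 b2 b3; split=> //; apply: chain_to_ext ch' => i iin /=.
  rewrite tl; case: eqP => // il; case: ifP => [_|_]; first by rewrite il.
  by have := disj u uv; rewrite -il iin.
- split; first by rewrite a1 /=; case: eqP => //; lia.
  move=> u hu'; have [uv|uv] := eqVneq u v.+1.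
    rewrite uv /table_ok a1 a2 a3 /= eqxx; split=> //; rewrite bdE.
    (* The next greedy point ends an interval starting beyond [v.+1], so the table entries read
       there are not the ones just written. *)
    have nv : (Vs vNX == v.+1) = false.
      have [n1 n2 n3] := hN; apply/negP => /eqP nv.
      by have [|g gin [vg gx]] := n2; [lia|have := sg_hi gin; lia].
    by rewrite nv; case: (Vs vNX <= first_end E d v.+1).
  have uv' : v.+1 < u <= d by lia.
  have [t1 t2] := hT u uv'; rewrite /table_ok a1 a2 a3 /= (negbTE uv); split=> //.
  case: ifP t2 => // h; have nv : (As aNXT u == v.+1) = false; last by rewrite nv.
  have [n1 n2 n3] := t1; apply/negP => /eqP nv.
  by have [|g gin [vg gx]] := n2; [lia|have := sg_hi gin; lia].
Qed.

Lemma table_steps s v : v <= d -> tabled s E sg d v ->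
  exists s', [/\ steps table_loop v s s', vars s' vV = 0, tabled s' E sg d 0 & vars s' vN = vars s vN].
Proof.
elim: v s => [|v IH] s vd ht; first by exists s; split=> //; case: ht => _ [].
have [s' [st hV ht' hN]] := IH _ (ltnW vd) (tabled_step vd ht).
exists s'; split=> //; first by split=> //=; have [_ [_ -> _ _] _ _ _] := ht.
Qed.

Lemma table_loop_ok s : parsed (arrs s) E sg -> vars s vD = d ->
  exists s', [/\ run_loop table_loop d s s', tabled s' E sg d 0 & vars s' vN = vars s vN].
Proof.
case: s => Vs As [_ hE hc hm] hD; rewrite /= in hE hc hm hD.
set s0 := run (State Vs As) (init table_loop).
have ht : tabled s0 E sg d d.
  rewrite /s0 /run /= hD addn1; have b0 : [seq e <- by_end E d | d < ehi e] = [::].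
    by apply/eqP; rewrite -[_ == _]negbK -has_filter; apply/hasPn => e /by_end_le; rewrite -leqNgt.
  split; rewrite /= ?b0 //.
  - split=> //; first by rewrite /first_end /= b0.
    by split=> [g gin dg| |//]; [have := sg_hi gin; lia|rewrite ltnn].
  - by move=> u _; have [] := hc u; have [] := hm u.
  - by split=> [|u]; [rewrite eqxx|lia].
have [s' [st hV ht' hN]] := table_steps (leqnn d) ht.
by exists s'; split.
Qed.

End Table.

(** * The search loop *)

Definition entry (As : nat -> nat -> nat) k :=
  (As aTE k, As aTEB k, As aTB k, As aTP k, As aTC k, (As aTSV k, As aTPS k, As aTCS k)).

Ltac freeze x E := let y := eval unfold x in x in assert (E : x = y) by reflexivity;
  clearbody x.

Lemma branch_value (o : nat) (b1 b2 b3 : bool) :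
  (if o == 0 then 0 else if (if (b1 : nat) == 0 then 1 else 0) == 0 then 0
   else if (b2 : nat) == 0 then if (if b3 then 1 else 0) == 0 then 1 else 0 else 1)
  = [&& o != 0, ~~ b1 & b2 || ~~ b3].
Proof. by case: (o == 0); case: b1; case: b2; case: b3. Qed.

Lemma visit_step Vs As :
  let e := As aTE (Vs vSP) in
  let bit := upd (As aBIT) (As aTEB (Vs vSP)) (As aTB (Vs vSP)) in
  let r := As aEHI e in
  let pc := advance (As aNXT) (As aLL) (As aCNT) (As aTP (Vs vSP)) (As aTC (Vs vSP)) r in
  let qc := advance (As aNXT) (As aLL) (As aCNT) (As aTPS (Vs vSP)) (As aTCS (Vs vSP)) r in
  let sv := As aTSV (Vs vSP) in
  let h := (bit (As aEPREV e) != 0) || (As aELO e <= pc.1) in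
  let hs := ((bit (As aEPREV e) != 0) (+) (As aEPREV e == sv)) || (As aELO e <= qc.1) in
  let br := [&& As aEOPT e != 0, ~~ h & hs || ~~ (qc.2 + bit sv <= pc.2)] in
  let s' := run (State Vs As) visit in
  [/\ [/\ vars s' vD = Vs vD, vars s' vN = Vs vN, vars s' vSP = Vs vSP - 1, vars s' vCE = e & vars s' vNS = As aSNEXT e],
      [/\ vars s' vCP = pc.1, vars s' vCC = pc.2, vars s' vPS = qc.1, vars s' vCS = qc.2 & vars s' vSV = sv],
      [/\ vars s' vH = h, vars s' vHS = hs, vars s' vOP = As aEOPT e, vars s' vBR = br & vars s' vR = r],
      vars s' vANS = (if e == 0 then (Vs vANS != 0) || (pc.2 <= Vs vN) : nat else Vs vANS)
    & arrs s' = set_array As aBIT bit].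
Proof.
move=> e bit r pc qc sv h hs br s'.
have : s' = run (State Vs As) visit by [].
clearbody s'; rewrite /visit; do 25!exec1; rewrite /run /= => ->.
freeze h Eh; freeze hs Ehs; freeze br Ebr.
freeze pc Epc; freeze qc Eqc; freeze r Er; freeze bit Ebit; freeze sv Esv; freeze e Ee.
subst i v; rewrite -Ebit in EA; subst A; rewrite -Ee in Ev0; subst v0.
rewrite -Er in Ev7; rewrite -Esv in Ev3; subst v1 v3 v4 v7 v8 v9 v12 v15 v16 v19 v6.
have ifnat (b : bool) (k m : nat) : (if (if b then 1 else 0) == 0 then k else m) = if b then m else k.
  by case: b.
have eP : v11 = pc.1 by rewrite Ev11 ifnat subn_eq0 Epc /advance; case: ifP.
have eC : v10 = pc.2 by rewrite Ev10 Ev2 ifnat subn_eq0 addn1 Epc /advance; case: ifP.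
have eQ : v14 = qc.1 by rewrite Ev14 ifnat subn_eq0 Eqc /advance; case: ifP.
have eD : v13 = qc.2 by rewrite Ev13 Ev5 ifnat subn_eq0 addn1 Eqc /advance; case: ifP.
have eH : v17 = h.
  by rewrite Ev17 eP subn_eq0 Eh; case: eqP => //=; case: leqP.
have eS : v18 = hs.
  rewrite Ev18 Ehs eQ ifnat !subn_eq0.
  have -> : (if As aEPREV e <= sv then if sv <= As aEPREV e then 1 else 0 else 0) = (As aEPREV e == sv).
    by rewrite eqn_leq; case: (_ <= sv).
  by case: (As aEPREV e == sv); case: (bit _ == 0) => //=; case: (_ <= qc.1).
have eB : v21 = br by rewrite Ev21 Ev20 eH eS eD eC subn_eq0 Ebr; apply: branch_value.
split=> //=.
by rewrite Ev22 subn_eq0 eC; case: (e == 0) => //; case: (Vs vANS == 0) => //=; case: (_ <= _).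
Qed.

Lemma branch_step (Vs : nat -> nat) As (h hs br : bool) : Vs vH = h -> Vs vHS = hs -> Vs vBR = br ->
  let op := Vs vOP != 0 in
  let s' := run (State Vs As) branch in
  [/\ [/\ vars s' vD = Vs vD, vars s' vN = Vs vN, vars s' vANS = Vs vANS
        & vars s' vSP = if Vs vCE == 0 then Vs vSP else Vs vSP + (if br then 2 else 1)],
      forall a, a <= aBIT -> arrs s' a = As a
    & [/\ forall k, k <= Vs vSP -> entry (arrs s') k = entry As k,
        entry (arrs s') (Vs vSP + 1) = (Vs vNS, Vs vCE, if op then h : nat else 1,
          if op || h then Vs vCP else Vs vR, if op || h then Vs vCC else (Vs vCC).+1,
          (if br then Vs vCE else if op then 0 else Vs vSV,
           if br then Vs vR else if op then (Vs vD).+1 else if hs then Vs vPS else Vs vR,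
           if br then (Vs vCC).+1 else if op then 0 else if hs then Vs vCS else (Vs vCS).+1))
        & entry (arrs s') (Vs vSP + 2) = (Vs vNS, Vs vCE, 1, Vs vR, (Vs vCC).+1, (Vs vCE, Vs vCP, Vs vCC))]].
Proof.
move=> eH eS eB op s'; have : s' = run (State Vs As) branch by [].
clearbody s'; rewrite /branch /push [_ ++ _]/=; do 17!exec1; rewrite /run /= => ->.
subst; rewrite /entry /= eH eS eB.
have e12 : (Vs vSP + 1 == Vs vSP + 2) = false by lia.
split; [split=> //=|by move=> a; do 13!(case: a => [|a] //)|split=> [k hk||]]; rewrite /= ?eqxx ?e12.
- by case: br {eB}; case: (Vs vCE == 0).
- have h1 : (k == Vs vSP + 1) = false by apply/negP => /eqP; lia.
  have h2 : (k == Vs vSP + 2) = false by apply/negP => /eqP; lia.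
  by rewrite h1 h2.
- rewrite !addn1 /op; case: (Vs vOP == 0); case: h {eH}; case: hs {eS}; case: br {eB} => //=.
- by rewrite addn1.
Qed.

Lemma search_step Vs As :
  let sp := Vs vSP - 1 in let e := As aTE (Vs vSP) in
  let bit := upd (As aBIT) (As aTEB (Vs vSP)) (As aTB (Vs vSP)) in
  let r := As aEHI e in
  let pc := advance (As aNXT) (As aLL) (As aCNT) (As aTP (Vs vSP)) (As aTC (Vs vSP)) r in
  let qc := advance (As aNXT) (As aLL) (As aCNT) (As aTPS (Vs vSP)) (As aTCS (Vs vSP)) r in
  let sv := As aTSV (Vs vSP) in
  let h := (bit (As aEPREV e) != 0) || (As aELO e <= pc.1) in
  let hs := ((bit (As aEPREV e) != 0) (+) (As aEPREV e == sv)) || (As aELO e <= qc.1) in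
  let op := As aEOPT e != 0 in
  let br := [&& op, ~~ h & hs || ~~ (qc.2 + bit sv <= pc.2)] in
  let s' := run (State Vs As) (body search_loop) in
  [/\ [/\ vars s' vD = Vs vD, vars s' vN = Vs vN,
        vars s' vANS = (if e == 0 then (Vs vANS != 0) || (pc.2 <= Vs vN) : nat else Vs vANS)
        & vars s' vSP = if e == 0 then sp else sp + (if br then 2 else 1)],
      [/\ arrs s' aNXT = As aNXT, arrs s' aLL = As aLL, arrs s' aCNT = As aCNT & arrs s' aSNEXT = As aSNEXT],
      [/\ arrs s' aELO = As aELO, arrs s' aEHI = As aEHI, arrs s' aEPREV = As aEPREV
        & arrs s' aEOPT = As aEOPT],
      arrs s' aBIT = bit
    & [/\ forall k, k <= sp -> entry (arrs s') k = entry As k,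
        entry (arrs s') (sp + 1) = (As aSNEXT e, e, if op then h : nat else 1,
          if op || h then pc.1 else r, if op || h then pc.2 else pc.2.+1,
          (if br then e else if op then 0 else sv,
           if br then r else if op then (Vs vD).+1 else if hs then qc.1 else r,
           if br then pc.2.+1 else if op then 0 else if hs then qc.2 else qc.2.+1))
        & entry (arrs s') (sp + 2) = (As aSNEXT e, e, 1, r, pc.2.+1, (e, pc.1, pc.2))]].
Proof.
cbv zeta; rewrite -[body search_loop]/(visit ++ branch) /run foldl_cat -!/(run _ _).
have := visit_step Vs As; cbv zeta; case: (run _ visit) => V1 A1; cbn [vars arrs].
move=> [[f1 f2 f3 f4 f5] [f6 f7 f8 f9 f10] [f11 f12 f13 f14 f15] f16 ->].
have := branch_step (set_array As aBIT (upd (As aBIT) (As aTEB (Vs vSP)) (As aTB (Vs vSP)))) f11 f12 f14.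
cbv zeta; rewrite f1 f2 f3 f4 f5 f6 f7 f8 f9 f10 f13 f15 f16.
case: (run _ branch) => V2 A2; cbn [vars arrs].
move=> [[g1 g2 g3 g4] ga [e0 e1 e2]].
split; [by split|by rewrite !ga|by rewrite !ga|by rewrite ga|by split].
Qed.

Definition same_tables (s s0 : state) :=
  [/\ vars s vD = vars s0 vD /\ vars s vN = vars s0 vN,
    [/\ arrs s aNXT = arrs s0 aNXT, arrs s aLL = arrs s0 aLL, arrs s aCNT = arrs s0 aCNT
      & arrs s aSNEXT = arrs s0 aSNEXT]
    & [/\ arrs s aELO = arrs s0 aELO, arrs s aEHI = arrs s0 aEHI, arrs s aEPREV = arrs s0 aEPREV
      & arrs s aEOPT = arrs s0 aEOPT]].

(* [bit i] tells whether the variable of event [i] has been hit once event [i] is processed. *)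
Definition coherent (bit : nat -> nat) (Hf : nat -> bool) (es : seq event) :=
  forall e, e \in es -> eprev e \notin map eid es -> (bit (eprev e) != 0) = Hf (evar e).

(** The last clause lets the program decide whether the current variable is [x] by comparing its
    predecessor with the branching event [sv], and the first reads [b] off the bit of [sv]. *)
Definition sibling (bit : nat -> nat) (sv x : nat) (b : bool) (ps inf : nat) (es : seq event) :=
  ps = inf \/ [/\ bit sv = b, sv \notin map eid es
    & forall e, e \in es -> eprev e \notin map eid es -> (eprev e == sv) = (evar e == x)].

(** If the variables agree, [prev_ok] places the predecessor of [e1] in [e :: es]; not being in
    [es], it is [e]. *)
Lemma prev_ok_same e es e1 : prev_ok (e :: es) -> e1 \in es -> eprev e1 \notin map eid es ->
  (eprev e1 == eid e) = (evar e1 == evar e).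
Proof.
move=> [_ L1 _ L4 _] e1in np; apply/eqP/eqP => [|v]; first exact: L4.
by have := L1 _ e1in v; rewrite inE (negbTE np) orbF => /eqP.
Qed.

Lemma coherent_step bit bit' Hf e es b : prev_ok (e :: es) -> coherent bit Hf (e :: es) ->
  (forall i, i \notin map eid es -> i != eid e -> bit' i = bit i) ->
  coherent (upd bit' (eid e) (b : bool)) (setb Hf (evar e) b) es.
Proof.
move=> pe co hb e1 e1in np; rewrite /= /setb -(prev_ok_same pe e1in np).
case: (eqVneq (eprev e1)) => [_|ne]; first by case: b.
rewrite hb // co //; first by rewrite inE e1in orbT.
by rewrite inE negb_or ne.
Qed.

Lemma chain_to_head nxt h l z : chain_to nxt h l z -> h = head z l.
Proof. by case: l => [|x l] //= []. Qed.

Section Run.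

Variables (s0 : state) (all_es : seq event) (d n : nat).
Let nx := arrs s0 aNXT.
Let ll := arrs s0 aLL.
Let cc := arrs s0 aCNT.
Hypothesis D0 : vars s0 vD = d.
Hypothesis N0 : vars s0 vN = n.
Hypothesis hi0 : arrs s0 aEHI 0 = d.
Hypothesis nx_inf : nx d.+1 = d.+1.
Hypothesis ev0 : events_at (arrs s0) all_es.

(** A call of [search] is simulated by popping one entry and running until the stack is back below
    it. The frame clauses make the induction work: a subtree leaves lower entries alone and changes
    bits only of events still ahead and of [eb]. *)
Lemma search_run es : {subset es <= all_es} -> prev_ok es -> wf_events d es ->
  forall s sp Hf p c x b ps cs eb bb sv,
  same_tables s s0 -> vars s vSP = sp.+1 ->
  entry (arrs s) sp.+1 = (head 0 (map eid es), eb, bb, p, c, (sv, ps, cs)) ->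
  chain_to (arrs s0 aSNEXT) (head 0 (map eid es)) (map eid es) 0 ->
  coherent (upd (arrs s aBIT) eb bb) Hf es ->
  sibling (upd (arrs s aBIT) eb bb) sv x b ps d.+1 es ->
  eb \notin map eid es ->
  let t := search d n nx ll cc es Hf p c x b ps cs in
  exists s', [/\ steps search_loop (nodes t) s s', same_tables s' s0, vars s' vSP = sp,
    (vars s' vANS != 0) = (vars s vANS != 0) || accepts t
    & (forall k, k <= sp -> entry (arrs s') k = entry (arrs s) k) /\
      (forall i, i \notin map eid es -> i != eb -> arrs s' aBIT i = arrs s aBIT i)].
Proof.
elim: es => [|e es IH] sub pe wf s sp Hf p c x b ps cs eb bb sv st hsp hent hch hco hsib heb.
  clear hco hsib; case: s st hsp hent => Vs As [[/= stD stN] [st1 st2 st3 st4] [st5 st6 st7 st8]] hsp hent.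
  rewrite /entry in hent; case: hent => E1 E2 E3 E4 E5 E6 E7 E8.
  have F := search_step Vs As; cbv zeta in F; move: F; remember (run _ _) as s1 eqn:e1 => F.
  rewrite hsp subSS subn0 E1 E2 E3 E4 E5 st1 st2 st3 st6 hi0 stN N0 /= in F.
  move: F => [[f1 f2 f3 f4] [g1 g2 g3 g4] [g5 g6 g7 g8] fb [fk _ _]].
  exists s1; split.
  - by split; [rewrite /= hsp|rewrite e1].
  - by split; split; congruence.
  - exact: f4.
  - by rewrite f3; case: (_ || _).
  - split=> [k kp|i _ ib]; first by rewrite fk.
    by rewrite fb /= (negbTE ib).
have {}ein : e \in all_es by apply: sub; rewrite mem_head.
have [hlo hhi hprev hopt] := ev0 ein.
have [id0 L1 L2 L4 [idn pe']] := pe.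
have [/andP[lohi hiD] srt oE wf'] := wf.
have sub' : {subset es <= all_es} by move=> i iin; apply: sub; rewrite inE iin orbT.
have [_ hch'] := hch; have nE := chain_to_head hch'; rewrite nE in hch'.
have {}IH := IH sub' pe' wf'.
case: s st hsp hent hco hsib => Vs As [[/= stD stN] [st1 st2 st3 st4] [st5 st6 st7 st8]] hsp hent.
rewrite /entry in hent; case: hent => E1 E2 E3 E4 E5 E6 E7 E8.
set bit := upd _ eb bb => hco hsib.
have F := search_step Vs As; cbv zeta in F; move: F; remember (run _ _) as s1 eqn:e1.
rewrite hsp subSS subn0 E1 E2 E3 E4 E5 E6 E7 E8 st1 st2 st3 st4 st5 st6 st7 st8 stN N0 stD D0.
rewrite hlo hhi hprev hopt -/bit (gtn_eqF id0) nE.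
rewrite -/nx -/ll -/cc; set pc := advance nx ll cc p c _; set qc := advance nx ll cc ps cs _.
rewrite (hco e (mem_head _ _) L2).
set h := Hf (evar e) || (elo e <= pc.1).
pose hs := (Hf (evar e) (+) (evar e == x)) || (elo e <= qc.1).
(* For a fictitious sibling [sv] carries no information; its position alone forces [hs], so that
   neither test depends on [sv]. *)
have inf_hs : ps = d.+1 -> qc = (d.+1, cs) /\ hs.
  move=> pinf; have qE : qc = (d.+1, cs) by rewrite /qc pinf advance_inf.
  by rewrite /hs qE /=; split=> //; apply/orP; right; lia.
have -> : (Hf (evar e) (+) (eprev e == sv)) || (elo e <= qc.1) = hs.
  case: hsib => [/inf_hs[qE hsT]|[_ _ ->]] //; last by rewrite mem_head.
  by rewrite hsT qE /=; apply/orP; right; lia.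
have -> : hs || ~~ (qc.2 + bit sv <= pc.2) = hs || ~~ (qc.2 + b <= pc.2).
  by case: hsib => [/inf_hs[_ ->]|[-> _ _]].
move=> [[f1 f2 f3 f4] [g1 g2 g3 g4] [g5 g6 g7 g8] fb [fk fe1 fe2]].
have st' : same_tables s1 s0.
  by split; [split; congruence|split; rewrite ?g1 ?g2 ?g3 ?g4|split; congruence].
have stp t s2 : steps search_loop t s1 s2 -> steps search_loop t.+1 (State Vs As) s2.
  by move=> hst; split; [rewrite /= hsp|rewrite -e1].
have out i : i \notin map eid (e :: es) -> i != eb -> i \notin map eid es /\ arrs s1 aBIT i = As aBIT i.
  rewrite /= inE negb_or => /andP[ie ni] ib; split=> //.
  by rewrite fb /bit /= (negbTE ib).
have co b1 : coherent (upd (arrs s1 aBIT) (eid e) (b1 : bool)) (setb Hf (evar e) b1) es.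
  by apply: coherent_step hco _ => // i _ _; rewrite fb.
rewrite /= -/pc -/qc -/h -/hs.
case: (boolP (eopt e)) => o /=; last first.
  rewrite (negbTE o) /= in f4 fe1.
  have [|||s2 [t1 t2 t3 t4 [t5 t6]]] := IH s1 sp (setb Hf (evar e) true)
    (if h then pc.1 else ehi e) (if h then pc.2 else pc.2.+1) x b
    (if hs then qc.1 else ehi e) (if hs then qc.2 else qc.2.+1) (eid e) 1 sv st' _ _ hch' (co true) _ idn.
  - by rewrite f4 addn1.
  - by rewrite -addn1.
  - case: hsib => [/inf_hs[qE ->]|[b1 b2 b3]]; first by left; rewrite qE.
    move: b2; rewrite /= inE negb_or => /andP[b2 b2']; right; split=> //=.
      by rewrite (negbTE b2) fb.
    move=> e' e'in np; apply: b3; first by rewrite inE e'in orbT.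
    (* [e] is the last event of its variable, hence the predecessor of no later event: a predecessor
       outside [es] is also outside [e :: es]. *)
    rewrite /= inE negb_or np andbT; apply/negP => /eqP pee.
    by move: o; rewrite oE => /hasPn/(_ _ e'in); rewrite (L4 _ e'in pee) eqxx.
  exists s2; split; [exact: stp|by []|by []|by rewrite t4 f3|split].
    by move=> k kp; rewrite t5 // fk.
  by move=> i ni ib; have [ni' <-] := out i ni ib; apply: t6 => //; move: ni; rewrite /= inE negb_or => /andP[].
rewrite o /= in f4 fe1; case: ifPn => hd.
  have brF : ~~ h && (hs || ~~ (qc.2 + b <= pc.2)) = false.
    by case: (h) hd => //=; case: (hs) => //= ->.
  rewrite brF /= in f4 fe1.
  have [|||s2 [t1 t2 t3 t4 [t5 t6]]] := IH s1 sp (setb Hf (evar e) h) pc.1 pc.2 0 true d.+1 0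
    (eid e) h 0 st' _ _ hch' (co h) _ idn.
  - by rewrite f4 addn1.
  - by rewrite -addn1.
  - by left.
  exists s2; split; [exact: stp|by []|by []|by rewrite t4 f3|split].
    by move=> k kp; rewrite t5 // fk.
  by move=> i ni ib; have [ni' <-] := out i ni ib; apply: t6 => //; move: ni; rewrite /= inE negb_or => /andP[].
move: hd; rewrite negb_or negb_and negbK => /andP[/negbTE hF hd].
rewrite hF hd /= in f4 fe1.
have sib bit' b1 ps1 : sibling (upd bit' (eid e) (b1 : bool)) (eid e) (evar e) b1 ps1 d.+1 es.
  right; split=> [||e' e'in np] //=; first by rewrite eqxx.
  exact: prev_ok_same pe e'in np.
(* The placing child runs first, from the top of the stack, and leaves the entry at [sp.+1] for the
   postponing child. *)
have [||s2 [t1 t2 t3 t4 [t5 t6]]] := IH s1 sp.+1 (setb Hf (evar e) true) (ehi e) pc.2.+1 (evar e) true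
    pc.1 pc.2 (eid e) 1 (eid e) st' _ _ hch' (co true) (sib _ true _) idn.
- by rewrite f4 addn2.
- by rewrite -addn2.
(* The first subtree did not touch the bits of processed events other than [e], and the bit of [e]
   is rewritten when the second entry is popped. *)
have co2 : coherent (upd (arrs s2 aBIT) (eid e) false) (setb Hf (evar e) false) es.
  apply: coherent_step hco _ => // i ni ie; by rewrite t6 // fb.
have [|s3 [u1 u2 u3 u4 [u5 u6]]] := IH s2 sp (setb Hf (evar e) false) pc.1 pc.2 (evar e) false
    (ehi e) pc.2.+1 (eid e) 0 (eid e) t2 t3 _ hch' co2 (sib _ false _) idn.
- by rewrite t5 // -addn1.
exists s3; split; [by apply: stp; apply: steps_cat t1 u1|by []|by []|by rewrite u4 t4 f3 orbA|split].
  by move=> k kp; rewrite u5 // t5 ?fk // leqW.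
move=> i ni ib; have [ni' <-] := out i ni ib.
by move: ni; rewrite /= inE negb_or => /andP[ie _]; rewrite u6 ?t6.
Qed.

End Run.

(** * Correctness and running time *)

Lemma sum_size_excess d ivs : all (wf_domain d) ivs ->
  \sum_(iv <- ivs) size iv = size ivs + excess ivs.
Proof.
rewrite /excess; elim: ivs => [|iv ivs IH] /=; first by rewrite !big_nil.
by move=> /andP[/and3P[sz _ _] /IH]; rewrite !big_cons; lia.
Qed.

Section Solve.

Variables (d n : nat) (ivs : seq (seq (nat * nat))).
Hypothesis wf : all (wf_domain d) ivs.
Let E := all_events ivs 1.
Let sg := singles ivs.
Let es := by_end E d.

Lemma event_bounds e : e \in E -> [/\ 0 < eid e, elo e <= ehi e & ehi e <= d].
Proof. by case/(all_events_mem wf) => _ /andP[? _] [/andP[_ ?] ?]. Qed.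

Lemma event_ends : all (fun e => 0 < ehi e <= d) E.
Proof. by apply/allP => e /(all_events_mem wf)[_ _ [/andP[l0 lh] hd]]; rewrite hd (leq_trans l0). Qed.

Lemma sorted_perm : perm_eq es E. Proof. exact: perm_by_end event_ends. Qed.

Lemma sorted_wf : wf_events d es /\ prev_ok es.
Proof.
apply: (chained_sorted (all_events_chained wf (ltn0Sn 0)) event_bounds _ sorted_perm (by_end_pairwise _ _)).
by rewrite all_events_eid iota_uniq.
Qed.

Lemma single_bounds (g : nat * nat) : g \in sg -> 0 < g.1 <= g.2 /\ g.2 <= d.
Proof. exact: singles_mem wf. Qed.

Lemma parse_ok s : (forall i, i != 0 -> i != 2 -> arrs s aINP i = nth 0 ([:: size ivs; d; 0; n] ++ records ivs) i) ->
  (forall a i, 0 < a < 32 -> arrs s a i = 0) ->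
  exists s', [/\ run_loop parse_loop (\sum_(iv <- ivs) size iv) s s', parsed (arrs s') E sg,
    vars s' vD = d & vars s' vN = n].
Proof.
case: s => Vs As /= hi h0; set s1 := run (State Vs As) (init parse_loop).
have [|||||s' [st p hD hN hC]] := parse_all (s := s1) (E := [::]) (sg := [::]) wf.
- by rewrite /= hi // -nth0.
- by [].
- by [].
- by move=> i; rewrite /= hi // nth_behead.
- split=> //= v; first by rewrite !h0.
  by split=> //; rewrite h0.
by exists s'; split; rewrite ?hD ?hN //= hi.
Qed.

Lemma search_ok s : tabled s E sg d 0 -> vars s vN = n -> map eid E = iota 1 (size E) ->
  exists k s', [/\ run_loop search_loop k s s', k <= (size es).+1 * fib (excess ivs).+2
    & (vars s' vANS != 0) <-> exists pts, size pts <= n /\ all (hits pts) ivs].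
Proof.
case: s => Vs As [hE [/= hD hV hB hN] hC hu [hNd hT]] /= hn Eid.
set s0 := run (State Vs As) (init search_loop).
pose nx := upd (As aNXT) 0 (Vs vNX).
have [wfe pok] := sorted_wf.
have ev0 : events_at (arrs s0) es.
  move=> e; rewrite (perm_mem sorted_perm) => ein; rewrite /= ?addn1.
  have [id0 _ _] := event_bounds ein; rewrite (gtn_eqF id0).
  exact: hE.
have es0 : [seq e <- es | 0 < ehi e] = es.
  by apply/all_filterP/allP => e; rewrite (perm_mem sorted_perm) => /(allP event_ends)/andP[].
rewrite -/es es0 in hC.
have cuE := chain_to_head hC.
have nxd : nx d.+1 = d.+1 by rewrite /nx /=.
(* Initially only events without predecessor matter; they refer to index 0, whose bit is 0 for not
   hit. *)
have coh : coherent (upd (As aBIT) 0 0) (fun=> false) es.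
  move=> e ein np /=; have [_ _ H3] := all_events_chained wf (ltn0Sn 0).
  rewrite (perm_mem sorted_perm) in ein; case: (H3 e ein) => [[-> _] //|[e' e'in [_ ide _]]].
  by case/negP: np; rewrite -ide; apply: map_f; rewrite (perm_mem sorted_perm).
have [|||||||||||s' [st _ hSP hANS _]] := search_run (s0 := s0) (all_es := es) (d := d) (n := n)
  _ _ _ _ ev0 (fun e h => h) pok wfe (s := s0) (sp := 0) (Hf := fun=> false) (p := 0) (c := 0)
  (x := 0) (b := true) (ps := d.+1) (cs := 0) (eb := 0) (bb := 0) (sv := 0).
- exact: hD.
- exact: hn.
- by rewrite /= hD.
- exact: nxd.
- by split.
- by [].
- by rewrite /= /entry /= addn1 hD cuE.
- by rewrite -cuE.
- exact: coh.
- by left.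
- apply/mapP => -[e]; rewrite (perm_mem sorted_perm) => /event_bounds[id0 _ _] h; by rewrite -h in id0.
set t := search _ _ _ _ _ _ _ _ _ _ _ _ _ in st hANS.
exists (nodes t), s'; split.
- by split; rewrite //= hSP.
- rewrite /t; have [h _] := search_nodes n (arrs s0 aLL) (arrs s0 aCNT) nxd wfe.
  by apply: leq_trans (h _ _ _ _ _ _) _; rewrite (permP sorted_perm) all_events_count.
rewrite hANS /=.
have nxP p : p <= d -> next_end sg d p (nx p).
  case: p => [//|p] pd; have [|h _] := hT p.+1; first lia.
  by rewrite /nx /=.
have [|||||||h _] := @search_correct d n sg nx (arrs s0 aLL) (arrs s0 aCNT) (first_end E d)
  _ _ _ nxd _ es 0 wfe _ _ _.
- by move=> g /single_bounds[/andP[_ ->] ->].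
- by move=> p g pd gin pg; have [h _ _] := nxP p pd; apply: h.
- by move=> p pd; have [_ h _] := nxP p pd.
- move=> q /andP[q0 qd]; have [|_] := hT q; first by rewrite q0.
  by rewrite /nx /= (gtn_eqF q0).
- by [].
- by [].
- by [].
have -> : accepts t <-> feasible n sg (fun=> false) 0 0 es.
  (* The invariant [0 < nx 0] holds at the start because shifted intervals end at 1 or later. *)
  apply: h => //; have [h1 h2 _] := nxP 0 (leq0n d).
  case: (posnP (nx 0)) => // nx0; have [|g gin [g0 gx]] := h2; first by rewrite nx0.
  by have [/andP[_ gh] _] := single_bounds gin; rewrite gx nx0 in gh; lia.
exact: feasible_start wf sorted_perm.
Qed.

Lemma loops_ok s : (forall i, i != 0 -> i != 2 -> arrs s aINP i = nth 0 ([:: size ivs; d; 0; n] ++ records ivs) i) ->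
  (forall a i, 0 < a < 32 -> arrs s a i = 0) ->
  exists k s', [/\ run_loops loops k s s',
      k <= size ivs + d + excess ivs + (2 * excess ivs).+1 * fib (excess ivs).+2
    & (vars s' vANS != 0) <-> exists pts, size pts <= n /\ all (hits pts) ivs].
Proof.
move=> hi h0; have [s1 [r1 p1 hD1 hN1]] := parse_ok hi h0.
have Eid : map eid E = iota 1 (size E) by apply: all_events_eid.
have [s2 [r2 t2 hN2]] := table_loop_ok Eid event_ends single_bounds p1 hD1.
have [k [s3 [r3 hk hA]]] := search_ok t2 (etrans hN2 hN1) Eid.
exists (\sum_(iv <- ivs) size iv + (d + (k + 0))), s3; split=> //.
  exists (\sum_(iv <- ivs) size iv), (d + (k + 0)), s1; split=> //.
  exists d, (k + 0), s2; split=> //.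
  by exists k, 0, s3.
rewrite (sum_size_excess wf) addn0.
have : (size es).+1 * fib (excess ivs).+2 <= (2 * excess ivs).+1 * fib (excess ivs).+2.
  by rewrite leq_mul2r ltnS (perm_size sorted_perm) (all_events_size _ wf) orbT.
lia.
Qed.

End Solve.

Definition epilogue pc := [:: IConst 0 0; IJz vANS.+1 (pc + 3); IConst 0 1].

Definition program :=
  let c := comp_loops (size prologue) loops in
  prologue ++ c ++ epilogue (size prologue + size c).

Lemma program_code_at :
  let pc := size prologue + size (comp_loops (size prologue) loops) in
  [/\ code_at program 0 prologue, code_at program (size prologue) (comp_loops (size prologue) loops)
    & code_at program pc (epilogue pc)].
Proof.
split; [exact: code_at0|exact: code_at_prefix|].
rewrite /program catA -size_cat -[X in code_at (_ ++ X)]cats0; exact: code_at_prefix.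
Qed.

Lemma program_end :
  nth IHalt program (size prologue + size (comp_loops (size prologue) loops) + 3) = IHalt.
Proof.
have -> : program = (prologue ++ comp_loops (size prologue) loops) ++
  epilogue (size prologue + size (comp_loops (size prologue) loops)) by rewrite -catA.
by rewrite nth_default // !size_cat.
Qed.

(** Cell 2 holds the sign flag, and the first instruction tests it before anything is
    overwritten. *)
Lemma program_neg hdr w : nth 0 hdr 2 != 0 ->
  exists2 m', m' 0 = 0 & exec program 3 0 (init_mem (hdr ++ w)) = Some m'.
Proof.
move=> h; exists (upd (init_mem (hdr ++ w)) 0 0) => //.
have [c1 _ _] := program_code_at; have [c _] := code_at_cat c1.
have [i0 /code_at_cons[i1 /code_at_cons[i2 _]]] := code_at_cons c.
have h2 : init_mem (hdr ++ w) 2 != 0.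
  by rewrite /init_mem nth_cat; case: ltnP h => // h2; rewrite nth_default.
by rewrite /exec i0 (negbTE h2) i1 i2.
Qed.

Opaque program.

Lemma size_records d ivs : all (wf_domain d) ivs ->
  size (records ivs) = 3 * size ivs + 2 * excess ivs.
Proof.
rewrite /excess; elim: ivs => [|iv ivs IH]; first by rewrite big_nil.
move=> /andP[/and3P[sz _ _] /IH {}IH]; rewrite big_cons.
rewrite -[records _]/(record_of iv ++ records ivs) size_cat size_record IH [size (_ :: _)]/=; lia.
Qed.

Definition loops_size := size (comp_loops (size prologue) loops).

Lemma epilogue_ok P pc s B m : code_at P pc (epilogue pc) -> nth IHalt P (pc + 3) = IHalt ->
  represents B s m ->
  exists m' : nat -> nat, m' 0 = (vars s vANS != 0) /\ exec P 4 pc m = Some m'.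
Proof.
move=> /code_at_cons[i1 /code_at_cons[i2 /code_at_cons[i3 _]]] i4 [_ _ hv _].
have e k m' : reach P pc m k (pc + 3) m' -> k <= 3 -> exec P 4 pc m = Some m'.
  move=> r k3; rewrite (_ : 4 = k + (3 - k).+1); last by lia.
  by rewrite r /= i4.
have r3 := reach_const m i1; have r4 := reach_jz (upd m 0 0) i2.
rewrite upd_other // hv // in r4; case: eqP r4 => ans r4.
  exists (upd m 0 0); split=> //; apply: (e (1 + 1)) => //; exact: reach_trans r3 r4.
exists (upd (upd m 0 0) 0 1); split=> //; apply: (e (1 + (1 + 1))) => //.
by rewrite addn3; apply: reach_trans r3 (reach_trans r4 _); exact: reach_const i3.
Qed.

Lemma program_ok d n ivs : all (wf_domain d) ivs ->
  let x := excess ivs in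
  exists t m', [/\ exec program t 0 (init_mem ([:: size ivs; d; 0; n] ++ records ivs)) = Some m',
    t <= (350 + 4 * loops_size) * (size ivs + d + x + 1 + x * x * fib x.+2)
    & exists2 b : bool, m' 0 = b & b <-> exists pts, size pts <= n /\ all (hits pts) ivs].
Proof.
move=> wf x; set w := _ ++ _; have [c1 c2 c3] := program_code_at.
have iend := program_end.
have nz : all (fun iv : seq (nat * nat) => 0 < size iv) ivs by apply: sub_all wf => iv /andP[].
have [k1 [m1 [B [s [hk1 r1 hr1 [hi h0]]]]]] := @prologue_ok program [:: size ivs; d; 0; n] ivs (init_mem w) c1
  erefl nz (fun=> erefl) erefl.
have [k2 [s2 [hl hk2 hA]]] := loops_ok wf hi h0.
have [k3 [m2 [hk3 r2 hr2]]] := comp_loops_ok loops_fit c2 hr1 hl.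
have [m3 [m30 r3]] := epilogue_ok c3 iend hr2.
have r := reach_trans r1 r2; rewrite -/loops_size in hk3.
exists (k1 + k3 + 4), m3; split.
- by rewrite r r3.
(* With this length the prologue and the epilogue cost at most [288 + 63 * size ivs + 42 * x], which
   the constant 350 covers. *)
- have sw : size w = 4 + 3 * size ivs + 2 * x.
    by rewrite /w size_cat (size_records wf) addnA.
  rewrite sw in hk1.
  (* For positive [x] one has [2 * x + 1 <= 3 * x * x]; the summand 1 is the case [x = 0]. *)
  have hx : (2 * x).+1 * fib x.+2 <= 1 + 3 * (x * x * fib x.+2).
    by case: (x) => [|y]; [|nia].
  rewrite -/x in hk2; set F := x * x * fib x.+2 in hx *; set G := _ * fib _ in hx hk2.
  have : (k2 + size loops) * loops_size <= 4 * (size ivs + d + x + 1 + F) * loops_size.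
    by rewrite leq_mul2r; apply/orP; right; have -> : size loops = 3 by []; lia.
  lia.
- by exists (vars s2 vANS != 0).
Qed.

(** * From Fibonacci numbers to powers of the golden ratio *)

Section Phi.

Local Open Scope R_scope.

Lemma phi_sqr : phi * phi = phi + 1.
Proof.
rewrite /phi; have : sqrt 5 * sqrt 5 = 5 by apply: sqrt_sqrt; lra.
nra.
Qed.

Lemma phi_ge1 : 1 <= phi.
Proof.
have : sqrt 1 <= sqrt 5 by apply: sqrt_le_1; lra.
by rewrite sqrt_1 /phi; lra.
Qed.

(** The factor 2 covers the base values [fib 2 = 1] and [fib 3 = 2] using only [phi >= 1];
    afterwards both sides obey the same recurrence, since [phi * phi = phi + 1]. *)
Lemma fib_phi x : INR (fib x.+2) <= 2 * phi ^ x.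
Proof.
have p1 := phi_ge1.
suff [] : INR (fib x.+2) <= 2 * phi ^ x /\ INR (fib x.+3) <= 2 * phi ^ x.+1 by [].
elim: x => [|x [IH1 IH2]]; first by split; rewrite /fib /=; lra.
split=> //; rewrite fibSS plus_INR.
have -> : phi ^ x.+2 = phi ^ x.+1 + phi ^ x by rewrite /= -Rmult_assoc phi_sqr; ring.
lra.
Qed.

Lemma fib_bound a x k t K : (x <= k)%nat -> (t <= K * (a + x + 1 + x * x * fib x.+2))%nat ->
  INR t <= 2 * INR K * (phi ^ k * INR (k * k) + INR (a + k + 1)).
Proof.
move=> /leP xk /leP/le_INR tK; apply: Rle_trans tK _.
rewrite -!multE -!plusE !mult_INR !plus_INR !mult_INR.
have K0 := pos_INR K; have a0 := pos_INR a; have x0 := pos_INR x.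
have xk' := le_INR _ _ xk; have p1 := phi_ge1.
have hf := fib_phi x; have pk : phi ^ x <= phi ^ k by apply: Rle_pow.
have p0 : 0 <= phi ^ x by apply: pow_le; lra.
have f0 := pos_INR (fib x.+2).
have xx : INR x * INR x <= INR k * INR k by apply: Rmult_le_compat.
have xx0 : 0 <= INR x * INR x by apply: Rmult_le_pos.
have h1 : INR x * INR x * INR (fib x.+2) <= INR k * INR k * (2 * phi ^ k).
  by apply: Rmult_le_compat => //; lra.
have main : INR a + INR x + INR 1 + INR x * INR x * INR (fib x.+2) <=
    2 * (phi ^ k * (INR k * INR k) + (INR a + INR k + INR 1)) by rewrite [INR 1]/=; lra.
by apply: Rle_trans (Rmult_le_compat_l _ _ _ K0 main) _; right; ring.
Qed.

End Phi.

Theorem theorem9 :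
  exists (P : seq instr) (c : R),
    forall (n d : nat) (dom : 'I_n -> {set 'I_d}) (N : Z),
      (forall x : 'I_n, dom x != set0) ->
      let k := total_holes dom in
      exists (t : nat) (m' : nat -> nat),
        exec P t 0 (init_mem (encode dom N)) = Some m' /\
        ((m' 0 = 1 /\ consistent dom N) \/ (m' 0 = 0 /\ ~ consistent dom N)) /\
        Rle (INR t) (Rmult c (Rplus (Rmult (pow phi k) (INR (k * k))) (INR (n + d + k + 1)))).
Proof.
pose K := 350 + 4 * loops_size.
exists program, (Rmult 2 (INR K)) => n d dom N dom0 k.
set ivs := [seq intervals (dom x) | x <- enum 'I_n].
have wf : all (wf_domain d) ivs by apply/allP => _ /mapP[x _ ->]; apply: intervals_wf.
have sz : size ivs = n by rewrite size_map size_enum_ord.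
have xk : excess ivs <= k by apply: excess_holes.
rewrite encode_records -/ivs; case: Z.ltb_spec => N0.
  (* For a negative bound the flag is 1 and the program answers 0 after three instructions: no set
     has negative size. *)
  have [m' m0 ex] := @program_neg [:: n; d; 1; Z.abs_nat N] (records ivs) erefl.
  exists 3, m'; split=> //; split.
    right; split=> // -[S [SN _]]; lia.
  by apply: (@fib_bound (n + d) 0 k 3 K) => //; rewrite /K; lia.
have [t [m' [ex ht [b m0 hb]]]] := program_ok (Z.abs_nat N) wf.
rewrite sz in ex ht; exists t, m'; split=> //; split; last exact: fib_bound xk ht.
rewrite m0; have hc := consistent_hits dom N0.
by case: (b) hb => hb; [left|right]; split=> //; rewrite hc -/ivs -hb.
Qed.
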